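(* Let $G$ be a locally profinite group, $k$ a unital commutative ring, and $\mathcal U\subseteq\mathcal V$ two open compact subgroups of $G$. Then: (1) (Projection formula) for all $A\in E^i_{\mathcal U}$ and $B\in E^j_{\mathcal V}$, $$C^{i+j}_{\mathcal U,\mathcal V}\big(A\cup R^j_{\mathcal V,\mathcal U}(B)\big)=C^i_{\mathcal U,\mathcal V}(A)\cup B \quad\text{in } E^{i+j}_{\mathcal V}.$$ (2) $\mathcal J_{\mathcal U}\circ R^*_{\mathcal V,\mathcal U}=R^*_{\mathcal V,\mathcal U}\circ\mathcal J_{\mathcal V}$ as maps $E^*_{\mathcal V}\to E^*_{\mathcal U}$, and $\mathcal J_{\mathcal V}\circ C^*_{\mathcal U,\mathcal V}=C^*_{\mathcal U,\mathcal V}\circ\mathcal J_{\mathcal U}$ as maps $E^*_{\mathcal U}\to E^*_{\mathcal V}$.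
   Context: For an open compact subgroup $\mathcal U$: $\mathbf X_{\mathcal U}$ is the space of compactly supported functions $G\to k$ constant on left cosets $g\mathcal U$, with $G$ acting by left translation; $\mathbf X_{\mathcal U}(g)$ is the subspace of functions supported on $\mathcal Ug\mathcal U$; $\mathcal U_g:=\mathcal U\cap g\mathcal Ug^{-1}$; $E^*_{\mathcal U}:=\mathrm{Ext}^*_{\mathrm{Mod}(G)}(\mathbf X_{\mathcal U},\mathbf X_{\mathcal U})^{\mathrm{op}}\cong H^*(\mathcal U,\mathbf X_{\mathcal U})=\bigoplus_{g\in\mathcal U\backslash G/\mathcal U}H^*(\mathcal U,\mathbf X_{\mathcal U}(g))$, where $\mathrm{Mod}(G)$ is the category of smooth $G$-representations over $k$. Cup product: $\cup:E^i_{\mathcal U}\otimes_kE^j_{\mathcal U}\to E^{i+j}_{\mathcal U}$ is induced on $H^*(\mathcal U,\mathbf X_{\mathcal U})$ by pointwise multiplication of functions $\mathbf X_{\mathcal U}\otimes_k\mathbf X_{\mathcal U}\to\mathbf X_{\mathcal U}$. For $\mathcal U\subseteq\mathcal V$: $\iota_{\mathcal V,\mathcal U}:\mathbf X_{\mathcal V}\hookrightarrow\mathbf X_{\mathcal U}$ is the inclusion ($\mathrm{char}_{\mathcal V}\mapsto\mathrm{char}_{\mathcal V}$), and $\pi_{\mathcal U,\mathcal V}:\mathbf X_{\mathcal U}\twoheadrightarrow\mathbf X_{\mathcal V}$ is the $G$-equivariant map with $\mathrm{char}_{\mathcal U}\mapsto\mathrm{char}_{\mathcal V}$. Define $R^*_{\mathcal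 V,\mathcal U}:E^*_{\mathcal V}\to E^*_{\mathcal U}$, $f\mapsto\iota_{\mathcal V,\mathcal U}\circ f\circ\pi_{\mathcal U,\mathcal V}$, and $C^*_{\mathcal U,\mathcal V}:E^*_{\mathcal U}\to E^*_{\mathcal V}$, $f\mapsto\pi_{\mathcal U,\mathcal V}\circ f\circ\iota_{\mathcal V,\mathcal U}$ (Yoneda compositions with degree $0$ morphisms). Involution: with $\mathrm{Sh}^{\mathcal U}_g:H^*(\mathcal U,\mathbf X_{\mathcal U}(g))\cong H^*(\mathcal U_g,k)$ the Shapiro isomorphism (restriction to $\mathcal U_g$ followed by evaluation of coefficients at $g$), $\mathcal J_{\mathcal U}:E^*_{\mathcal U}\to E^*_{\mathcal U}$ is the linear map sending $H^*(\mathcal U,\mathbf X_{\mathcal U}(g))$ to $H^*(\mathcal U,\mathbf X_{\mathcal U}(g^{-1}))$ via $(\mathrm{Sh}^{\mathcal U}_{g^{-1}})^{-1}\circ(g^{-1})_*\circ\mathrm{Sh}^{\mathcal U}_g$, where $(g^{-1})_*:H^*(\mathcal U_g,k)\to H^*(\mathcal U_{g^{-1}},k)$ is conjugation. *)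

(* Defs.v *)
From HB Require Import structures.
From mathcomp Require Import all_boot all_algebra.
From mathcomp Require Import all_classical.
From mathcomp Require Import generic_quotient ring_quotient topology.
From mathcomp Require Import zify.

Set Implicit Arguments.
Unset Strict Implicit.
Unset Printing Implicit Defensive.

Import GRing.Theory.
Local Open Scope classical_set_scope.
Local Open Scope quotient_scope.
Local Open Scope ring_scope.

(** * Topological groups *)

HB.mixin Record isTopologicalGroup G of Group G & Topological G := {
  mulg_continuous : continuous (fun xy : G * G => (xy.1 * xy.2)%g) ;
  invg_continuous : continuous (fun x : G => (x^-1)%g)
}.

#[short(type="topGroupType")]
HB.structure Definition TopologicalGroup :=
  { G of isTopologicalGroup G & Group G & Topological G }.

Record subgroup (G : groupType) := Subgroup {
  sg_set : set G ;
  sg1 : sg_set 1%g ;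
  sgM : forall x y, sg_set x -> sg_set y -> sg_set (x * y)%g ;
  sgV : forall x, sg_set x -> sg_set (x^-1)%g
}.

Definition sg_type (G : groupType) (H : subgroup G) : Type :=
  {x : G | x \in sg_set H}.
Coercion sg_type : subgroup >-> Sortclass.

Section SubgroupType.
Variables (G : topGroupType) (H : subgroup G).

HB.instance Definition _ := SubChoice.on (sg_type H).

Fact sg_group_closed : group_closed (fun x : G => x \in sg_set H).
Proof.
split; first by apply/mem_set/sg1.
by move=> x y /set_mem Hx /set_mem Hy; apply/mem_set/sgM => //; exact: sgV.
Qed.

HB.instance Definition _ :=
  SubChoice_isSubGroup.Build G (fun x : G => x \in sg_set H) (sg_type H)
    sg_group_closed.

HB.instance Definition _ :=
  Topological.copy (sg_type H) (initial_topology (\val : sg_type H -> G)).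

Lemma sg_nbhsP (x : H) (A : set H) :
  nbhs x A <-> exists2 B : set G, nbhs (\val x) B & \val @^-1` B `<=` A.
Proof.
split=> [[_ [[B oB <-] Bx BA]]|[B]].
  by exists B => //; exact: open_nbhs_nbhs.
rewrite nbhsE => -[C [oC Cx] CB] BA; exists (\val @^-1` C); split=> //; first by exists C.
by move=> y /CB /BA.
Qed.

Fact sg_mul_continuous : continuous (fun xy : H * H => (xy.1 * xy.2)%g).
Proof.
move=> [x y] A /sg_nbhsP[B Bxy BA].
have /= [[B1 B2] /= [B1x B2y] B12] := @mulg_continuous G (\val x, \val y) B Bxy.
exists (\val @^-1` B1, \val @^-1` B2) => /=.
  by split; apply/sg_nbhsP; [exists B1|exists B2].
by move=> [a b] /= [B1a B2b]; apply: BA; apply: (B12 (_, _)).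
Qed.

Fact sg_inv_continuous : continuous (fun x : H => (x^-1)%g).
Proof.
move=> x A /sg_nbhsP[B Bx BA]; apply/sg_nbhsP.
exists ((fun y : G => (y^-1)%g) @^-1` B); first exact: invg_continuous.
by move=> y By; exact: BA.
Qed.

HB.instance Definition _ :=
  isTopologicalGroup.Build (sg_type H) sg_mul_continuous sg_inv_continuous.

End SubgroupType.

Record ocsubgroup (G : topGroupType) := OCSubgroup {
  oc_sg :> subgroup G ;
  oc_open : open (sg_set oc_sg) ;
  oc_compact : compact (sg_set oc_sg)
}.

Definition locally_profinite (G : topGroupType) : Prop :=
  hausdorff_space G /\
  forall A : set G, nbhs 1%g A -> exists U : ocsubgroup G, sg_set U `<=` A.

(** * Submodules, quotients, cohomology of complexes *)

Record submod (k : comPzRingType) (V : lmodType k) := Submod {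
  sm_set : set V ;
  sm0 : sm_set 0 ;
  smD : forall x y, sm_set x -> sm_set y -> sm_set (x + y) ;
  smZ : forall a x, sm_set x -> sm_set (a *: x)
}.

Section SubmodType.
Variables (k : comPzRingType) (V : lmodType k) (S : submod V).

Definition sm_pred : {pred V} := fun x => x \in sm_set S.

Fact sm_zmod_closed : zmod_closed sm_pred.
Proof.
split=> [|x y /set_mem Sx /set_mem Sy]; apply/mem_set; first exact: sm0.
by apply: smD => //; rewrite -scaleN1r; exact: smZ.
Qed.

HB.instance Definition _ := GRing.isZmodClosed.Build V sm_pred sm_zmod_closed.

Definition sm_type : Type := {x : V | sm_pred x}.

HB.instance Definition _ := SubChoice.on sm_type.

Fact sm_closed : subsemimod_closed sm_pred.
Proof.
split=> [|a x /set_mem Sx]; last by apply/mem_set; exact: smZ.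
split=> [|x y /set_mem Sx /set_mem Sy]; apply/mem_set; first exact: sm0.
exact: smD.
Qed.

HB.instance Definition _ :=
  GRing.SubChoice_isSubLmodule.Build k V sm_pred sm_type sm_closed.

Definition quotmod : Type := Quotient.quot sm_pred.

HB.instance Definition _ := GRing.Zmodule.on quotmod.

Definition qpi (x : V) : quotmod := \pi_(Quotient.quot sm_pred) x.
Definition qrepr (y : quotmod) : V := repr (y : Quotient.quot sm_pred).

Lemma qreprK y : qpi (qrepr y) = y.
Proof. exact: reprK. Qed.

Lemma qpiP x y : qpi x = qpi y <-> sm_set S (x - y).
Proof.
split=> [/eqP|Sxy]; last apply/eqP.
  by rewrite -Quotient.idealrBE => /set_mem.
by rewrite -Quotient.idealrBE; apply/mem_set.
Qed.

Lemma qpiD x y : qpi (x + y) = qpi x + qpi y.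
Proof. exact: raddfD. Qed.

Definition qscale (a : k) (y : quotmod) : quotmod := qpi (a *: qrepr y).

Lemma qscaleE a x : qscale a (qpi x) = qpi (a *: x).
Proof.
by apply/qpiP; rewrite -scalerBr; apply/smZ/qpiP; rewrite qreprK.
Qed.

Fact qscaleA a b y : qscale a (qscale b y) = qscale (a * b) y.
Proof. by rewrite -[y]qreprK !qscaleE scalerA. Qed.

Fact qscale1 y : qscale 1 y = y.
Proof. by rewrite -[y]qreprK !qscaleE scale1r. Qed.

Fact qscaleDr : right_distributive qscale +%R.
Proof.
by move=> a x y; rewrite -[x]qreprK -[y]qreprK -qpiD !qscaleE -qpiD scalerDr.
Qed.

Fact qscaleDl y : {morph qscale^~ y : a b / a + b}.
Proof. by move=> a b; rewrite -[y]qreprK !qscaleE -qpiD scalerDl. Qed.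

HB.instance Definition _ :=
  GRing.Zmodule_isLmodule.Build k quotmod qscaleA qscale1 qscaleDr qscaleDl.

End SubmodType.
Coercion sm_type : submod >-> Sortclass.

Record complex (k : comPzRingType) := Complex {
  cpx_amb : nat -> lmodType k ;
  cpx : forall n, submod (cpx_amb n) ;
  dif : forall n, cpx_amb n -> cpx_amb n.+1 ;
  dif_linear : forall n, linear (@dif n) ;
  dif_cpx : forall n x, sm_set (cpx n) x -> sm_set (cpx n.+1) (dif x) ;
  dif_dif : forall n x, sm_set (cpx n) x -> dif (dif x) = 0
}.

Section LinearFun.
Variables (k : comPzRingType) (V W : lmodType k) (f : V -> W).
Hypothesis lf : linear f.

Lemma linD x y : f (x + y) = f x + f y.
Proof. by have := lf 1 x y; rewrite !scale1r. Qed.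

Lemma lin0 : f 0 = 0.
Proof. by apply: (addIr (f 0)); rewrite -linD !add0r. Qed.

Lemma linZ a x : f (a *: x) = a *: f x.
Proof. by have := lf a x 0; rewrite lin0 !addr0. Qed.

End LinearFun.

Section Cohomology.
Variables (k : comPzRingType) (C : complex k) (n : nat).

Definition cocycle : set (cpx_amb C n) :=
  [set x | sm_set (cpx C n) x /\ dif x = 0].

Fact cocycle0 : cocycle 0.
Proof. by split; [exact: sm0|rewrite (lin0 (@dif_linear _ _ _))]. Qed.

Fact cocycleD x y : cocycle x -> cocycle y -> cocycle (x + y).
Proof.
by move=> [Cx dx] [Cy dy]; split; [exact: smD|rewrite (linD (@dif_linear _ _ _)) dx dy addr0].
Qed.

Fact cocycleZ a x : cocycle x -> cocycle (a *: x).
Proof.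
by move=> [Cx dx]; split; [exact: smZ|rewrite (linZ (@dif_linear _ _ _)) dx scaler0].
Qed.

Definition cocycles : submod (cpx_amb C n) := Submod cocycle0 cocycleD cocycleZ.

End Cohomology.

Definition coboundary (k : comPzRingType) (C : complex k) (n : nat) :
    set (cpx_amb C n) :=
  match n with
  | 0 => [set 0]
  | m.+1 => [set dif x | x in sm_set (cpx C m)]
  end.

Section Cohomology2.
Variables (k : comPzRingType) (C : complex k) (n : nat).

Fact coboundary0 : coboundary (\val (0 : cocycles C n)).
Proof.
by case: n => [//|m] /=; exists 0; [exact: sm0|rewrite (lin0 (@dif_linear _ _ _))].
Qed.

Fact coboundaryD (x y : cocycles C n) :
  coboundary (\val x) -> coboundary (\val y) -> coboundary (\val (x + y)).
Proof.
case: n x y => [x y /= -> ->|m x y /= [a Ca <-] [b Cb <-]]; first exact: addr0.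
by exists (a + b); [exact: smD|rewrite (linD (@dif_linear _ _ _))].
Qed.

Fact coboundaryZ c (x : cocycles C n) :
  coboundary (\val x) -> coboundary (\val (c *: x)).
Proof.
case: n x => [x /= ->|m x /= [a Ca <-]]; first exact: scaler0.
by exists (c *: a); [exact: smZ|rewrite (linZ (@dif_linear _ _ _))].
Qed.

Definition coboundaries : submod (cocycles C n) :=
  @Submod _ _ [set x : cocycles C n | coboundary (\val x)]
    coboundary0 coboundaryD coboundaryZ.

Definition cohom := quotmod coboundaries.

HB.instance Definition _ := GRing.Lmodule.on cohom.

(* The class of a cocycle; the junk value 0 if x is not a cocycle. *)
Definition cls (x : cpx_amb C n) : cohom := qpi coboundaries (insubd 0 x).

(* Some cocycle in the given class. *)
Definition crepr (y : cohom) : cpx_amb C n := \val (qrepr y).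

Lemma crepr_cocycle y : cocycle (crepr y).
Proof. exact/set_mem/(valP (qrepr y)). Qed.

Lemma creprK y : cls (crepr y) = y.
Proof. by rewrite /cls /crepr valKd; exact: qreprK. Qed.

Lemma clsP x y : cocycle x -> cocycle y ->
  cls x = cls y <-> coboundary (x - y).
Proof.
move=> /mem_set Zx /mem_set Zy.
have -> : x - y = \val (insubd 0 x - insubd 0 y : cocycles C n).
  by rewrite /= !insubdK.
exact: qpiP.
Qed.

End Cohomology2.

(** * Representations *)

Record rep (k : comPzRingType) (H : topGroupType) := Rep {
  rep_mod :> lmodType k ;
  act : H -> rep_mod -> rep_mod ;
  act_linear : forall h, linear (act h) ;
  act1 : forall v, act 1%g v = v ;
  actM : forall g h v, act (g * h)%g v = act g (act h v)
}.

Definition smooth (k : comPzRingType) (H : topGroupType) (M : rep k H) : Prop :=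
  forall v : M, open [set h | act h v = v].

Definition is_hom (k : comPzRingType) (H : topGroupType) (M N : rep k H)
    (f : M -> N) : Prop :=
  linear f /\ forall h v, f (act h v) = act h (f v).

Section Constructions.
Variable k : comPzRingType.

Definition triv_rep (H : topGroupType) : rep k H :=
  @Rep k H k^o (fun _ v => v) (fun _ _ _ _ => erefl) (fun _ => erefl)
    (fun _ _ _ => erefl).

Definition res_rep (G : topGroupType) (M : rep k G) (H : subgroup G) : rep k H :=
  @Rep k H M (fun h v => act (\val h) v) (fun h => act_linear (\val h))
    (@act1 _ _ M) (fun g h => @actM _ _ M (\val g) (\val h)).

Section Sub.
Variables (H : topGroupType) (M : rep k H) (S : submod M).
Hypothesis stabS : forall h v, sm_set S v -> sm_set S (act h v).

Definition sub_act (h : H) (v : S) : S :=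
  exist _ (act h (\val v)) (mem_set (stabS h (set_mem (valP v)))).

Fact sub_act_linear h : linear (sub_act h).
Proof. by move=> a x y; apply: val_inj; rewrite /= act_linear. Qed.

Fact sub_act1 v : sub_act 1%g v = v.
Proof. by apply: val_inj; rewrite /= act1. Qed.

Fact sub_actM g h v : sub_act (g * h)%g v = sub_act g (sub_act h v).
Proof. by apply: val_inj; rewrite /= actM. Qed.

Definition sub_rep : rep k H := Rep sub_act_linear sub_act1 sub_actM.

End Sub.
End Constructions.

(** * Continuous cochain cohomology *)

Lemma ptws_cvg (T I : Type) (H : topologicalType) (F : set_system T)
    (u : T -> {ptws I -> H}) (x : {ptws I -> H}) :
  Filter F -> (forall i, (fun t => u t i) @ F --> x i) -> u @ F --> x.
Proof.
move=> FF ux; apply/cvg_sup => i A [_ [[C oC <-] Cx CA]].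
by apply: filterS CA _; apply: (ux i); exact: open_nbhs_nbhs.
Qed.

Section BarComplex.
Variables (k : comPzRingType) (H : topGroupType) (M : rep k H).

Definition loc_const (n : nat) (f : ('I_n.+1 -> H) -> M) : Prop :=
  forall x : {ptws 'I_n.+1 -> H}, nbhs x [set y | f y = f x].

Definition homogeneous (n : nat) (f : ('I_n.+1 -> H) -> M) : Prop :=
  forall h x, f (fun i => (h * x i)%g) = act h (f x).

Definition bar_dif (n : nat) (f : ('I_n.+1 -> H) -> M) :
    ('I_n.+2 -> H) -> M :=
  fun x => \sum_(j < n.+2) (-1) ^+ j *: f (x \o lift j).

Fact bar_dif_linear n : linear (@bar_dif n).
Proof.
move=> a f g; apply/funext => x.
change (bar_dif (a *: f + g) x = a *: bar_dif f x + bar_dif g x).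
rewrite /bar_dif scaler_sumr -big_split /=.
by apply: eq_bigr => j _; rewrite scalerDr !scalerA [a * _]mulrC.
Qed.

Lemma loc_const0 n : loc_const (0 : ('I_n.+1 -> H) -> M).
Proof. move=> x; have FF := nbhs_filter x; apply: filterS filterT => y _; reflexivity. Qed.

Lemma loc_constD n (f g : ('I_n.+1 -> H) -> M) :
  loc_const f -> loc_const g -> loc_const (f + g).
Proof.
move=> lf lg x; have FF := nbhs_filter x; apply: filterS (filterI (lf x) (lg x)) => y [fy gy].
by change (f y + g y = f x + g x); rewrite fy gy.
Qed.

Lemma loc_constZ n a (f : ('I_n.+1 -> H) -> M) :
  loc_const f -> loc_const (a *: f).
Proof.
move=> lf x; have FF := nbhs_filter x; apply: filterS (lf x) => y fy.
by change (a *: f y = a *: f x); rewrite fy.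
Qed.

Lemma loc_const_dif n (f : ('I_n.+1 -> H) -> M) :
  loc_const f -> loc_const (bar_dif f).
Proof.
move=> lf; rewrite /bar_dif.
have -> : (fun x : 'I_n.+2 -> H => \sum_(j < n.+2) (-1) ^+ j *: f (x \o lift j)) =
    \sum_(j < n.+2) (fun x => (-1) ^+ j *: f (x \o lift j)).
  by rewrite fct_sumE.
elim/big_ind: _ => [||j _]; [exact: loc_const0|exact: loc_constD|].
move=> x; have FF := nbhs_filter x.
pose re (y : {ptws 'I_n.+2 -> H}) : {ptws 'I_n.+1 -> H} := y \o lift j.
have cvre : continuous re.
  move=> y; apply: (ptws_cvg (nbhs_filter y)) => i.
  exact: (@proj_continuous _ (fun _ : 'I_n.+2 => H) (lift j i)).
have lfx : nbhs x (re @^-1` [set y | f y = f (re x)]) := cvre x _ (lf (re x)).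
apply: (@filterS _ _ FF _ _ _ lfx) => y fy.
by change ((-1) ^+ j *: f (re y) = (-1) ^+ j *: f (re x)); rewrite fy.
Qed.

Lemma homogeneous_dif n (f : ('I_n.+1 -> H) -> M) :
  homogeneous f -> homogeneous (bar_dif f).
Proof.
move=> hf h x; rewrite /bar_dif.
have -> : act h (\sum_(j < n.+2) (-1) ^+ j *: f (x \o lift j)) =
    \sum_(j < n.+2) act h ((-1) ^+ j *: f (x \o lift j)).
  apply: (big_morph (act h)); [exact/linD/act_linear|exact/lin0/act_linear].
apply: eq_bigr => j _; rewrite (linZ (@act_linear _ _ _ _)) -hf.
by congr (_ *: f _).
Qed.

Lemma bar_dif_dif n (f : ('I_n.+1 -> H) -> M) : bar_dif (bar_dif f) = 0.
Proof.
apply/funext => x; rewrite /bar_dif.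
pose g a b := f (fun r : 'I_n.+1 => x (inord (bump a (bump b r)))).
have gC a b : (b < a)%N -> g a b = g b a.-1.
  move=> ba; congr (f _); apply/funext => r; congr (x (inord _)).
  by rewrite /bump; case: a ba => //= a ba; case: (leqP b r) => ?;
    case: (leqP a r) => ?; lia.
transitivity (\sum_(j < n.+3) \sum_(i < n.+2) (-1) ^+ (j + i) *: g j i).
  apply: eq_bigr => j _; rewrite scaler_sumr; apply: eq_bigr => i _.
  rewrite scalerA exprD; congr (_ *: f _); apply/funext => r.
  rewrite /=; congr (x _); apply: val_inj.
  by rewrite [RHS]inordK //; exact: (ltn_ord (lift j (lift i r))).
transitivity (\sum_(i < n.+2) \sum_(j < n.+2 | (i <= j)%N)
    ((-1) ^+ (i + j).+1 *: g i j + (-1) ^+ (i + j) *: g i j)); last first.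
  apply: big1 => i _; apply: big1 => j _.
  by rewrite -scalerDl exprS mulN1r addNr scale0r.
under [RHS]eq_bigr do rewrite big_split /=.
rewrite big_split /=.
under eq_bigr => j _ do rewrite (bigID (fun i : 'I_n.+2 => (i < j)%N)) /=.
rewrite big_split /=; congr (_ + _).
  under eq_bigr do rewrite big_mkcond /=.
  rewrite exchange_big /=; apply: eq_bigr => i _.
  rewrite big_ord_recl ltn0 add0r [RHS]big_mkcond /=.
  apply: eq_bigr => j _; rewrite /bump leq0n add1n ltnS.
  by case: ifP => // ij; rewrite gC ?ltnS // addSn addnC.
rewrite big_ord_recr /= [X in _ + X]big1 ?addr0.
  by apply: eq_bigr => i _; apply: eq_bigl => j; rewrite -leqNgt.
by move=> i; rewrite ltn_ord.
Qed.

Definition bar_cochain (n : nat) : set (('I_n.+1 -> H) -> M) :=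
  [set f | loc_const f /\ homogeneous f].

Fact bar_cochain0 n : @bar_cochain n 0.
Proof.
split; first exact: loc_const0.
by move=> h x; rewrite (lin0 (@act_linear _ _ _ _)).
Qed.

Fact bar_cochainD n f g :
  @bar_cochain n f -> bar_cochain g -> bar_cochain (f + g).
Proof.
move=> [lf hf] [lg hg]; split; first exact: loc_constD.
by move=> h x; rewrite (linD (@act_linear _ _ _ _)) -hf -hg.
Qed.

Fact bar_cochainZ n a f : @bar_cochain n f -> bar_cochain (a *: f).
Proof.
move=> [lf hf]; split; first exact: loc_constZ.
by move=> h x; rewrite (linZ (@act_linear _ _ _ _)) -hf.
Qed.

Definition bar_cochains n : submod (('I_n.+1 -> H) -> M) :=
  Submod (@bar_cochain0 n) (@bar_cochainD n) (@bar_cochainZ n).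

Fact bar_dif_cochains n (f : ('I_n.+1 -> H) -> M) :
  sm_set (bar_cochains n) f -> sm_set (bar_cochains n.+1) (bar_dif f).
Proof.
by move=> [lf hf]; split; [exact: loc_const_dif|exact: homogeneous_dif].
Qed.

Definition bar : complex k :=
  @Complex k (fun n => ('I_n.+1 -> H) -> M) bar_cochains bar_dif bar_dif_linear
    bar_dif_cochains (fun n f _ => bar_dif_dif f).

Definition Hc (n : nat) := cohom bar n.

End BarComplex.

Section CochainOperations.
Variable k : comPzRingType.

(* Functoriality of H^n along phi : H' -> H and m : M -> M' satisfying
   m (phi h * v) = h * m v; covers restriction, conjugation and maps induced by
   morphisms of coefficients. *)
Definition pull (H H' : topGroupType) (M : rep k H) (M' : rep k H')
    (phi : H' -> H) (m : M -> M') (n : nat) (x : Hc M n) : Hc M' n :=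
  cls (C := bar M') (n := n) (fun z => m (crepr x (phi \o z))).

Definition cup (H : topGroupType) (M : rep k H) (mul : M -> M -> M) (i j : nat)
    (x : Hc M i) (y : Hc M j) : Hc M (i + j) :=
  cls (C := bar M) (n := i + j) (fun z =>
    mul (crepr x (fun r : 'I_i.+1 => z (inord r)))
        (crepr y (fun r : 'I_j.+1 => z (inord (i + r))))).

End CochainOperations.

Arguments pull {k H H' M M'} phi m {n} x.
Arguments cup {k H M} mul {i j} x y.

(** * Ext groups in Mod(G) *)

Definition injective_rep (k : comPzRingType) (G : topGroupType) (I : rep k G) :
    Prop :=
  forall (A B : rep k G) (i : A -> B) (f : A -> I),
    smooth A -> smooth B -> is_hom i -> injective i -> is_hom f ->
    exists2 g : B -> I, is_hom g & g \o i = f.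

(* Injective resolutions in the category Mod(G) of smooth representations. *)
Record injres (k : comPzRingType) (G : topGroupType) (Y : rep k G) := InjRes {
  ir_obj :> nat -> rep k G ;
  ir_aug : Y -> ir_obj 0 ;
  ir_dif : forall n, ir_obj n -> ir_obj n.+1 ;
  ir_smooth : forall n, smooth (ir_obj n) ;
  ir_injective : forall n, injective_rep (ir_obj n) ;
  ir_aug_hom : is_hom ir_aug ;
  ir_dif_hom : forall n, is_hom (@ir_dif n) ;
  ir_aug_inj : injective ir_aug ;
  ir_exact0 : forall v, ir_dif v = 0 <-> exists y, ir_aug y = v ;
  ir_exact : forall n (v : ir_obj n.+1),
    ir_dif v = 0 <-> exists w : ir_obj n, ir_dif w = v
}.

Section Ext.
Variables (k : comPzRingType) (G : topGroupType).

Section Hom.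
Variables (X Y : rep k G).

Fact is_hom0 : is_hom (0 : X -> Y).
Proof.
split=> [a u v|h v]; first by change (0 = a *: 0 + 0 :> Y); rewrite scaler0 addr0.
by change (0 = act h 0 :> Y); rewrite (lin0 (@act_linear _ _ _ _)).
Qed.

Fact is_homD (f g : X -> Y) : is_hom f -> is_hom g -> is_hom (f + g).
Proof.
move=> [lf ef] [lg eg]; split=> [a u v|h v].
  change (f (a *: u + v) + g (a *: u + v) = a *: (f u + g u) + (f v + g v)).
  by rewrite lf lg scalerDr addrACA.
change (f (act h v) + g (act h v) = act h (f v + g v)).
by rewrite ef eg (linD (@act_linear _ _ _ _)).
Qed.

Fact is_homZ c (f : X -> Y) : is_hom f -> is_hom (c *: f).
Proof.
move=> [lf ef]; split=> [a u v|h v].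
  change (c *: f (a *: u + v) = a *: (c *: f u) + c *: f v).
  by rewrite lf scalerDr !scalerA mulrC.
change (c *: f (act h v) = act h (c *: f v)).
by rewrite ef (linZ (@act_linear _ _ _ _)).
Qed.

Definition homs : submod (X -> Y) := Submod is_hom0 is_homD is_homZ.

End Hom.

Section HomComplex.
Variables (X Y : rep k G) (I : injres Y).

Definition hom_dif (n : nat) (f : X -> I n) : X -> I n.+1 := fun x => ir_dif (f x).

Fact hom_dif_linear n : linear (@hom_dif n).
Proof.
move=> a f g; apply/funext => x.
exact: ((ir_dif_hom I n).1 a (f x) (g x)).
Qed.

Fact hom_dif_homs n (f : X -> I n) : is_hom f -> is_hom (hom_dif f).
Proof.
case: (ir_dif_hom I n) => ld ed [lf ef].
by split=> [a u v|h v]; rewrite /hom_dif /= ?lf ?ef ?ld ?ed.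
Qed.

Fact hom_dif_dif n (f : X -> I n) : hom_dif (hom_dif f) = 0.
Proof.
by apply/funext => x; apply/(ir_exact (i := I)); exists (f x).
Qed.

Definition hom_complex : complex k :=
  @Complex k (fun n => X -> I n) (fun n => homs X (I n)) hom_dif hom_dif_linear
    hom_dif_homs (fun n f _ => hom_dif_dif f).

(* Ext^n(X, Y) *)
Definition Ext (n : nat) := cohom hom_complex n.

End HomComplex.

(* Yoneda composition with a morphism a : X' -> X on the right. *)
Definition ext_pre (X' X Y : rep k G) (I : injres Y) (a : X' -> X) (n : nat)
    (y : Ext X I n) : Ext X' I n :=
  cls (C := hom_complex X' I) (n := n) (crepr y \o a).

Definition chain_lift (Y Y' : rep k G) (I : injres Y) (I' : injres Y')
    (b : Y -> Y') (F : forall n, I n -> I' n) : Prop :=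
  [/\ forall n, is_hom (F n),
      forall n v, F n.+1 (ir_dif v) = ir_dif (F n v)
    & forall y, F 0 (ir_aug I y) = ir_aug I' (b y)].

(* Yoneda composition with a morphism b : Y -> Y' on the left. *)
Definition ext_post (X Y Y' : rep k G) (I : injres Y) (I' : injres Y')
    (b : Y -> Y') (n : nat) (y : Ext X I n) : Ext X I' n :=
  xget 0 [set z | exists2 F : forall n, I n -> I' n, chain_lift b F &
    z = cls (C := hom_complex X I') (n := n) (F n \o crepr y)].

End Ext.

(** * The representations X_U *)

Section CompactInduction.
Variables (k : comPzRingType) (G : topGroupType).

Definition ltrans (g : G) (f : G -> k^o) : G -> k^o := fun x => f (g^-1 * x)%g.

Fact ltrans_linear g : linear (ltrans g).
Proof. by []. Qed.

Fact ltrans1 f : ltrans 1%g f = f.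
Proof. by apply/funext => x; rewrite /ltrans invg1 mul1g. Qed.

Fact ltransM g h f : ltrans (g * h)%g f = ltrans g (ltrans h f).
Proof. by apply/funext => x; rewrite /ltrans invgM mulgA. Qed.

Definition fun_rep : rep k G := Rep ltrans_linear ltrans1 ltransM.

Lemma compact_ltrans (g : G) (K : set G) :
  compact K -> compact [set (g * x)%g | x in K].
Proof.
move=> cK; apply: continuous_compact => //.
apply: continuous_subspaceT => x.
exact: (@continuous2_cvg _ _ _ _ _ _ _ _ _ _ _ (@mulg_continuous G (g, x))
  (cvg_cst _) cvg_id).
Qed.

Variable U : ocsubgroup G.

Definition comp_ind : set (G -> k^o) :=
  [set f | (forall x u, sg_set U u -> f (x * u)%g = f x) /\
           exists2 K, compact K & forall x, ~ K x -> f x = 0].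

Fact comp_ind0 : comp_ind 0.
Proof. by split=> //; exists set0 => //; exact: compact0. Qed.

Fact comp_indD f g : comp_ind f -> comp_ind g -> comp_ind (f + g).
Proof.
move=> [fU [K cK fK]] [gU [L cL gL]]; split=> [x u Uu|].
  by change (f (x * u)%g + g (x * u)%g = f x + g x); rewrite fU ?gU.
exists (K `|` L); first exact: compactU.
move=> x /not_orP[Kx Lx]; change (f x + g x = 0).
by rewrite fK ?gL ?addr0.
Qed.

Fact comp_indZ a f : comp_ind f -> comp_ind (a *: f).
Proof.
move=> [fU [K cK fK]]; split=> [x u Uu|].
  by change (a *: f (x * u)%g = a *: f x); rewrite fU.
by exists K => // x Kx; change (a *: f x = 0); rewrite fK ?scaler0.
Qed.

Definition comp_inds : submod fun_rep := Submod comp_ind0 comp_indD comp_indZ.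

Fact comp_ind_ltrans (g : G) f : comp_ind f -> comp_ind (ltrans g f).
Proof.
move=> [fU [K cK fK]]; split=> [x u Uu|]; first by rewrite /ltrans mulgA fU.
exists [set (g * x)%g | x in K]; first exact: compact_ltrans.
by move=> x Kx; apply: fK => Kgx; apply: Kx; exists (g^-1 * x)%g; rewrite // mulgA mulgV mul1g.
Qed.

Definition Xind : rep k G := sub_rep (S := comp_inds) comp_ind_ltrans.

Definition xval (f : Xind) : G -> k := \val (f : comp_inds).

Lemma xvalP (f : Xind) : comp_ind (xval f).
Proof. exact/set_mem/(valP (f : comp_inds)). Qed.

Definition mkX (f : G -> k) (cf : comp_ind f) : Xind := exist _ f (mem_set cf).

Fact char_subproof :
  comp_ind (fun x => (x \in sg_set U)%:R : k^o).
Proof.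
split=> [x u Uu|]; last first.
  exists (sg_set U); first exact: oc_compact.
  by move=> x Ux; rewrite memNset.
congr (_%:R); congr nat_of_bool; apply/idP/idP => /set_mem Ux; apply/mem_set.
  by have := sgM Ux (sgV Uu); rewrite -mulgA mulgV mulg1.
exact: sgM.
Qed.

(* char_U *)
Definition charX : Xind := mkX char_subproof.

Fact xmul_subproof (f g : Xind) : comp_ind (fun x => xval f x * xval g x : k^o).
Proof.
have [fU [K cK fK]] := xvalP f; have [gU _] := xvalP g.
split=> [x u Uu|]; first by rewrite fU ?gU.
by exists K => // x /fK ->; rewrite mul0r.
Qed.

(* Pointwise multiplication of functions. *)
Definition xmul (f g : Xind) : Xind := mkX (xmul_subproof f g).

Definition dcoset (g : G) : set G :=
  [set (u * g * v)%g | u in sg_set U & v in sg_set U].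

Definition supp_in (g : G) : set (res_rep Xind U) :=
  [set f | forall x, ~ dcoset g x -> xval f x = 0].

Fact supp_in0 g : supp_in g 0.
Proof. by []. Qed.

Fact supp_inD g f1 f2 : supp_in g f1 -> supp_in g f2 -> supp_in g (f1 + f2).
Proof.
move=> s1 s2 x gx; change (xval f1 x + xval f2 x = 0).
by rewrite s1 ?s2 ?addr0.
Qed.

Fact supp_inZ g a f : supp_in g f -> supp_in g (a *: f).
Proof.
by move=> s x gx; change (a * xval f x = 0); rewrite s ?mulr0.
Qed.

Definition supps_in g : submod (res_rep Xind U) :=
  Submod (@supp_in0 g) (@supp_inD g) (@supp_inZ g).

Fact supp_in_act g (u : U) f : supp_in g f -> supp_in g (act u f).
Proof.
move=> s x gx; change (xval f ((\val u)^-1 * x)%g = 0).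
apply: s => -[u1 Uu1 [u2 Uu2 e]]; apply: gx.
have Uu : sg_set U (\val u) := set_mem (valP u).
exists (\val u * u1)%g; first exact: sgM.
exists u2 => //.
by rewrite -!mulgA [(u1 * _)%g]mulgA e mulgA mulgV mul1g.
Qed.

(* The U-representation X_U(g). *)
Definition Xdc (g : G) : rep k U := sub_rep (S := supps_in g) (@supp_in_act g).

Definition xg_incl (g : G) (f : Xdc g) : res_rep Xind U := \val (f : supps_in g).

Fact xcut_subproof g (f : Xind) :
  comp_ind (fun x => if x \in dcoset g then xval f x else 0 : k^o).
Proof.
have [fU [K cK fK]] := xvalP f; split=> [x u Uu|]; last first.
  by exists K => // x /fK ->; case: ifP.
rewrite fU //; congr (if _ then _ else _).
apply/idP/idP => /set_mem [u1 Uu1 [u2 Uu2 e]]; apply/mem_set; exists u1 => //.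
  exists (u2 * u^-1)%g; first exact/sgM/sgV.
  by rewrite mulgA e -mulgA mulgV mulg1.
by exists (u2 * u)%g; [exact: sgM|rewrite mulgA e].
Qed.

Definition xcut (g : G) (f : Xind) : res_rep Xind U := mkX (xcut_subproof g f).

Fact supp_in_xcut g f : supp_in g (xcut g f).
Proof.
by move=> x gx; rewrite /xcut /xval /= memNset.
Qed.

(* The projection of X_U onto its direct summand X_U(g). *)
Definition xg_proj (g : G) (f : res_rep Xind U) : Xdc g :=
  exist _ (xcut g f) (mem_set (@supp_in_xcut g f)).

End CompactInduction.

Section Functoriality.
Variables (k : comPzRingType) (G : topGroupType) (U V : ocsubgroup G).

Fact iotaX_subproof (sUV : sg_set U `<=` sg_set V) (f : Xind k V) :
  comp_ind U (xval f).
Proof.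
by have [fV fK] := xvalP f; split=> // x u /sUV; exact: fV.
Qed.

Definition iotaX (sUV : sg_set U `<=` sg_set V) (f : Xind k V) : Xind k U :=
  mkX (iotaX_subproof sUV f).

(* The G-equivariant map X_U -> X_V sending char_U to char_V. *)
Definition piX : Xind k U -> Xind k V :=
  xget 0 [set p | is_hom p /\ p (charX k U) = charX k V].

End Functoriality.

Section WellDefined.
Variable k : comPzRingType.

Lemma pull_cocycle (H H' : topGroupType) (M : rep k H) (M' : rep k H')
    (phi : H' -> H) (m : M -> M') (n : nat) (c : ('I_n.+1 -> H) -> M) :
  continuous phi -> (forall x y, phi (x * y)%g = (phi x * phi y)%g) ->
  linear m -> (forall h v, m (act (phi h) v) = act h (m v)) ->
  cocycle (C := bar M) (n := n) c ->
  cocycle (C := bar M') (n := n) (fun z => m (c (phi \o z))).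
Proof.
move=> cphi phiM lm mE [[lc hc] dc]; split; first split.
- move=> x; have FF := nbhs_filter x.
  pose p (y : {ptws 'I_n.+1 -> H'}) : {ptws 'I_n.+1 -> H} := phi \o y.
  have cp : continuous p.
    move=> y; apply: (ptws_cvg (nbhs_filter y)) => i.
    apply: (@continuous_comp _ _ _ (fun y : {ptws 'I_n.+1 -> H'} => y i) phi).
      exact: (@proj_continuous _ (fun _ : 'I_n.+1 => H') i).
    exact: cphi.
  have lcx : nbhs x (p @^-1` [set y | c y = c (p x)]) := cp x _ (lc (p x)).
  apply: (@filterS _ _ FF _ _ _ lcx) => y cy.
  by change (m (c (p y)) = m (c (p x))); rewrite cy.
- move=> h x; rewrite -mE -hc; congr (m (c _)).
  by apply/funext => i; exact: phiM.
apply/funext => z.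
change (\sum_(j < n.+2) (-1) ^+ j *: m (c (phi \o (z \o lift j))) = 0).
transitivity (m (bar_dif c (phi \o z))); last by rewrite [bar_dif c]dc (lin0 lm).
rewrite [RHS](big_morph m (linD lm) (lin0 lm)).
by apply: eq_bigr => j _; rewrite (linZ lm).
Qed.

Lemma cup_cocycle (H : topGroupType) (M : rep k H) (mul : M -> M -> M)
    (i j : nat) (a : ('I_i.+1 -> H) -> M) (b : ('I_j.+1 -> H) -> M) :
  (forall v, linear (mul v)) -> (forall w, linear (mul^~ w)) ->
  (forall h v w, mul (act h v) (act h w) = act h (mul v w)) ->
  cocycle (C := bar M) (n := i) a -> cocycle (C := bar M) (n := j) b ->
  cocycle (C := bar M) (n := i + j) (fun z =>
    mul (a (fun r : 'I_i.+1 => z (inord r)))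
        (b (fun r : 'I_j.+1 => z (inord (i + r))))).
Proof.
move=> lr ll mulE [[la ha] da] [[lb hb] db]; split; first split.
- move=> x; have FF := nbhs_filter x.
  pose p (y : {ptws 'I_(i + j).+1 -> H}) : {ptws 'I_i.+1 -> H} :=
    fun r => y (inord r).
  pose q (y : {ptws 'I_(i + j).+1 -> H}) : {ptws 'I_j.+1 -> H} :=
    fun r => y (inord (i + r)).
  have cp : continuous p.
    move=> y; apply: (ptws_cvg (nbhs_filter y)) => r.
    exact: (@proj_continuous _ (fun _ : 'I_(i + j).+1 => H) (inord r)).
  have cq : continuous q.
    move=> y; apply: (ptws_cvg (nbhs_filter y)) => r.
    exact: (@proj_continuous _ (fun _ : 'I_(i + j).+1 => H) (inord (i + r))).
  have ax : nbhs x (p @^-1` [set y | a y = a (p x)]) := cp x _ (la (p x)).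
  have bx : nbhs x (q @^-1` [set y | b y = b (q x)]) := cq x _ (lb (q x)).
  apply: (@filterS _ _ FF _ _ _ (@filterI _ _ FF _ _ ax bx)) => y [ay b_y].
  by change (mul (a (p y)) (b (q y)) = mul (a (p x)) (b (q x))); rewrite ay b_y.
- by move=> h x; rewrite -mulE -ha -hb.
apply/funext => z.
pose y (r : nat) := z (inord r).
pose a' (l : nat) := a (fun r : 'I_i.+1 => y (bump l r)).
pose b' (l : nat) := b (fun r : 'I_j.+1 => y (i + bump l r)%N).
have sa : \sum_(l < i.+2) (-1) ^+ l *: a' l = 0.
  have := congr1 (fun f => f (fun r : 'I_i.+2 => y r)) da; exact.
have sb : \sum_(l < j.+2) (-1) ^+ l *: b' l = 0.
  have := congr1 (fun f => f (fun r : 'I_j.+2 => y (i + r)%N)) db; exact.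
change (\sum_(l < (i + j).+2) (-1) ^+ l *:
  mul (a (fun r : 'I_i.+1 => z (lift l (inord r))))
      (b (fun r : 'I_j.+1 => z (lift l (inord (i + r))))) = 0).
have e1 (l : 'I_(i + j).+2) (r : nat) : (r < (i + j).+1)%N ->
    z (lift l (inord r)) = y (bump l r).
  move=> rij; congr z; apply: val_inj; rewrite /= inordK // inordK //.
  exact: (ltn_ord (lift l (Ordinal rij))).
under eq_bigr => l _.
  have -> : (fun r : 'I_i.+1 => z (lift l (inord r))) = fun r => y (bump l r).
    by apply/funext => r; apply: e1; have := ltn_ord r; lia.
  have -> : (fun r : 'I_j.+1 => z (lift l (inord (i + r)))) =
      fun r => y (bump l (i + r)).
    by apply/funext => r; apply: e1; have := ltn_ord r; lia.
  over.
rewrite -(big_mkord xpredT (fun l => (-1) ^+ l *: mul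
  (a (fun r : 'I_i.+1 => y (bump l r)))
  (b (fun r : 'I_j.+1 => y (bump l (i + r)))))).
rewrite (big_cat_nat (n := i.+1)) //=; last by lia.
have -> : \sum_(0 <= l < i.+1) (-1) ^+ l *: mul
    (a (fun r : 'I_i.+1 => y (bump l r)))
    (b (fun r : 'I_j.+1 => y (bump l (i + r)))) =
  mul (\sum_(l < i.+1) (-1) ^+ l *: a' l) (b' 0%N).
  rewrite [RHS](big_morph (mul^~ _) (linD (ll _)) (lin0 (ll _))) big_mkord.
  apply: eq_bigr => l _; rewrite (linZ (ll _)); congr (_ *: mul _ (b _)).
  by apply/funext => r; congr y; rewrite /bump; have := ltn_ord l; lia.
have -> : \sum_(i.+1 <= l < (i + j).+2) (-1) ^+ l *: mul
    (a (fun r : 'I_i.+1 => y (bump l r)))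
    (b (fun r : 'I_j.+1 => y (bump l (i + r)))) =
  mul ((-1) ^+ i.+1 *: a' i.+1) (\sum_(s < j.+1) (-1) ^+ s *: b' s.+1).
  rewrite [RHS](big_morph (mul _) (linD (lr _)) (lin0 (lr _))).
  rewrite -{1}[i.+1]add0n big_addn.
  have -> : ((i + j).+2 - i.+1)%N = j.+1 by lia.
  rewrite big_mkord; apply: eq_bigr => s _.
  rewrite (linZ (ll _)) (linZ (lr _)) scalerA -exprD.
  congr (_ ^+ _ *: mul (a _) (b _)); first by rewrite addnC.
  - by apply/funext => r; congr y; rewrite /bump; have := ltn_ord r; lia.
  - by apply/funext => r; congr y; rewrite /bump; lia.
move: sa sb; rewrite big_ord_recr /= => /eqP; rewrite addr_eq0 => /eqP ->.
rewrite big_ord_recl /= scale1r => sb.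
have -> : \sum_(s < j.+1) (-1) ^+ s *: b' s.+1 = b' 0%N.
  apply/eqP; rewrite -subr_eq0 -oppr_eq0 opprB -[X in _ == X]sb.
  apply/eqP; congr (_ + _); rewrite -sumrN; apply: eq_bigr => s _.
  by rewrite /bump /= add1n exprS mulN1r scaleNr.
by rewrite -scaleN1r (linZ (ll _)) scaleN1r addNr.
Qed.

End WellDefined.

Section Smoothness.
Variables (k : comPzRingType) (G : topGroupType) (U : ocsubgroup G).

Lemma xval_loc (f : Xind k U) (x : G) : \forall y \near x, xval f y = xval f x.
Proof.
have [fU _] := xvalP f.
have cm : {for x, continuous (fun y : G => (x^-1 * y)%g)}.
  exact: (@continuous2_cvg _ _ _ _ _ _ _ _ _ _ _
    (@mulg_continuous G (x^-1, x)%g) (cvg_cst _) cvg_id).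
have nU : nbhs (x^-1 * x)%g (sg_set U).
  by apply: open_nbhs_nbhs; split; [exact: oc_open|rewrite mulVg; exact: sg1].
have F0 := nbhs_filter x.
apply: (@filterS _ _ F0 _ _ _ (cm _ nU)) => y /= Uy.
by rewrite -[in LHS](mulVKg x y) fU.
Qed.

Lemma smooth_X : smooth (Xind k U).
Proof.
move=> f; rewrite openE => h0 /= h0f.
have [_ [K /compact_near_coveringP cK fK]] := xvalP f.
have e1 x : xval f (h0^-1 * x)%g = xval f x by rewrite -[in RHS]h0f.
have e2 x : xval f (h0 * x)%g = xval f x by rewrite -e1 mulKg.
have aux (p : G -> G) : {for h0, continuous p} ->
    (forall x, xval f (p h0 * x)%g = xval f x) ->
    \forall h \near h0, K `<=` [set y | xval f (p h * y)%g = xval f y].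
  move=> cp ep; apply: cK => x Kx.
  have c1 : (fun yh : G * G => (p yh.2 * yh.1)%g) @ (x, h0) --> (p h0 * x)%g.
    apply: (@continuous2_cvg _ _ _ _ _ _ _ _ _ _ _
      (@mulg_continuous G (p h0, x))); last exact: cvg_fst.
    apply: (@continuous_comp _ _ _ (fun yh : G * G => yh.2) p (x, h0)) => //.
    exact: cvg_snd.
  have c2 : (fun yh : G * G => yh.1) @ (x, h0) --> x by exact: cvg_fst.
  have F0 := nbhs_filter (x, h0).
  apply: (@filterS _ _ F0 _ _ _ (@filterI _ _ F0 _ _
    (c1 _ (xval_loc f (p h0 * x)%g)) (c2 _ (xval_loc f x)))) => -[y h] /= [-> ->].
  exact: ep.
have n1 := aux _ (@invg_continuous G h0) e1.
have n2 := aux id cvg_id e2.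
have F0 := nbhs_filter h0.
apply: (@filterS _ _ F0 _ _ _ (@filterI _ _ F0 _ _ n1 n2)) => h [h1 h2] /=.
apply: val_inj => /=; apply/funext => y; change (xval f (h^-1 * y)%g = xval f y).
have [/h1//|Ky] := pselect (K y).
have [/h2|Khy] := pselect (K (h^-1 * y)%g); first by rewrite /= mulVKg.
by rewrite !fK.
Qed.

End Smoothness.

(** * The Ext algebra and its operations *)

Section Involution.
Variables (k : comPzRingType) (G : topGroupType) (U : ocsubgroup G).

Definition conjI_set (g : G) : set G :=
  sg_set U `&` [set (g * u * g^-1)%g | u in sg_set U].

Fact conjI1 (g : G) : conjI_set g 1%g.
Proof.
by split; [exact: sg1|exists 1%g; [exact: sg1|rewrite mulg1 mulgV]].
Qed.

Fact conjIM (g x y : G) :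
  conjI_set g x -> conjI_set g y -> conjI_set g (x * y)%g.
Proof.
move=> [Ux [u Uu ex]] [Uy [v Uv ey]]; split; first exact: sgM.
by exists (u * v)%g; [exact: sgM|rewrite -ex -ey !mulgA mulgVK].
Qed.

Fact conjIV (g x : G) : conjI_set g x -> conjI_set g (x^-1)%g.
Proof.
move=> [Ux [u Uu e]]; split; first exact: sgV.
by exists (u^-1)%g; [exact: sgV|rewrite -e !invgM invgK mulgA].
Qed.

(* U_g, the intersection of U and g U g^-1 *)
Definition conjI (g : G) : subgroup G :=
  Subgroup (conjI1 g) (@conjIM g) (@conjIV g).

Definition conjI_incl (g : G) (x : conjI g) : U :=
  exist _ (\val x) (mem_set (set_mem (valP x)).1).

Fact conjI_conj_subproof (g : G) (x : conjI (g^-1)%g) :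
  sg_set (conjI g) (g * \val x * g^-1)%g.
Proof.
have [Ux [u Uu e]] := set_mem (valP x); split; last by exists (\val x).
by rewrite -e invgK !mulgA mulgV mul1g -mulgA mulgV mulg1.
Qed.

Definition conjI_conj (g : G) (x : conjI (g^-1)%g) : conjI g :=
  exist (fun y => y \in sg_set (conjI g)) _ (mem_set (conjI_conj_subproof x)).

Definition shapiro (g : G) (n : nat) :
    Hc (Xdc k U g) n -> Hc (triv_rep k (conjI g)) n :=
  pull (M' := triv_rep k (conjI g)) (@conjI_incl g)
    (fun f : Xdc k U g => xval (xg_incl f) g).

Definition shapiro_inv (g : G) (n : nat) (y : Hc (triv_rep k (conjI g)) n) :
    Hc (Xdc k U g) n :=
  xget 0 [set x | shapiro x = y].

(* (g^-1)_* : H^n(U_g, k) -> H^n(U_{g^-1}, k) *)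
Definition conj_star (g : G) (n : nat) :
    Hc (triv_rep k (conjI g)) n -> Hc (triv_rep k (conjI (g^-1)%g)) n :=
  pull (M := triv_rep k (conjI g)) (M' := triv_rep k (conjI (g^-1)%g))
    (@conjI_conj g) id.

Definition hc_incl (g : G) (n : nat) :
    Hc (Xdc k U g) n -> Hc (res_rep (Xind k U) U) n :=
  pull id (@xg_incl k G U g).

Definition hc_proj (g : G) (n : nat) :
    Hc (res_rep (Xind k U) U) n -> Hc (Xdc k U g) n :=
  pull id (@xg_proj k G U g).

Definition hc_invol (n : nat) (x : Hc (res_rep (Xind k U) U) n) :
    Hc (res_rep (Xind k U) U) n :=
  \sum_(D \in range (dcoset U))
    let g := xget 1%g D in
    hc_incl (shapiro_inv (conj_star (shapiro (hc_proj g x)))).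

End Involution.

Section ExtAlgebra.
Variables (k : comPzRingType) (G : topGroupType).

Section Comparison.
Variables (U : ocsubgroup G) (Y : rep k G) (I : injres Y).

Definition comparison (F : forall n, (('I_n.+1 -> U) -> res_rep Y U) -> I n) :
    Prop :=
  [/\ forall n a f g, loc_const f -> loc_const g ->
        F n (a *: f + g) = a *: F n f + F n g,
      forall n (u : U) f, loc_const f ->
        F n (fun x => act u (f (fun r => (u^-1 * x r)%g))) =
        act (\val u) (F n f),
      forall n f, loc_const f -> F n.+1 (bar_dif f) = ir_dif (F n f)
    & forall y, F 0 (fun=> y) = ir_aug I y].

(* The identification Ext^n(X_U, Y) = H^n(U, Y): a homomorphism f on X_U is
   determined by the U-invariant vector f(char_U), and any comparison morphism
   from the standard resolution of Y by locally constant functions on U^(n+1)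
   to I induces H^n(U, Y) = H^n(I^U). *)
Definition ext_match (n : nat) (e : Ext (Xind k U) I n)
    (c : Hc (res_rep Y U) n) : Prop :=
  exists2 F, comparison F &
    exists f : Xind k U -> I n, [/\ is_hom f, f (charX k U) = F n (crepr c)
      & e = cls (C := hom_complex (Xind k U) I) (n := n) f].

Definition ext_to_hc (n : nat) (e : Ext (Xind k U) I n) : Hc (res_rep Y U) n :=
  xget 0 [set c | ext_match e c].

Definition hc_to_ext (n : nat) (c : Hc (res_rep Y U) n) : Ext (Xind k U) I n :=
  xget 0 [set e | ext_match e c].

End Comparison.

(* E^n_U, for a chosen injective resolution I of X_U. *)
Definition EU (U : ocsubgroup G) (I : injres (Xind k U)) (n : nat) :=
  Ext (Xind k U) I n.

Section OneSubgroup.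
Variables (U : ocsubgroup G) (I : injres (Xind k U)).

Definition E_cup (i j : nat) (a : EU I i) (b : EU I j) : EU I (i + j) :=
  hc_to_ext I (cup (M := res_rep (Xind k U) U) (@xmul k G U)
    (ext_to_hc a) (ext_to_hc b)).

Definition E_invol (n : nat) (a : EU I n) : EU I n :=
  hc_to_ext I (hc_invol (ext_to_hc a)).

End OneSubgroup.

Section TwoSubgroups.
Variables (U V : ocsubgroup G) (sUV : sg_set U `<=` sg_set V).
Variables (IU : injres (Xind k U)) (IV : injres (Xind k V)).

(* R^n_{V,U} : f |-> iota o f o pi *)
Definition E_res (n : nat) (b : EU IV n) : EU IU n :=
  ext_post IU (iotaX sUV) (ext_pre (@piX k G U V) b).

(* C^n_{U,V} : f |-> pi o f o iota *)
Definition E_cores (n : nat) (a : EU IU n) : EU IV n :=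
  ext_post IV (@piX k G U V) (ext_pre (iotaX sUV) a).

End TwoSubgroups.
End ExtAlgebra.

(* Main.v *)
Require Import Defs.
From mathcomp Require Import all_boot all_algebra.
From mathcomp Require Import all_classical topology.
From mathcomp Require Import finmap zify.

(** Why the theorem holds. A class of H^n(U, X_U) is represented by a cocycle [f] on
   the powers of the whole group [G] that is locally constant, U-equivariant, and whose
   values, functions on [G], vanish off a common compact set. Such an [f] is the
   part s = 1 of the G-invariant function f (x; s, t) = f (s^-1 x) (s^-1 t), where s and t
   matter only up to right multiplication by [U]. In this form
   - restriction from [V] to [U] leaves the function unchanged;
   - corestriction sums f (x; s v, t w) over v and w in V / U ([gcores_val]);
   - the involution exchanges s and t ([swap]);
   - the cup product multiplies values, on the first and the last entries of x ([gcup]).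
   The projection formula ([gcores_gcup]) and the compatibility of the involution with
   restriction and corestriction ([swap_iota], [swap_gcores]) are now equalities of
   functions: a V-invariant factor leaves the double sum, and the double sum is symmetric.

   It remains to see that the operations on Ext groups have these descriptions. Let [I] be
   an injective resolution of Y. Homomorphisms from X_U to I^n are vectors of I^n fixed by
   [U], and [zig] joins such vectors to cocycles with values in Y through the double complex
   of cochains with values in [I]. Its rows are exact because values can be lifted
   equivariantly ([ucoch_lift]). Its columns are exact because an injective representation
   of [G] has an equivariant mean for functions on [U] ([injective_mean]), which contracts
   the column ([hmeanK]). So zigzags define an isomorphism between fixed vectors modulo
   boundaries and cocycles modulo coboundaries ([zig_total], [zig_bdry], [zig_cobd]), and
   every comparison morphism induces the same one ([comparison_zig]). Zigzags can be mapped
   by chain maps, restricted to subgroups and summed over V / U ([zig_map], [zig_restrict],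
   [zig_trace]); this describes restriction and corestriction ([EZ_res], [EZ_cores]).

   For the involution ([hc_invol_cls]), the Shapiro maps are injective, so its defining
   property need only be checked on U_g for g^-1 in place of g. There it compares the
   pullbacks of one cocycle on powers of [G] along x |-> g x and x |-> g x g^-1, and the
   prism homotopy ([prism_dif]) makes them cohomologous ([translate_coboundary]). *)

Set Implicit Arguments.
Unset Strict Implicit.
Unset Printing Implicit Defensive.

Import GRing.Theory.
Local Open Scope classical_set_scope.
Local Open Scope ring_scope.

(** * Locally constant functions *)

Definition locc (X : topologicalType) (Z : Type) (f : X -> Z) : Prop :=
  forall x, nbhs x [set y | f y = f x].

Lemma nbhs_sub (X : topologicalType) (x : X) (A B : set X) :
  nbhs x A -> A `<=` B -> nbhs x B.
Proof. by move=> xA AB; exact: (@filterS _ _ (nbhs_filter x) _ _ AB xA). Qed.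

Section LocallyConstant.
Variable X : topologicalType.

Lemma locc_cst (Z : Type) (z : Z) : @locc X Z (fun=> z).
Proof. by move=> x; have FF := nbhs_filter x; apply: filterS filterT => y _. Qed.

Lemma locc_comp (Y : topologicalType) (Z : Type) (p : X -> Y) (f : Y -> Z) :
  continuous p -> locc f -> locc (f \o p).
Proof. by move=> cp lf x; exact: (cp x _ (lf (p x))). Qed.

Lemma locc_post (Z W : Type) (f : X -> Z) (s : Z -> W) :
  locc f -> locc (s \o f).
Proof.
move=> lf x; have FF := nbhs_filter x.
by apply: filterS (lf x) => y /= ->.
Qed.

Lemma locc_pair (Z W : Type) (f : X -> Z) (g : X -> W) :
  locc f -> locc g -> locc (fun x => (f x, g x)).
Proof.
move=> lf lg x; have FF := nbhs_filter x.
by apply: filterS (filterI (lf x) (lg x)) => y [/= -> ->].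
Qed.

Lemma locc_op2 (Z1 Z2 W : Type) (op : Z1 -> Z2 -> W) (f : X -> Z1) (g : X -> Z2) :
  locc f -> locc g -> locc (fun x => op (f x) (g x)).
Proof.
move=> lf lg; exact: (locc_post (fun p => op p.1 p.2) (locc_pair lf lg)).
Qed.

Lemma locc_sum (V : nmodType) (I : Type) (s : seq I) (F : I -> X -> V) :
  (forall i, locc (F i)) -> locc (fun x => \sum_(i <- s) F i x).
Proof.
move=> lF; elim: s => [|i s IH].
  have -> : (fun x => \sum_(i <- [::]) F i x) = fun=> 0.
    by apply/funext => x; rewrite big_nil.
  exact: locc_cst.
have -> : (fun x => \sum_(j <- i :: s) F j x) = fun x => F i x + \sum_(j <- s) F j x.
  by apply/funext => x; rewrite big_cons.
exact: locc_op2.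
Qed.

(** Near [x] the values do not change, uniformly over the compact set [K].
   This is how local constancy survives operations that look at all elements
   of a compact group at once: means, swaps, spreading over a double coset. *)
Lemma locc_tube (S : topologicalType) (Z : Type) (K : set S) (f : S * X -> Z) (x : X) :
  compact K -> (forall s, K s -> nbhs (s, x) [set y | f y = f (s, x)]) ->
  \forall y \near x, forall s, K s -> f (s, y) = f (s, x).
Proof.
move=> /compact_near_coveringP cK lf.
have FF := nbhs_filter x.
have : \forall y \near x, K `<=` (fun s => f (s, y) = f (s, x)).
  apply: cK => s Ks.
  have c1 : (fun yh : S * X => (yh.1, x)) @ (s, x) --> (s, x).
    apply: cvg_pair; first exact: cvg_fst.
    exact: cvg_cst.
  have F0 := nbhs_filter (s, x).
  apply: (@filterS _ _ F0 _ _ _ (@filterI _ _ F0 _ _ (lf _ Ks) (c1 _ (lf _ Ks)))).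
  by move=> [s' y] /= [-> ->].
by apply: filterS => y h s Ks; exact: h.
Qed.

Lemma locc_finite (Z : Type) (K : set X) (f : X -> Z) :
  compact K -> locc f -> exists s : seq X,
    forall x, K x -> exists2 y, y \in s & f x = f y.
Proof.
move=> /compact_near_coveringP cK lf.
(* the filter of eventual properties of larger and larger finite lists *)
pose F : set_system (seq X) := [set P | exists s0 : seq X, forall s : seq X, {subset s0 <= s} -> P s].
have FF : Filter F.
  split=> [|P Q [s sP] [t tQ]|P Q PQ [s sP]].
  - by exists [::].
  - exists (s ++ t) => w sw; split; [apply: sP|apply: tQ] => y ys; apply: sw;
      by rewrite mem_cat ys ?orbT.
  - by exists s => w /sP /PQ.
have [|s sK] := cK _ F (fun s x => exists2 y, y \in s & f x = f y) FF.
  move=> x Kx; exists ([set y | f y = f x], [set s | x \in s]) => /=.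
    by split; [exact: lf|exists [:: x] => s xs; apply: xs; rewrite inE].
  by move=> [y s] /= [e xs]; exists x.
by exists s => x Kx; exact: (sK s).
Qed.

End LocallyConstant.

(** * Topological groups and their open subgroups *)

Section TopGroup.
Variables (G : topGroupType).

Lemma ptws_coord (I : choiceType) (i : I) :
  continuous (fun x : {ptws I -> G} => x i).
Proof. exact: (@proj_continuous _ (fun _ : I => G) i). Qed.

Lemma ptws_continuous (X : topologicalType) (I : choiceType) (u : X -> {ptws I -> G}) :
  (forall i, continuous (fun x => u x i)) -> continuous u.
Proof.
move=> cu x; apply: (ptws_cvg (nbhs_filter x)) => i; exact: cu.
Qed.

Lemma continuousM (X : topologicalType) (f g : X -> G) :
  continuous f -> continuous g -> continuous (fun x => f x * g x)%g.
Proof.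
move=> cf cg x.
exact: (@continuous2_cvg _ _ _ _ _ _ _ _ _ _ _ (@mulg_continuous G (f x, g x)) (cf x) (cg x)).
Qed.

Lemma continuousV (X : topologicalType) (f : X -> G) :
  continuous f -> continuous (fun x => (f x)^-1)%g.
Proof.
move=> cf x; exact: (continuous_comp (cf x) (@invg_continuous G (f x))).
Qed.

Lemma continuous_cst (X Y : topologicalType) (y : Y) : continuous (fun _ : X => y).
Proof. by move=> x; exact: cvg_cst. Qed.

Lemma continuous_id (X : topologicalType) : continuous (fun x : X => x).
Proof. by move=> x; exact: cvg_id. Qed.

Lemma mul_continuous (g : G) : continuous (fun x : G => g * x)%g.
Proof. exact: (continuousM (@continuous_cst _ _ g) (@continuous_id _)). Qed.

Lemma sg_val_continuous (H : subgroup G) : continuous (\val : H -> G).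
Proof. by move=> x A Ax; apply/sg_nbhsP; exists A. Qed.

Lemma sg_continuous (X : topologicalType) (H : subgroup G) (u : X -> H) :
  continuous (fun x => \val (u x)) -> continuous u.
Proof.
move=> cu x A /sg_nbhsP[B Bx BA].
have FF := nbhs_filter x.
apply: (@filterS _ _ FF _ _ _ (cu x B Bx)) => y /= By; exact: BA.
Qed.

Lemma sg_mem (H : subgroup G) (h : H) : sg_set H (\val h).
Proof. exact: set_mem (valP h). Qed.

(** Smoothness says exactly that the action of a varying group element is
   locally constant on a fixed vector. *)
Lemma locc_act (k : comPzRingType) (X : topologicalType) (M : rep k G)
    (a : X -> G) (f : X -> M) :
  smooth M -> continuous a -> locc f -> locc (fun x => act (a x) (f x)).
Proof.
move=> sM ca lf x; have FF := nbhs_filter x.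
have ca' : continuous (fun y => (a x)^-1 * a y)%g.
  exact: (continuousM (@continuous_cst _ _ _) ca).
have n1 : nbhs ((a x)^-1 * a x)%g [set h | act h (f x) = f x].
  by apply: open_nbhs_nbhs; split; [exact: sM|rewrite /= mulVg act1].
apply: filterS (filterI (lf x) (ca' x _ n1)) => y [/= -> e].
by rewrite -{2}e -actM mulVKg.
Qed.

(** Right cosets of [H] are open, so choosing a representative in each of
   them, the unit in [H] itself, is a continuous operation. *)
Lemma retraction (H : subgroup G) : open (sg_set H) ->
  exists r : G -> H, [/\ continuous r,
    forall (h : H) x, r (\val h * x)%g = (h * r x)%g & forall h : H, r (\val h) = h].
Proof.
move=> oH.
pose s (x : G) : G := if x \in sg_set H then 1%g else xget 1%g [set y | sg_set H (x * y^-1)%g].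
have HsP x : sg_set H (x * (s x)^-1)%g.
  rewrite /s; case: ifP => [/set_mem Hx|_]; first by rewrite invg1 mulg1.
  case: xgetP => [y _ //|/(_ x)]; rewrite /= mulgV => /(_ (sg1 H)) //.
have sM h x : sg_set H h -> s (h * x)%g = s x.
  move=> Hh; rewrite /s.
  have -> : ((h * x)%g \in sg_set H) = (x \in sg_set H).
    apply/idP/idP => /set_mem Hx; apply/mem_set; last exact: sgM.
    by have := sgM (sgV Hh) Hx; rewrite mulKg.
  case: ifP => // _; congr xget; apply/funext => y; apply/propext; split => Hy.
    by have := sgM (sgV Hh) Hy; rewrite /= -mulgA mulKg.
  by rewrite /= -mulgA; exact: sgM.
pose r (x : G) : H := exist _ (x * (s x)^-1)%g (mem_set (HsP x)).
have cs : locc s.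
  move=> x; have n1 : nbhs x [set y | sg_set H (y * x^-1)%g].
    apply: (continuousM (@continuous_id _) (@continuous_cst _ _ (x^-1)%g)).
    by apply: open_nbhs_nbhs; split => //; rewrite mulgV; exact: sg1.
  have FF := nbhs_filter x; apply: filterS n1 => y /= Hy.
  by rewrite -[in LHS](mulgVK x y) sM.
exists r; split.
- apply: sg_continuous => /= x A Ax; have FF := nbhs_filter x.
  have ca : continuous (fun y => y * (s x)^-1)%g.
    exact: (continuousM (@continuous_id _) (@continuous_cst _ _ _)).
  by apply: filterS (filterI (cs x) (ca x _ Ax)) => y [/= ->].
- move=> h x; apply: val_inj; rewrite /= sM; last exact: sg_mem.
  by rewrite mulgA.
- move=> h; apply: val_inj; rewrite /= /s.
  by rewrite (valP h : is_true (\val h \in sg_set H)) invg1 mulg1.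
Qed.

Lemma sg_compact (H : ocsubgroup G) : compact [set: H].
Proof.
have [r [cr _ rK]] := retraction (@oc_open G H).
have -> : [set: H] = r @` sg_set H.
  by apply/predeqP => u; split=> // _; exists (\val u); [exact: sg_mem|exact: rK].
by apply: continuous_compact; [apply: continuous_subspaceT|exact: oc_compact].
Qed.

Lemma sg_compact_power (H : ocsubgroup G) n :
  compact [set y : {ptws 'I_n.+1 -> H} | forall i, [set: H] (y i)].
Proof.
exact: (@tychonoff _ (fun _ : 'I_n.+1 => H) (fun=> [set: H]) (fun=> @sg_compact H)).
Qed.

End TopGroup.

(** * Sums over left cosets *)

Section CosetSums.
Variables (G : topGroupType) (U : ocsubgroup G).

Definition lrep (x : G) : G := xget 1%g [set y | sg_set U (x^-1 * y)%g].

Lemma lrepP x : sg_set U (x^-1 * lrep x)%g.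
Proof.
rewrite /lrep; case: xgetP => [y _ //|/(_ x)]; rewrite /= mulVg.
by move=> /(_ (sg1 U)).
Qed.

Lemma lrepM x u : sg_set U u -> lrep (x * u)%g = lrep x.
Proof.
move=> Uu; rewrite /lrep; congr xget; apply/funext => y; apply/propext; split => Hy.
  by have := sgM Uu Hy; rewrite invgM !mulgA mulgV mul1g.
by rewrite /= invgM -mulgA; exact: sgM (sgV Uu) Hy.
Qed.

Lemma lrep_eq x y : sg_set U (x^-1 * y)%g -> lrep y = lrep x.
Proof. by move=> Uxy; rewrite -[in LHS](mulVKg x y) lrepM. Qed.

Lemma lrepK x : lrep (lrep x) = lrep x.
Proof. exact: lrep_eq (lrepP x). Qed.

Lemma locc_right (Z : Type) (f : G -> Z) :
  (forall x u, sg_set U u -> f (x * u)%g = f x) -> locc f.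
Proof.
move=> fU x.
have nU : nbhs (x^-1 * x)%g (sg_set U).
  by apply: open_nbhs_nbhs; split; [exact: oc_open|rewrite mulVg; exact: sg1].
apply: (nbhs_sub (@mul_continuous G (x^-1)%g x _ nU)) => y /= Uy.
by rewrite -[in LHS](mulVKg x y) fU.
Qed.

Lemma finite_lrep (K : set G) : compact K -> finite_set (lrep @` K).
Proof.
move=> cK; have [s sK] := locc_finite cK (locc_right lrepM).
apply: (@sub_finite_set _ _ [set` map lrep s]); last exact: finite_seq.
by move=> _ [x Kx <-]; have [y ys ->] := sK x Kx; apply/mapP; exists y.
Qed.

Section Sums.
Variable V : zmodType.

Definition rinv (th : G -> V) : Prop :=
  forall x u, sg_set U u -> th (x * u)%g = th x.

Definition vanish_off (K : set G) (th : G -> V) : Prop := forall x, ~ K x -> th x = 0.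

Lemma rinv_lrep th x : rinv th -> th (lrep x) = th x.
Proof. by move=> tU; rewrite -(mulVKg x (lrep x)) tU //; exact: lrepP. Qed.

(** The sum over G/U: the range of [lrep] is a set of representatives, and for
   right invariant [th] of compact support only finitely many of its terms are
   nonzero. *)
Definition csum (th : G -> V) : V := \sum_(x \in range lrep) th x.

Lemma csum_list (K : set G) th : compact K -> rinv th -> vanish_off K th ->
  csum th = \sum_(x <- fset_set (lrep @` K)) th x.
Proof.
move=> cK tU tK; rewrite /csum -(fsbig_finite _ _ (finite_lrep cK)).
apply/esym/fsbig_widen.
  by move=> _ [x _ <-]; exists x.
move=> _ [[y _ <-]] /= nK; rewrite rinv_lrep //; apply: tK => Ky.
by apply: nK; exists y.
Qed.

(** Left translation permutes the left cosets; only the representatives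
   change, which right invariant functions do not see. *)
Lemma csum_mul g th : rinv th -> csum (fun x => th (g * x)%g) = csum th.
Proof.
move=> tU; rewrite /csum [RHS](@reindex_fsbig _ _ _ _ _ (fun x => lrep (g * x)%g) (range lrep)).
  by apply: eq_fsbigr => x _; rewrite rinv_lrep.
split.
- by move=> x _; exists (g * x)%g.
- move=> _ _ /set_mem[x _ <-] /set_mem[y _ <-] e.
  rewrite -[LHS]lrepK -[RHS]lrepK; apply/esym/lrep_eq.
  have := sgM (lrepP (g * lrep x)%g) (sgV (lrepP (g * lrep y)%g)).
  rewrite e [in X in _ -> X]/=; set r := lrep _.
  by rewrite !invgM !invgK !mulgA mulgK mulgVK.
- move=> _ [y _ <-]; exists (lrep (g^-1 * y)%g); first by exists (g^-1 * y)%g.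
  apply: lrep_eq; have := lrepP (g^-1 * y)%g.
  by rewrite invgM invgK mulgA.
Qed.

Lemma csum_one v : csum (fun x => if x \in sg_set U then v else 0) = v.
Proof.
rewrite /csum -(fsbig_widen [set lrep 1%g]).
- rewrite fsbig_set1; have := lrepP 1%g; rewrite invg1 mul1g => U1.
  by rewrite mem_set.
- by move=> _ ->; exists 1%g.
- move=> _ [[x _ <-]] /= ne; rewrite memNset // => Ux; apply: ne.
  by rewrite -[LHS]lrepK; apply: lrep_eq; rewrite invg1 mul1g.
Qed.

End Sums.

Lemma csum_linear (k : comPzRingType) (V : lmodType k) (K : set G) a (th1 th2 : G -> V) :
  compact K -> rinv th1 -> rinv th2 -> vanish_off K th1 -> vanish_off K th2 ->
  csum (fun x => a *: th1 x + th2 x) = a *: csum th1 + csum th2.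
Proof.
move=> cK r1 r2 v1 v2; rewrite !(@csum_list _ K) //.
- by rewrite big_split scaler_sumr.
- by move=> x u Uu; rewrite r1 ?r2.
- by move=> x Kx; rewrite v1 ?v2 // scaler0 addr0.
Qed.

Lemma csum_morph (k : comPzRingType) (V W : lmodType k) (L : V -> W) (K : set G)
    (th : G -> V) :
  linear L -> compact K -> rinv th -> vanish_off K th ->
  L (csum th) = csum (fun x => L (th x)).
Proof.
move=> lL cK r v; rewrite !(@csum_list _ K) //.
- by rewrite (big_morph L (linD lL) (lin0 lL)).
- by move=> x u Uu; rewrite r.
- by move=> x Kx; rewrite v // (lin0 lL).
Qed.

End CosetSums.

(** * The index set of the trace *)

Section Transversal.
Variables (G : topGroupType) (U V : ocsubgroup G).
Hypothesis sUV : sg_set U `<=` sg_set V.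

Definition coset_reps : seq G := fset_set (lrep U @` sg_set V).

Lemma coset_reps_csum (W : zmodType) (th : G -> W) :
  (forall x u, sg_set V x -> sg_set U u -> th (x * u)%g = th x) ->
  csum U (fun x => if x \in sg_set V then th x else 0) = \sum_(x <- coset_reps) th x.
Proof.
move=> tU.
rewrite (@csum_list _ U _ (sg_set V)).
- apply: eq_big_seq => x; rewrite in_fset_set; last exact/finite_lrep/oc_compact.
  move=> /set_mem[y Vy <-]; rewrite mem_set //.
  by have := sgM Vy (sUV (lrepP U y)); rewrite mulVKg.
- exact: oc_compact.
- move=> x u Uu; have Vu := sUV Uu.
  have -> : ((x * u)%g \in sg_set V) = (x \in sg_set V).
    apply/idP/idP => /set_mem Hx; apply/mem_set; last exact: sgM.
    by have := sgM Hx (sgV Vu); rewrite mulgK.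
  by case: ifP => // /set_mem Vx; exact: tU.
- by move=> x Vx; rewrite memNset.
Qed.

Lemma coset_reps_sub x : x \in coset_reps -> sg_set V x.
Proof.
rewrite in_fset_set; last exact/finite_lrep/oc_compact.
move=> /set_mem[y Vy <-].
by have := sgM Vy (sUV (lrepP U y)); rewrite mulVKg.
Qed.

Lemma coset_reps_mul (W : zmodType) (th : G -> W) w : sg_set V w ->
  (forall x u, sg_set V x -> sg_set U u -> th (x * u)%g = th x) ->
  \sum_(x <- coset_reps) th (w * x)%g = \sum_(x <- coset_reps) th x.
Proof.
move=> Vw tU; rewrite -!coset_reps_csum //; last first.
  by move=> x u Vx Uu; rewrite mulgA; exact: (tU _ _ (sgM Vw Vx) Uu).
rewrite -[RHS](csum_mul w).
  congr csum; apply/funext => x.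
  have -> // : ((w * x)%g \in sg_set V) = (x \in sg_set V).
  apply/idP/idP => /set_mem Hx; apply/mem_set; last exact: sgM.
  by have := sgM (sgV Vw) Hx; rewrite mulKg.
move=> x u Uu; have Vu := sUV Uu.
have -> : ((x * u)%g \in sg_set V) = (x \in sg_set V).
  apply/idP/idP => /set_mem Hx; apply/mem_set; last exact: sgM.
  by have := sgM Hx (sgV Vu); rewrite mulgK.
by case: ifP => // /set_mem Vx; exact: tU.
Qed.

End Transversal.

(** * Homomorphisms out of compact inductions *)

Section Frobenius.
Variables (k : comPzRingType) (G : topGroupType).

Definition fixed_by (U : subgroup G) (M : rep k G) (v : M) : Prop :=
  forall u, sg_set U u -> act u v = v.

Lemma csum_act (U : ocsubgroup G) (M : rep k G) (K : set G) (th : G -> M) g :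
  compact K -> rinv U th -> vanish_off K th ->
  csum U (fun x => act g (th (g^-1 * x)%g)) = act g (csum U th).
Proof.
move=> cK r v; rewrite (csum_morph (act_linear g) cK) //.
rewrite -[RHS](csum_mul g^-1%g) // => x u Uu; first by rewrite r.
Qed.

Variable U : ocsubgroup G.

(** Frobenius reciprocity: for [v] fixed by [U], this is the homomorphism that
   sends the characteristic function of [U] to [v]. *)
Definition frob (M : rep k G) (v : M) (phi : Xind k U) : M :=
  csum U (fun x => xval phi x *: act x v).

Lemma frob_rinv (M : rep k G) (v : M) (phi : Xind k U) : fixed_by U v ->
  rinv U (fun x => xval phi x *: act x v).
Proof. by move=> fv x u Uu; rewrite (xvalP phi).1 // actM fv. Qed.

Lemma frob_hom (M : rep k G) (v : M) : fixed_by U v -> is_hom (frob v).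
Proof.
move=> fv; split=> [a phi psi|g phi].
  have [_ [K cK phiK]] := xvalP phi; have [_ [L cL psiL]] := xvalP psi.
  rewrite /frob -(@csum_linear _ U k M (K `|` L)).
  - congr csum; apply/funext => x; rewrite scalerA -scalerDl.
    by congr (_ *: _).
  - exact: compactU.
  - exact: frob_rinv.
  - exact: frob_rinv.
  - by move=> x /not_orP[Kx _]; rewrite phiK // scale0r.
  - by move=> x /not_orP[_ Lx]; rewrite psiL // scale0r.
have [_ [K cK phiK]] := xvalP phi.
rewrite /frob -(@csum_act U M K) //; last first.
- by move=> x Kx; rewrite phiK // scale0r.
- exact: frob_rinv.
congr csum; apply/funext => x.
by rewrite (linZ (act_linear g)) -actM mulVKg.
Qed.

Lemma frob_char (M : rep k G) (v : M) : fixed_by U v -> frob v (charX k U) = v.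
Proof.
move=> fv; rewrite -[RHS](csum_one U); congr csum; apply/funext => x.
change (((x \in sg_set U)%:R : k) *: act x v = if x \in sg_set U then v else 0).
by case: ifP => [/set_mem Ux|_]; rewrite ?scale1r ?scale0r ?fv.
Qed.

Lemma charX_fixed : fixed_by U (charX k U).
Proof.
move=> u Uu; apply: val_inj; apply/funext => x.
change (((u^-1 * x)%g \in sg_set U)%:R = (x \in sg_set U)%:R :> k).
congr (_%:R); congr nat_of_bool; apply/idP/idP => /set_mem Hx; apply/mem_set.
  by have := sgM Uu Hx; rewrite mulVKg.
exact: sgM (sgV Uu) Hx.
Qed.

Lemma xval_linear t : linear (fun phi : Xind k U => xval phi t : k^o).
Proof. by []. Qed.

(** The terms that survive are those with x in t W; substituting t x for x
   turns them into a sum over W / U. *)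
Lemma csum_eval (W : ocsubgroup G) (phi : G -> k) t :
  rinv U phi -> sg_set U `<=` sg_set W ->
  csum U (fun x => phi x * ((x^-1 * t)%g \in sg_set W)%:R) =
  \sum_(x <- coset_reps U W) phi (t * x)%g.
Proof.
move=> r sUW; have memW x : ((x^-1 * t)%g \in sg_set W) = ((t^-1 * x)%g \in sg_set W).
  by apply/idP/idP => /set_mem /sgV; rewrite invgM invgK => Hx; apply/mem_set.
rewrite -(coset_reps_csum sUW); last by move=> x u _ Uu; rewrite mulgA r.
rewrite -[LHS](csum_mul t).
  congr csum; apply/funext => x; rewrite memW mulKg.
  by case: ifP => _; rewrite ?mulr0 ?mulr1.
move=> x u Uu; rewrite r // !memW; congr (_ * (nat_of_bool _)%:R).
rewrite mulgA; apply/idP/idP => /set_mem Hx; apply/mem_set; last exact/sgM/sUW.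
by have := sgM Hx (sUW _ (sgV Uu)); rewrite mulgK.
Qed.

Lemma coset_reps_id (V : zmodType) (th : G -> V) : rinv U th ->
  \sum_(x <- coset_reps U U) th x = th 1%g.
Proof.
move=> r; rewrite -coset_reps_csum //; last by move=> x u _; exact: r.
rewrite -[RHS](csum_one U); congr csum; apply/funext => x.
by case: ifP => // /set_mem Ux; rewrite -(mul1g x) r.
Qed.

(** By [csum_eval] with W = U. Hence a homomorphism on X_U is determined by
   its value on the characteristic function of [U], which is [hom_charX]. *)
Lemma charX_span (phi : Xind k U) : frob (charX k U) phi = phi.
Proof.
have [r [K cK phiK]] := xvalP phi.
apply: val_inj; apply/funext => t.
change (xval (frob (charX k U) phi) t = xval phi t).
rewrite -[in RHS](mulg1 t) -(@coset_reps_id _ (fun x => xval phi (t * x)%g)); last first.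
  by move=> x u Uu; rewrite mulgA r.
rewrite -csum_eval //.
rewrite /frob (csum_morph (xval_linear t) cK) //.
  exact: (frob_rinv _ charX_fixed).
by move=> x Kx; rewrite phiK // scale0r.
Qed.

Lemma hom_charX (M : rep k G) (f : Xind k U -> M) : is_hom f ->
  f = frob (f (charX k U)).
Proof.
move=> [lf ef]; apply/funext => phi.
have [r [K cK phiK]] := xvalP phi.
rewrite -[in LHS](charX_span phi) /frob (csum_morph lf cK).
- by congr csum; apply/funext => x; rewrite (linZ lf) ef.
- exact: (frob_rinv _ charX_fixed).
- by move=> x Kx; rewrite phiK // scale0r.
Qed.

Lemma hom_char_fixed (M : rep k G) (f : Xind k U -> M) : is_hom f ->
  fixed_by U (f (charX k U)).
Proof. by move=> [_ ef] u Uu; rewrite -ef charX_fixed. Qed.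

End Frobenius.

Section Functoriality.
Variables (k : comPzRingType) (G : topGroupType) (U V : ocsubgroup G).
Hypothesis sUV : sg_set U `<=` sg_set V.

Lemma iotaX_hom : is_hom (@iotaX k G U V sUV).
Proof. by split=> [a x y|h v]; apply: val_inj. Qed.

Lemma piX_spec : is_hom (@piX k G U V) /\ piX V (charX k U) = charX k V.
Proof.
have fV : fixed_by U (charX k V) by move=> u /sUV; exact: charX_fixed.
rewrite /piX; case: xgetP => [y _ //|/(_ (frob (charX k V)))] [].
by split; [exact: frob_hom|exact: frob_char].
Qed.

Lemma piX_val (phi : Xind k U) t :
  xval (piX V phi) t = \sum_(x <- coset_reps U V) xval phi (t * x)%g.
Proof.
have [hp pc] := piX_spec; have [r [K cK phiK]] := xvalP phi.
have fV : fixed_by U (charX k V) by move=> u /sUV; exact: charX_fixed.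
rewrite (hom_charX hp) pc -(csum_eval (phi := xval phi)) //.
rewrite /frob (csum_morph (@xval_linear _ _ V t) cK) //.
  exact: (frob_rinv _ fV).
by move=> x Kx; rewrite phiK // scale0r.
Qed.

Lemma hom_iota_char (M : rep k G) (f : Xind k U -> M) : is_hom f ->
  f (iotaX sUV (charX k V)) =
  \sum_(x <- coset_reps U V) act x (f (charX k U)).
Proof.
move=> hf; have fx := hom_char_fixed hf.
rewrite {1}(hom_charX hf) -(coset_reps_csum sUV); last first.
  by move=> x u _ Uu; rewrite actM fx.
congr csum; apply/funext => x.
change (((x \in sg_set V)%:R : k) *: act x (f (charX k U)) =
  if x \in sg_set V then act x (f (charX k U)) else 0).
by case: ifP; rewrite ?scale1r ?scale0r.
Qed.

End Functoriality.

(** * Means on injective representations *)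

Section Mean.
Variables (k : comPzRingType) (G : topGroupType) (U : ocsubgroup G) (M : rep k G).

(** An equivariant substitute for averaging functions over [U], which in
   general cannot be defined by dividing by indices. The last clause
   lets [rho] be applied to functions on all of [G]. *)
Definition mean (rho : (G -> M) -> M) : Prop :=
  [/\ forall a f g, locc f -> locc g -> rho (a *: f + g) = a *: rho f + rho g,
      forall v, rho (fun=> v) = v,
      forall u f, sg_set U u -> locc f ->
        rho (fun x => act u (f (u^-1 * x)%g)) = act u (rho f)
    & forall f g, (forall x, sg_set U x -> f x = g x) -> rho f = rho g].

Definition ltr (g : G) (f : G -> M) : G -> M := fun x => f (g^-1 * x)%g.

Fact ltr_linear g : linear (ltr g).
Proof. by []. Qed.

Fact ltr1 f : ltr 1%g f = f.
Proof. by apply/funext => x; rewrite /ltr invg1 mul1g. Qed.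

Fact ltrM g h f : ltr (g * h)%g f = ltr g (ltr h f).
Proof. by apply/funext => x; rewrite /ltr invgM mulgA. Qed.

Definition funM : rep k G := Rep ltr_linear ltr1 ltrM.

Definition lcc : set (G -> M) :=
  [set f | locc f /\ exists2 K, compact K & forall x, ~ K x -> f x = 0].

Fact lcc0 : lcc 0.
Proof. by split; [exact: locc_cst|exists set0 => //; exact: compact0]. Qed.

Fact lccD f g : lcc f -> lcc g -> lcc (f + g).
Proof.
move=> [lf [K cK fK]] [lg [L cL gL]]; split; first exact: locc_op2.
exists (K `|` L); first exact: compactU.
move=> x /not_orP[Kx Lx]; change (f x + g x = 0).
by rewrite fK ?gL ?addr0.
Qed.

Fact lccZ a f : lcc f -> lcc (a *: f).
Proof.
move=> [lf [K cK fK]]; split; first exact: (locc_post (fun v => a *: v) lf).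
by exists K => // x Kx; change (a *: f x = 0); rewrite fK ?scaler0.
Qed.

Definition lccs : submod funM := Submod lcc0 lccD lccZ.

Fact lcc_ltr g f : lcc f -> lcc (ltr g f).
Proof.
move=> [lf [K cK fK]]; split; first exact: (locc_comp (@mul_continuous G g^-1%g) lf).
exists [set (g * x)%g | x in K]; first exact: compact_ltrans.
move=> x Kx; apply: fK => Kgx; apply: Kx.
by exists (g^-1 * x)%g; rewrite // mulVKg.
Qed.

(** After the substitution psi x = x^-1 phi x, the diagonal action of [G] on
   M-valued functions becomes translation alone, for which smoothness only
   uses compact supports. *)
Definition Brep : rep k G := sub_rep (S := lccs) lcc_ltr.

(** In terms of psi, a function phi that is constant on left cosets of [U]
   satisfies psi (x u) = u^-1 psi x. *)
Definition lcu : set (G -> M) :=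
  [set f | lcc f /\ forall x u, sg_set U u -> f (x * u)%g = act u^-1%g (f x)].

Fact lcu0 : lcu 0.
Proof.
by split; [exact: lcc0|move=> x u _; rewrite (lin0 (act_linear _))].
Qed.

Fact lcuD f g : lcu f -> lcu g -> lcu (f + g).
Proof.
move=> [lf fU] [lg gU]; split; first exact: lccD.
move=> x u Uu; change (f (x * u)%g + g (x * u)%g = act u^-1%g (f x + g x)).
by rewrite fU ?gU // (linD (act_linear _)).
Qed.

Fact lcuZ a f : lcu f -> lcu (a *: f).
Proof.
move=> [lf fU]; split; first exact: lccZ.
move=> x u Uu; change (a *: f (x * u)%g = act u^-1%g (a *: f x)).
by rewrite fU // (linZ (act_linear _)).
Qed.

Definition lcus : submod funM := Submod lcu0 lcuD lcuZ.

Fact lcu_ltr g f : lcu f -> lcu (ltr g f).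
Proof.
move=> [lf fU]; split; first exact: lcc_ltr.
by move=> x u Uu; rewrite /ltr mulgA fU.
Qed.

Definition Arep : rep k G := sub_rep (S := lcus) lcu_ltr.

Lemma ltr_stab_open f : lcc f -> open [set h | ltr h f = f].
Proof.
move=> [lf [K cK fK]]; rewrite openE => h0 /= e0.
have e1 x : f (h0^-1 * x)%g = f x by rewrite -[in RHS]e0.
have e2 x : f (h0 * x)%g = f x by rewrite -e1 mulKg.
have c1 : continuous (fun xh : G * G => xh.2^-1 * xh.1)%g.
  by apply: continuousM; [apply: continuousV => x; exact: cvg_snd|move=> x; exact: cvg_fst].
have c2 : continuous (fun xh : G * G => xh.2 * xh.1)%g.
  by apply: continuousM => x; [exact: cvg_snd|exact: cvg_fst].
have n1 := locc_tube cK (fun x _ => locc_comp c1 lf (x, h0)).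
have n2 := locc_tube cK (fun x _ => locc_comp c2 lf (x, h0)).
apply: (nbhs_sub (@filterI _ _ (nbhs_filter h0) _ _ n1 n2)) => h [/= h1 h2].
apply/funext => x; change (f (h^-1 * x)%g = f x).
have [Kx|Kx] := pselect (K x); first by rewrite h1 // e1.
have [Khx|Khx] := pselect (K (h^-1 * x)%g).
  by have := h2 _ Khx; rewrite e2 mulVKg => ->.
by rewrite !fK.
Qed.

Lemma smooth_sub (S : submod funM) (stabS : forall h v, sm_set S v -> sm_set S (act h v)) :
  (forall f, sm_set S f -> lcc f) -> smooth (sub_rep stabS).
Proof.
move=> Sl f; have lf := ltr_stab_open (Sl _ (set_mem (valP f))).
have -> // : [set h | act h f = f] = [set h | ltr h (\val f) = \val f].
by apply/predeqP => h; split=> [/(congr1 val)//|e]; exact: val_inj.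
Qed.

(** Summation over G/U is a homomorphism to [M] on the functions that are
   constant on left cosets of [U]. Injectivity extends it to all locally
   constant functions of compact support, and on those supported by [U] the
   extension is a mean. *)
Lemma injective_mean : smooth M -> injective_rep M -> exists rho, mean rho.
Proof.
move=> sM iM.
have sB : smooth Brep by apply: smooth_sub.
have sA : smooth Arep by apply: smooth_sub => f [].
pose i (a : Arep) : Brep := exist _ (\val a) (mem_set (set_mem (valP a)).1).
have hi : is_hom i by split=> [b x y|h v]; apply: val_inj.
have ii : injective i by move=> x y /(congr1 val) e; apply: val_inj.
pose s (a : Arep) : M := csum U (fun x => act x ((\val a : G -> M) x)).
have rs (a : Arep) : rinv U (fun x => act x ((\val a : G -> M) x)).
  by move=> x u Uu; have [_ ->] := set_mem (valP a); rewrite // actM -(actM u) mulgV act1.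
have hs : is_hom s.
  split=> [b x y|h v].
    have [[_ [K cK xK]] _] := set_mem (valP x); have [[_ [L cL yL]] _] := set_mem (valP y).
    rewrite /s -(@csum_linear _ U k M (K `|` L)) //.
    - congr csum; apply/funext => z; rewrite -act_linear.
      by congr (act z _).
    - exact: compactU.
    - by move=> z /not_orP[Kz _]; rewrite xK // (lin0 (act_linear _)).
    - by move=> z /not_orP[_ Lz]; rewrite yL // (lin0 (act_linear _)).
  have [[_ [K cK vK]] _] := set_mem (valP v).
  rewrite /s -(@csum_act _ _ U M K) //; last first.
    by move=> x Kx; rewrite vK // (lin0 (act_linear _)).
  by congr csum; apply/funext => x; rewrite -actM mulVKg.
have [g [lg eg] gi] := iM _ _ i s sA sB hi ii hs.
pose tw (f : G -> M) : G -> M := fun x => if x \in sg_set U then act x^-1%g (f x) else 0.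
have memU : locc (fun x : G => x \in sg_set U).
  apply: (@locc_right _ U) => x u Uu; apply/idP/idP => /set_mem Hx; apply/mem_set.
    by have := sgM Hx (sgV Uu); rewrite mulgK.
  exact: sgM.
have twP f : locc f -> lcc (tw f).
  move=> lf; split.
    have la := locc_act sM (continuousV (@continuous_id G)) lf.
    exact: (locc_op2 (fun (b : bool) (v : M) => if b then v else 0) memU la).
  exists (sg_set U); first exact: oc_compact.
  by move=> x Ux; rewrite /tw memNset.
pose ex (f : G -> M) : Brep := insubd (0 : sm_type lccs) (tw f).
have exE f : locc f -> \val (ex f) = tw f.
  by move=> lf; rewrite insubdK //; apply/mem_set/twP.
exists (fun f => g (ex f)); split.
- move=> a f h lf lh; rewrite -lg; congr g; apply: val_inj.
  have laf : locc (a *: f + h).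
    exact: (locc_op2 (fun v w => a *: v + w) lf lh).
  change (\val (ex (a *: f + h)) = a *: \val (ex f) + \val (ex h)).
  rewrite !exE //; apply/funext => x.
  change (tw (a *: f + h) x = a *: tw f x + tw h x).
  by rewrite /tw; case: ifP => _; rewrite ?scaler0 ?addr0 // -act_linear.
- move=> v; have lv : locc (fun _ : G => v) by exact: locc_cst.
  have cvP : lcu (tw (fun=> v)).
    split; first exact: twP.
    move=> x u Uu; rewrite /tw.
    have -> : ((x * u)%g \in sg_set U) = (x \in sg_set U).
      apply/idP/idP => /set_mem Hx; apply/mem_set; last exact: sgM.
      by have := sgM Hx (sgV Uu); rewrite mulgK.
    by case: ifP => _; rewrite ?(lin0 (act_linear _)) // invgM actM.
  pose a : Arep := exist (fun x : funM => sm_pred lcus x) _ (mem_set cvP).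
  have -> : ex (fun=> v) = i a by apply: val_inj; rewrite exE.
  rewrite -[g (i a)]/((g \o i) a) gi /s -[RHS](csum_one U); congr csum.
  apply/funext => x; rewrite /= /tw; case: ifP => _; last exact: (lin0 (act_linear _)).
  by rewrite -actM mulgV act1.
- move=> u f Uu lf; rewrite -eg; congr g; apply: val_inj.
  have luf : locc (fun x => act u (f (u^-1 * x)%g)).
    apply: (locc_post (act u)); exact: (locc_comp (@mul_continuous G u^-1%g) lf).
  change (\val (ex (fun x => act u (f (u^-1 * x)%g))) = ltr u (\val (ex f))).
  rewrite !exE //; apply/funext => x; rewrite /ltr /tw.
  have -> : ((u^-1 * x)%g \in sg_set U) = (x \in sg_set U).
    apply/idP/idP => /set_mem Hx; apply/mem_set; last exact: sgM (sgV Uu) Hx.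
    by have := sgM Uu Hx; rewrite mulVKg.
  by case: ifP => // _; rewrite -actM invgM invgK.
- move=> f h fh; congr g; congr insubd; apply/funext => x; rewrite /tw.
  by case: ifP => // /set_mem /fh ->.
Qed.

End Mean.

(** * Equivariant cochains on the whole group *)

Section Cochains.
Variables (k : comPzRingType) (G : topGroupType) (U : subgroup G).

Definition ueq (M : rep k G) (n : nat) (f : ('I_n.+1 -> G) -> M) : Prop :=
  forall u x, sg_set U u -> f (fun i => (u * x i)%g) = act u (f x).

(** Cochains for the cohomology of [U] that are defined on the powers of [G];
   the larger domain makes room for translation by elements of [G] and for the
   passage between subgroups. *)
Definition ucoch (M : rep k G) (n : nat) (f : ('I_n.+1 -> G) -> M) : Prop :=
  loc_const f /\ ueq f.

Lemma ucoch0 (M : rep k G) n : ucoch (0 : ('I_n.+1 -> G) -> M).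
Proof. by split; [exact: loc_const0|move=> u x _; rewrite (lin0 (act_linear _))]. Qed.

Lemma ucochL (M : rep k G) n a (f g : ('I_n.+1 -> G) -> M) :
  ucoch f -> ucoch g -> ucoch (a *: f + g).
Proof.
move=> [lf ef] [lg eg]; split; first exact/loc_constD/lg/loc_constZ/lf.
move=> u x Uu; change (a *: f (fun i => (u * x i)%g) + g (fun i => (u * x i)%g) =
  act u (a *: f x + g x)).
by rewrite ef // eg // act_linear.
Qed.

Lemma ucoch_dif (M : rep k G) n (f : ('I_n.+1 -> G) -> M) :
  ucoch f -> ucoch (bar_dif f).
Proof.
move=> [lf ef]; split; first exact: loc_const_dif.
move=> u x Uu; rewrite /bar_dif.
rewrite (big_morph (act u) (linD (act_linear u)) (lin0 (act_linear u))).
apply: eq_bigr => j _; rewrite (linZ (act_linear u)) -ef //.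
Qed.

Lemma ucoch_hom (M N : rep k G) (L : M -> N) n (f : ('I_n.+1 -> G) -> M) :
  is_hom L -> ucoch f -> ucoch (fun x => L (f x)).
Proof.
move=> [lL eL] [lf ef]; split; first exact: (locc_post L lf).
by move=> u x Uu; rewrite ef // eL.
Qed.

Lemma ucochZ (M : rep k G) n a (f : ('I_n.+1 -> G) -> M) :
  ucoch f -> ucoch (a *: f).
Proof. by move=> cf; rewrite -[a *: f]addr0; exact: ucochL cf (ucoch0 _ _). Qed.

Lemma bar_dif_lin (M N : rep k G) (L : M -> N) n (f : ('I_n.+1 -> G) -> M) x :
  linear L -> bar_dif (fun x => L (f x)) x = L (bar_dif f x).
Proof.
move=> lL; rewrite /bar_dif (big_morph L (linD lL) (lin0 lL)).
by apply: eq_bigr => j _; rewrite (linZ lL).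
Qed.

(** The rows of the double complex are exact: any lift of the values, twisted
   by the first variable to make it equivariant, is again a cochain. *)
Lemma ucoch_lift (M N : rep k G) (d : M -> N) n (z : ('I_n.+1 -> G) -> N) :
  smooth M -> smooth N -> is_hom d -> ucoch z -> (forall x, exists w, d w = z x) ->
  exists2 w, ucoch w & forall x, d (w x) = z x.
Proof.
move=> sM sN [ld ed] [lz ez] zd.
pose s (v : N) : M := xget 0 [set w | d w = v].
have sP v : (exists w, d w = v) -> d (s v) = v.
  by move=> [w dw]; rewrite /s; case: xgetP => [y _ //|/(_ w)].
have c0 : continuous (fun x : {ptws 'I_n.+1 -> G} => x ord0).
  exact: (@ptws_coord G _ ord0).
exists (fun x => act (x ord0) (s (act (x ord0)^-1%g (z x)))); first split.
- apply: (locc_act sM c0); apply: (locc_post s).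
  by apply: locc_act => //; exact: continuousV.
- move=> u x Uu; rewrite ez //.
  have -> : act ((u * x ord0)^-1)%g (act u (z x)) = act (x ord0)^-1%g (z x).
    by rewrite -actM invgM mulgVK.
  by rewrite actM.
- move=> x; rewrite ed sP -?actM ?mulgV ?act1 //.
  by have [w <-] := zd x; exists (act (x ord0)^-1%g w); rewrite ed.
Qed.

End Cochains.

(** * The contracting homotopy given by a mean *)

Section MeanHomotopy.
Variables (k : comPzRingType) (G : topGroupType).

Definition hcons (T : Type) (p : nat) (u : T) (x : 'I_p.+1 -> T) : 'I_p.+2 -> T :=
  fun l => oapp x u (unlift ord0 l).

Lemma hcons0 (T : Type) p (u : T) (x : 'I_p.+1 -> T) : hcons u x ord0 = u.
Proof. by rewrite /hcons unlift_none. Qed.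

Lemma hconsS (T : Type) p (u : T) (x : 'I_p.+1 -> T) i : hcons u x (lift ord0 i) = x i.
Proof. by rewrite /hcons liftK. Qed.

Lemma hcons_map (T T' : Type) (s : T -> T') p (u : T) (x : 'I_p.+1 -> T) :
  hcons (s u) (fun i => s (x i)) = fun l => s (hcons u x l).
Proof. by apply/funext => l; rewrite /hcons; case: unlift. Qed.

Lemma hcons_lift0 (T : Type) p (u : T) (x : 'I_p.+1 -> T) : hcons u x \o lift ord0 = x.
Proof. by apply/funext => i; rewrite /= hconsS. Qed.

Lemma hcons_lift (T : Type) p (u : T) (x : 'I_p.+2 -> T) j :
  hcons u x \o lift (lift ord0 j) = hcons u (x \o lift j).
Proof.
apply/funext => i; case: (unliftP ord0 i) => [l ->|->] /=.
  rewrite hconsS /=; have -> : lift (lift ord0 j) (lift ord0 l) = lift ord0 (lift j l).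
    by apply: val_inj; rewrite /= /bump /= !add1n ltnS addnS.
  by rewrite hconsS.
rewrite hcons0; have -> : lift (lift ord0 j) ord0 = ord0 :> 'I_p.+3.
  by apply: val_inj.
exact: hcons0.
Qed.

Lemma hcons1_lift (T : Type) (u : T) (x : 'I_1 -> T) :
  hcons u x \o lift (lift ord0 ord0) = fun=> u.
Proof.
apply/funext => i; rewrite /= (ord1 i).
have -> : lift (lift ord0 ord0) ord0 = ord0 :> 'I_2 by apply: val_inj.
exact: hcons0.
Qed.

Lemma hcons_continuous p :
  continuous (fun ux : G * {ptws 'I_p.+1 -> G} => hcons ux.1 ux.2 : {ptws 'I_p.+2 -> G}).
Proof.
apply: ptws_continuous => i; case: (unliftP ord0 i) => [l ->|->].
  have -> : (fun ux : G * {ptws 'I_p.+1 -> G} => hcons ux.1 ux.2 (lift ord0 l)) =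
      fun ux => ux.2 l by apply/funext => ux; rewrite hconsS.
  move=> ux; apply: (@continuous_comp _ _ _ _ (fun x : {ptws 'I_p.+1 -> G} => x l)).
    exact: cvg_snd.
  exact: ptws_coord.
have -> : (fun ux : G * {ptws 'I_p.+1 -> G} => hcons ux.1 ux.2 ord0) =
    fun ux => ux.1 by apply/funext => ux; rewrite hcons0.
by move=> ux; exact: cvg_fst.
Qed.

Variables (U : ocsubgroup G) (M : rep k G) (rho : (G -> M) -> M).
Hypothesis mr : mean U rho.

Definition hmean p (f : ('I_p.+2 -> G) -> M) : ('I_p.+1 -> G) -> M :=
  fun x => rho (fun u => f (hcons u x)).

Definition hmean0 (f : ('I_1 -> G) -> M) : M := rho (fun u => f (fun=> u)).

Lemma locc_hcons p (f : ('I_p.+2 -> G) -> M) x :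
  loc_const f -> locc (fun u => f (hcons u x)).
Proof.
move=> lf.
apply: (@locc_comp _ _ _ (fun u : G => hcons u x : {ptws 'I_p.+2 -> G}) f) => //.
apply: (@ptws_continuous G) => i; case: (unliftP ord0 i) => [l ->|->].
  have -> : (fun u => hcons u x (lift ord0 l)) = fun=> x l.
    by apply/funext => u; rewrite hconsS.
  exact: continuous_cst.
have -> : (fun u => hcons u x ord0) = id by apply/funext => u; rewrite hcons0.
exact: continuous_id.
Qed.

Lemma locc_diag (f : ('I_1 -> G) -> M) :
  loc_const f -> locc (fun u => f (fun=> u)).
Proof.
move=> lf.
apply: (@locc_comp _ _ _ (fun u : G => (fun=> u) : {ptws 'I_1 -> G}) f) => //.
by apply: (@ptws_continuous G) => i; exact: continuous_id.
Qed.

Lemma mean0 : rho 0 = 0.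
Proof. by have [_ rc _ _] := mr; exact: rc. Qed.

Lemma mean_sum n (F : 'I_n -> G -> M) (c : 'I_n -> k) : (forall j, locc (F j)) ->
  rho (fun u => \sum_(j < n) c j *: F j u) = \sum_(j < n) c j *: rho (F j).
Proof.
have [rl _ _ _] := mr.
elim: n F c => [|n IH] F c lF.
  rewrite big_ord0 -[RHS]mean0; congr rho.
  by apply/funext => u; rewrite big_ord0.
rewrite big_ord_recl -IH // -rl //.
  by congr rho; apply/funext => u; rewrite big_ord_recl.
apply: (@locc_sum _ _ _ _ (fun j u => c (lift ord0 j) *: F (lift ord0 j) u)) => j.
exact: (locc_post (fun v => c (lift ord0 j) *: v) (lF _)).
Qed.

(** Inserting a fixed element as first variable contracts the cochain complex
   but is not equivariant; averaging over the inserted element with the mean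
   repairs this. *)
Lemma hmeanK p (f : ('I_p.+2 -> G) -> M) : loc_const f ->
  hmean (bar_dif f) = f - bar_dif (hmean f).
Proof.
move=> lf; have [rl rc _ _] := mr; apply/funext => x; rewrite /hmean.
have -> : (fun u => bar_dif f (hcons u x)) = fun u =>
    1 *: f x + \sum_(j < p.+2) - (-1) ^+ j *: f (hcons u (x \o lift j)).
  apply/funext => u; rewrite /bar_dif big_ord_recl hcons_lift0 /= expr0.
  congr (_ + _); apply: eq_bigr => j _; rewrite hcons_lift.
  by rewrite /bump /= add1n exprS mulN1r.
rewrite [LHS](rl 1 (fun=> f x)) ?rc ?scale1r; last 2 first.
- exact: locc_cst.
- apply: (@locc_sum _ _ _ _ (fun (j : 'I_p.+2) u => - (-1) ^+ j *: f (hcons u (x \o lift j)))).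
  by move=> j; apply: (locc_post (fun v => - (-1) ^+ j *: v)); exact: locc_hcons.
rewrite mean_sum; last by move=> j; exact: locc_hcons.
change (f x + \sum_(j < p.+2) - (-1) ^+ j *: hmean f (x \o lift j) =
  f x - bar_dif (hmean f) x).
by congr (_ + _); rewrite /bar_dif -sumrN; apply: eq_bigr => j _; rewrite scaleNr.
Qed.

Lemma hmean0K (f : ('I_1 -> G) -> M) : loc_const f ->
  hmean (bar_dif f) = f - (fun=> hmean0 f).
Proof.
move=> lf; have [rl rc _ _] := mr; apply/funext => x; rewrite /hmean.
have -> : (fun u => bar_dif f (hcons u x)) = fun u =>
    (-1) *: f (fun=> u) + f x.
  apply/funext => u; rewrite /bar_dif big_ord_recl big_ord1 hcons_lift0 hcons1_lift /=.
  by rewrite expr0 scale1r addrC.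
rewrite [LHS](rl (-1) (fun u => f (fun=> u)) (fun=> f x)) ?rc ?scaleN1r.
- by rewrite addrC.
- exact: locc_diag.
- exact: locc_cst.
Qed.

Lemma hmean_locc p (f : ('I_p.+2 -> G) -> M) : loc_const f -> loc_const (hmean f).
Proof.
have [_ _ _ rU] := mr; move=> lf x; have lfh := locc_comp (@hcons_continuous p) lf.
have n1 := locc_tube (x := x : {ptws 'I_p.+1 -> G}) (@oc_compact G U) (fun s _ => lfh (s, _)).
apply: (nbhs_sub n1) => y /= ey.
by apply: rU => u Uu; exact: ey.
Qed.

Lemma hmean_ucoch p (f : ('I_p.+2 -> G) -> M) : ucoch U f -> ucoch U (hmean f).
Proof.
move=> [lf ef]; have [_ _ re _] := mr; split; first exact: hmean_locc.
move=> u x Uu; rewrite /hmean -re //; last exact: locc_hcons.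
congr rho; apply/funext => v; rewrite -ef //; congr f.
rewrite -(hcons_map (fun g => (u * g)%g)).
by rewrite mulVKg.
Qed.

Lemma hmean0_fixed (f : ('I_1 -> G) -> M) : ucoch U f -> fixed_by U (hmean0 f).
Proof.
move=> [lf ef] u Uu; have [_ _ re _] := mr; rewrite /hmean0 -re //.
  congr rho; apply/funext => v; rewrite -ef //; congr f.
  by apply/funext => i; rewrite mulVKg.
exact: locc_diag.
Qed.

End MeanHomotopy.

(** * Zigzags *)

Section Zigzag.
Variables (k : comPzRingType) (G : topGroupType).

(** [zig U d z v] joins the cochain [z] with values in [J 0] to the vector [v]
   of [J p] through the double complex of cochains with values in [J]: z =
   delta w_{p-1}, d w_{p-1} = +- delta w_{p-2}, ..., d w_0 = +- v. The
   recursion shifts [J], so that every step starts in degree 0; the signs are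
   those produced by a comparison morphism in [comparison_zig_nat]. *)
Fixpoint zig (U : subgroup G) (p : nat) : forall (J : nat -> rep k G)
    (d : forall n, J n -> J n.+1), (('I_p.+1 -> G) -> J 0) -> J p -> Prop :=
  match p with
  | 0 => fun J d z v => z = fun=> v
  | q.+1 => fun J d z v => exists w : ('I_q.+1 -> G) -> J 0,
      [/\ ucoch U w, bar_dif w = z
        & zig U (J := fun n => J n.+1) (fun n => d n.+1)
            (fun x => (-1) ^+ q.+1 *: d 0 (w x)) v]
  end.

Definition bdry (U : subgroup G) (J : nat -> rep k G)
    (d : forall n, J n -> J n.+1) (p : nat) : J p -> Prop :=
  match p with
  | 0 => fun v => v = 0
  | q.+1 => fun v => exists2 w, fixed_by U w & d q w = v
  end.

(** An injective resolution without its augmentation; [injective_mean]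
   provides the means. *)
Definition acyclic_seq (U : ocsubgroup G) (J : nat -> rep k G)
    (d : forall n, J n -> J n.+1) : Prop :=
  forall n, [/\ smooth (J n), is_hom (d n), exists rho : (G -> J n) -> J n, mean U rho
    & forall v : J n.+1, d n.+1 v = 0 <-> exists w, d n w = v].

Lemma acyclic_shift (U : ocsubgroup G) (J : nat -> rep k G)
    (d : forall n, J n -> J n.+1) :
  acyclic_seq U d -> acyclic_seq U (J := fun n => J n.+1) (fun n => d n.+1).
Proof. by move=> aJ n; exact: (aJ n.+1). Qed.

Lemma zig_linear (U : subgroup G) p (J : nat -> rep k G)
    (d : forall n, J n -> J n.+1) a z z' v v' : (forall n, linear (d n)) ->
  zig U d z v -> zig U d z' v' -> zig U (p := p) d (a *: z + z') (a *: v + v').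
Proof.
elim: p J d z z' v v' => [|p IH] J d z z' v v' ld; first by move=> /= -> ->.
move=> [w [cw wz zw]] [w' [cw' wz' zw']]; exists (a *: w + w'); split.
- exact: ucochL.
- by rewrite bar_dif_linear wz wz'.
- have := IH _ (fun n => d n.+1) _ _ _ _ (fun n => ld n.+1) zw zw'.
  congr zig; apply/funext => x.
  change (a *: ((-1) ^+ p.+1 *: d 0 (w x)) + (-1) ^+ p.+1 *: d 0 (w' x) =
    (-1) ^+ p.+1 *: d 0 (a *: w x + w' x)).
  by rewrite ld scalerDr !scalerA mulrC.
Qed.

Lemma zig0 (U : subgroup G) p (J : nat -> rep k G) (d : forall n, J n -> J n.+1) :
  (forall n, linear (d n)) -> zig U (p := p) d 0 0.
Proof.
elim: p J d => [|p IH] J d ld //=.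
exists 0; split; first exact: ucoch0.
  exact: (lin0 (@bar_dif_linear _ _ _ _)).
have := IH _ (fun n => d n.+1) (fun n => ld n.+1); congr zig.
by apply/funext => x; rewrite (lin0 (ld 0)) scaler0.
Qed.

Lemma zig_sub (U : subgroup G) p (J : nat -> rep k G) (d : forall n, J n -> J n.+1)
    z z' v v' : (forall n, linear (d n)) ->
  zig U d z v -> zig U d z' v' -> zig U (p := p) d (z - z') (v - v').
Proof.
move=> ld zv zv'; rewrite -[z - z']addrC -[v - v']addrC -!scaleN1r.
exact: zig_linear.
Qed.

Section Acyclic.
Variable U : ocsubgroup G.

(** Start from the constant cochain [v] and climb along the exact rows. *)
Lemma zig_total p (J : nat -> rep k G) (d : forall n, J n -> J n.+1) v :
  acyclic_seq U d -> fixed_by U v -> d p v = 0 ->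
  exists z, [/\ ucoch U z, bar_dif z = 0, forall x, d 0 (z x) = 0 & zig U d z v].
Proof.
elim: p J d v => [|p IH] J d v aJ fv dv.
  exists (fun=> v); split => //.
    by split; [exact: locc_cst|move=> u x Uu; rewrite fv].
  apply/funext => x; rewrite /bar_dif big_ord_recl big_ord1 /=.
  by rewrite expr0 expr1 scale1r scaleN1r subrr.
have [z [cz dz hz zv]] := IH _ (fun n => d n.+1) v (acyclic_shift aJ) fv dv.
have [s0 h0 _ ex0] := aJ 0; have [s1 _ _ _] := aJ 1.
have [|w cw wz] := ucoch_lift s0 s1 h0 (ucochZ ((-1) ^+ p.+1) cz).
  move=> x; apply/ex0; have [_ [l1 _] _ _] := aJ 1.
  by change (d 1 ((-1) ^+ p.+1 *: z x) = 0); rewrite (linZ l1) hz scaler0.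
exists (bar_dif w); split.
- exact: ucoch_dif.
- exact: bar_dif_dif.
- move=> x; rewrite -(bar_dif_lin _ _ h0.1).
  have -> : (fun x => d 0 (w x)) = (-1) ^+ p.+1 *: z by apply/funext.
  by rewrite (linZ (@bar_dif_linear _ _ _ _)) dz scaler0.
- exists w; split => //; move: zv; congr zig; apply/funext => x.
  rewrite wz; change (z x = (-1) ^+ p.+1 *: ((-1) ^+ p.+1 *: z x)).
  by rewrite scalerA -exprD addnn -mul2n exprM sqrrN expr1n expr1n scale1r.
Qed.

(** The columns are exact: in a zigzag that starts at 0, the first cochain is
   a coboundary by [hmeanK], and subtracting what it contributes shortens the
   zigzag. *)
Lemma zig_bdry p (J : nat -> rep k G) (d : forall n, J n -> J n.+1) v :
  acyclic_seq U d -> zig U (p := p) d 0 v -> bdry U d v.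
Proof.
elim: p J d v => [|p IH] J d v aJ.
  by move=> /(congr1 (fun f => f (fun=> 1%g))) /= <-.
move=> [w [cw dw zv]]; have [s0 h0 [rho mr] ex0] := aJ 0.
have aS := acyclic_shift aJ.
have ldS n : linear (d n.+1) by have [_ []] := aJ n.+1.
case: p IH w cw dw v zv => [|p] IH w cw dw v zv.
  have e := hmean0K mr cw.1.
  have w0 : w = fun=> hmean0 rho w.
    apply/eqP; rewrite -subr_eq0 -e dw; apply/eqP/funext => x.
    exact: (mean0 mr).
  exists (- hmean0 rho w).
    move=> u Uu; rewrite -scaleN1r (linZ (act_linear u)).
    by rewrite (hmean0_fixed mr).
  move: zv => /(congr1 (fun f => f (fun=> 1%g))) /= <-.
  by rewrite -scaleN1r (linZ h0.1) expr1 {2}w0.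
have e := hmeanK mr cw.1.
pose w' := hmean rho w.
have we : w = bar_dif w'.
  apply/eqP; rewrite -subr_eq0 -e dw; apply/eqP/funext => x.
  exact: (mean0 mr).
have cw' : ucoch U w' by exact: (hmean_ucoch mr).
have z0 : zig U (J := fun n => J n.+1) (fun n => d n.+1)
   (fun x => (-1) ^+ p.+2 *: d 0 (w x)) 0.
  exists (fun x => (-1) ^+ p.+2 *: d 0 (w' x)); split.
  - exact/ucochZ/(ucoch_hom h0).
  - rewrite [LHS](linZ (@bar_dif_linear _ _ _ _)); apply/funext => x.
    change ((-1) ^+ p.+2 *: bar_dif (fun x => d 0 (w' x)) x = (-1) ^+ p.+2 *: d 0 (w x)).
    by rewrite (bar_dif_lin _ _ h0.1) -we.
  - have := @zig0 U p _ (fun n => d n.+2) (fun n => ldS n.+1); congr zig.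
    apply/funext => x; rewrite (linZ (ldS 0)).
    have -> : d 1 (d 0 (w' x)) = 0 by apply/ex0; exists (w' x).
    by rewrite !scaler0.
have := @zig_sub U p.+1 _ _ _ _ _ _ ldS zv z0; rewrite subrr subr0.
exact: (IH _ _ _ aS).
Qed.

(** The same correction as in [zig_bdry], now along the exact rows and from
   the other end of the zigzag. *)
Lemma zig_cobd p (J : nat -> rep k G) (d : forall n, J n -> J n.+1) z :
  acyclic_seq U d -> zig U (p := p.+1) d z 0 ->
  exists w, [/\ ucoch U w, forall x, d 0 (w x) = 0 & bar_dif w = z].
Proof.
elim: p J d z => [|p IH] J d z aJ.
  move=> [w [cw dw zw]]; exists w; split => // x.
  have /= := congr1 (fun f => f x) zw; rewrite expr1 scaleN1r => /eqP.
  by rewrite oppr_eq0 => /eqP.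
move=> [w [cw dw zw]].
have [y [cy dy yw]] := IH _ (fun n => d n.+1) _ (acyclic_shift aJ) zw.
have [s0 h0 _ ex0] := aJ 0; have [s1 _ _ _] := aJ 1.
have [|t ct ty] := ucoch_lift s0 s1 h0 cy; first by move=> x; apply/ex0/dy.
exists (w - (-1) ^+ p.+2 *: bar_dif t); split.
- rewrite -scaleN1r scalerA addrC; apply: ucochL => //; exact: ucoch_dif.
- move=> x; change (d 0 (w x - (-1) ^+ p.+2 *: bar_dif t x) = 0).
  rewrite -scaleN1r addrC (h0.1 (-1)) (linZ h0.1) -(bar_dif_lin _ _ h0.1).
  have -> : (fun x => d 0 (t x)) = y by apply/funext.
  rewrite yw [X in _ *: X + _]scalerA -exprD addnn -mul2n exprM sqrrN !expr1n.
  by rewrite scale1r scaleN1r addNr.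
- rewrite -dw -scaleN1r addrC (@bar_dif_linear _ _ _ _ (-1)).
  by rewrite (linZ (@bar_dif_linear _ _ _ _)) bar_dif_dif !scaler0 add0r.
Qed.

End Acyclic.

Lemma bdry_zig (U : subgroup G) p (J : nat -> rep k G) (d : forall n, J n -> J n.+1) v :
  (forall n, linear (d n)) -> bdry U (p := p) d v -> zig U d 0 v.
Proof.
elim: p J d v => [|p IH] J d v ld; first by move=> /= ->.
move=> [w fw dw]; case: p IH w fw v dw => [|p] IH w fw v dw.
  exists (fun=> - w); split.
  - split; first exact: locc_cst.
    by move=> u x Uu; rewrite -scaleN1r (linZ (act_linear u)) fw.
  - apply/funext => x; rewrite /bar_dif big_ord_recl big_ord1 /=.
    by rewrite expr0 expr1 scale1r scaleN1r subrr.
  - apply/funext => x; rewrite -scaleN1r (linZ (ld 0)) expr1.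
    by rewrite !scaleN1r opprK.
exists 0; split; [exact: ucoch0|exact: (lin0 (@bar_dif_linear _ _ _ _))|].
have : zig U (p := p.+1) (J := fun n => J n.+1) (fun n => d n.+1) 0 v.
  by apply: IH => [n|]; [exact: ld|exists w].
by congr zig; apply/funext => x; rewrite (lin0 (ld 0)) scaler0.
Qed.

Lemma zig_map (U : subgroup G) p (J J' : nat -> rep k G) (d : forall n, J n -> J n.+1)
    (d' : forall n, J' n -> J' n.+1) (F : forall n, J n -> J' n) z v :
  (forall n, is_hom (F n)) -> (forall n w, F n.+1 (d n w) = d' n (F n w)) ->
  zig U (p := p) d z v -> zig U d' (fun x => F 0 (z x)) (F p v).
Proof.
elim: p J J' d d' F z v => [|p IH] J J' d d' F z v hF Fd; first by move=> /= ->.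
move=> [w [cw dw zw]]; exists (fun x => F 0 (w x)); split.
- exact: (ucoch_hom (hF 0)).
- by apply/funext => x; rewrite (bar_dif_lin _ _ (hF 0).1) dw.
- have := IH _ _ _ (fun n => d' n.+1) (fun n => F n.+1) _ _ (fun n => hF n.+1) (fun n => Fd n.+1) zw.
  congr zig; apply/funext => x; by rewrite (linZ (hF 1).1) Fd.
Qed.

End Zigzag.

(** * Comparison morphisms *)

Section NatSequences.
Variables (k : comPzRingType) (G : topGroupType) (U : ocsubgroup G) (Y : rep k G).

(** Sequences indexed by [nat] replace tuples here, since words x_0 ... x_p
   y_0 ... y_m of varying shape would otherwise need casts between index
   types. *)
Definition fin_dep (T : topGroupType) n (g : (nat -> T) -> Y) : Prop :=
  exists2 g' : ('I_n.+1 -> T) -> Y,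
    @locc {ptws 'I_n.+1 -> T} Y g' & g = fun y => g' (fun i => y i).

Lemma fin_depL (T : topGroupType) n a (g h : (nat -> T) -> Y) :
  fin_dep n g -> fin_dep n h -> fin_dep n (fun y => a *: g y + h y).
Proof.
move=> [g' lg ->] [h' lh ->]; exists (fun y => a *: g' y + h' y) => //.
exact: (@locc_op2 _ _ _ _ (fun v w => a *: v + w) _ _ lg lh).
Qed.

Lemma fin_dep0 (T : topGroupType) n : fin_dep n (fun _ : nat -> T => 0).
Proof. by exists (fun=> 0) => //; exact: locc_cst. Qed.

(** The word x_0 ... x_p y_0 y_1 ... *)
Definition word p (x : 'I_p.+1 -> G) (y : nat -> U) : nat -> G :=
  fun l => if (l < p.+1)%N then x (inord l) else \val (y (l - p.+1)%N).

Lemma fin_dep_word p m (f : (nat -> G) -> Y) (x : 'I_p.+1 -> G) :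
  fin_dep (p.+1 + m) f -> fin_dep m (fun y => f (word x y)).
Proof.
move=> [f' lf ->].
exists (fun y : 'I_m.+1 -> U => f' (fun i => word x (fun l => y (inord l)) i)).
  apply: (@locc_comp _ _ _ (fun y : {ptws 'I_m.+1 -> U} =>
    (fun i : 'I_(p.+1 + m).+1 => word x (fun l => y (inord l)) i) : {ptws 'I_(p.+1 + m).+1 -> G}) f' _ lf).
  apply: (@ptws_continuous G) => i; rewrite /word; case: (i < p.+1)%N.
    exact: continuous_cst.
  move=> y; apply: (@continuous_comp _ _ _ (fun y : {ptws 'I_m.+1 -> U} => y (inord (i - p.+1))) \val).
    exact: (@ptws_coord U).
  exact: sg_val_continuous.
apply/funext => y; congr f'; apply/funext => i; rewrite /word.
case: ifP => // ip; congr (\val (y _)); apply/esym/inordK.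
by have := ltn_ord i; lia.
Qed.

Lemma word_lift p (x : 'I_p.+2 -> G) y (l : 'I_p.+2) :
  word x y \o bump l = word (x \o lift l) y.
Proof.
apply/funext => i; rewrite /word /bump /=; have := ltn_ord l => lp.
case: (ltnP i p.+1) => ip.
  have -> : ((l <= i) + i < p.+2)%N by case: (leqP l i); lia.
  congr x; apply: val_inj; rewrite /= !inordK //; case: (leqP l i); lia.
have -> : (l <= i)%N by lia.
by rewrite add1n (_ : (i.+1 < p.+2)%N = false) ?subSS; last lia.
Qed.

Lemma word_bump p (x : 'I_p.+1 -> G) y j :
  word x y \o bump (p.+1 + j) = word x (y \o bump j).
Proof.
apply/funext => i; rewrite /word /bump /=.
case: (ltnP i p.+1) => ip.
  have -> : (p.+1 + j <= i)%N = false by lia.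
  by rewrite add0n ip.
have -> : ((p.+1 + j <= i) + i < p.+1)%N = false by lia.
congr (\val (y _)); have -> : (p.+1 + j <= i)%N = (j <= i - p.+1)%N by lia.
by lia.
Qed.

Lemma word_locc p m (f : (nat -> G) -> Y) (x : 'I_p.+1 -> G) :
  fin_dep (p.+1 + m) f ->
  nbhs (x : {ptws 'I_p.+1 -> G}) [set x' | forall y, f (word x' y) = f (word x y)].
Proof.
move=> [f' lf ->].
pose N := (p.+1 + m)%N.
pose w (yx : {ptws 'I_m.+1 -> U} * {ptws 'I_p.+1 -> G}) : {ptws 'I_N.+1 -> G} :=
  fun i => word yx.2 (fun l => yx.1 (inord l)) i.
have cw : continuous w.
  apply: (@ptws_continuous G) => i; rewrite /w /word; case: (i < p.+1)%N.
    move=> yx; apply: (@continuous_comp _ _ _ _ (fun x : {ptws 'I_p.+1 -> G} => x (inord i))).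
      exact: cvg_snd.
    exact: ptws_coord.
  move=> yx; apply: (@continuous_comp _ _ _ (fun yx : {ptws 'I_m.+1 -> U} * {ptws 'I_p.+1 -> G} => yx.1 (inord (i - p.+1))) \val).
    apply: (@continuous_comp _ _ _ _ (fun x : {ptws 'I_m.+1 -> U} => x (inord (i - p.+1)))).
      exact: cvg_fst.
    exact: (@ptws_coord U).
  exact: sg_val_continuous.
have n1 := locc_tube (x := x : {ptws 'I_p.+1 -> G}) (@sg_compact_power G U m) (fun s _ => locc_comp cw lf (s, _)).
apply: (nbhs_sub n1) => x' /= ex' y.
have := ex' (fun i : 'I_m.+1 => y i) (fun=> I); rewrite /w /=.
have wE (z : {ptws 'I_p.+1 -> G}) : (fun i : 'I_N.+1 => word z (fun l => y (inord l : 'I_m.+1)) i) =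
    (fun i : 'I_N.+1 => word z y i).
  apply/funext => i; rewrite /word; case: ifP => // ip.
  congr (\val (y _)); apply: inordK; have := ltn_ord i; rewrite /N; lia.
by rewrite !wE.
Qed.

(** A comparison morphism truncated below degree [m]: [FF q] is its component
   of degree m + q. *)
Record seq_comparison (J : nat -> rep k G) (d : forall n, J n -> J n.+1) (m : nat)
    (FF : forall q, ((nat -> U) -> Y) -> J q) : Prop := SeqComparison {
  sc_linear : forall q a g h, fin_dep (m + q) g -> fin_dep (m + q) h ->
    FF q (fun y => a *: g y + h y) = a *: FF q g + FF q h ;
  sc_act : forall q (u : U) g, fin_dep (m + q) g ->
    FF q (fun y => act (\val u) (g (fun l => u^-1 * y l)%g)) = act (\val u) (FF q g) ;
  sc_dif : forall q g, fin_dep (m + q) g ->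
    FF q.+1 (fun y => \sum_(j < (m + q).+2) (-1) ^+ j *: g (y \o bump j)) = d q (FF q g)
}.

Lemma sc_sum J d m FF (sc : seq_comparison (J := J) d m FF) N
    (c : 'I_N -> k) (g : 'I_N -> (nat -> U) -> Y) :
  (forall l, fin_dep m (g l)) ->
  FF 0 (fun y => \sum_(l < N) c l *: g l y) = \sum_(l < N) c l *: FF 0 (g l) /\
  fin_dep m (fun y => \sum_(l < N) c l *: g l y).
Proof.
elim: N c g => [|N IH] c g fg.
  have -> : (fun y => \sum_(l < 0) c l *: g l y) = fun=> 0.
    by apply/funext => y; rewrite big_ord0.
  split; last exact: fin_dep0.
  have f0 : fin_dep (m + 0) (fun _ : nat -> U => 0) by exact: fin_dep0.
  by have := sc_linear sc (-1) f0 f0; rewrite !scaleN1r !addNr big_ord0.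
have [e fd] := IH (fun l => c (lift ord0 l)) (fun l => g (lift ord0 l)) (fun l => fg _).
have -> : (fun y => \sum_(l < N.+1) c l *: g l y) = fun y =>
    c ord0 *: g ord0 y + \sum_(l < N) c (lift ord0 l) *: g (lift ord0 l) y.
  by apply/funext => y; rewrite big_ord_recl.
split; last exact: fin_depL.
by rewrite (sc_linear sc) ?addn0 // e big_ord_recl.
Qed.

(** The zigzag consists of the functions f (x_0 ... x_p y_0 ... y_m), with the
   comparison morphism applied to them as functions of y. By the cocycle
   equation of [f] on the word x y, the differentials in x and in y agree up
   to sign. *)
Lemma comparison_zig_nat p : forall J d m FF (f : (nat -> G) -> Y) N,
  (forall n, linear (d n)) ->
  seq_comparison (J := J) d m FF -> N = (p + m)%N -> fin_dep N f ->
  (forall u z, sg_set U u -> f (fun l => u * z l)%g = act u (f z)) ->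
  (forall z, \sum_(l < N.+2) (-1) ^+ l *: f (z \o bump l) = 0) ->
  zig U d (fun x : 'I_p.+1 -> G =>
      FF 0 (fun y => \sum_(j < m.+1) (-1) ^+ j *: f (word x (y \o bump j))))
    (FF p (fun y => f (fun l => \val (y l)))).
Proof.
elim: p => [|p IH] J d m FF f N ld sc NE fd fe f0.
  apply/funext => x; congr (FF 0); apply/funext => y.
  have wE : word x y \o bump 0 = fun l => \val (y l).
    by apply/funext => l; rewrite /word /bump /= add1n subn1.
  have := f0 (word x y); rewrite NE add0n big_ord_recl /= expr0 scale1r wE.
  under eq_bigr => j _ do rewrite /bump /= exprD expr1 mulN1r scaleNr -/(bump _ _) -[(1 + j)%N]/(1 + j)%N word_bump.
  by rewrite sumrN => /eqP; rewrite subr_eq0 => /eqP.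
have {}NE : N = (p.+1 + m)%N by [].
rewrite NE in fd f0.
have wdep (x : 'I_p.+1 -> G) : fin_dep m (fun y => f (word x y)) by exact: fin_dep_word.
exists (fun x => (-1) ^+ p.+1 *: FF 0 (fun y => f (word x y))); split.
- apply: ucochZ; split.
    move=> x; apply: (nbhs_sub (word_locc x fd)) => x' /= ex'.
    by congr (FF 0); apply/funext => y; rewrite ex'.
  move=> u x Uu; pose u' : U := exist _ u (mem_set Uu).
  rewrite -[u]/(\val u') -(sc_act sc) ?addn0 //; congr (FF 0); apply/funext => y.
  rewrite -fe //; congr f; apply/funext => l; rewrite /word.
  by case: ifP => // _; rewrite -[\val u']/u mulVKg.
- apply/funext => x.
  rewrite /bar_dif.
  have -> : (fun y => \sum_(j < m.+1) (-1) ^+ j *: f (word x (y \o bump j))) =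
     (fun y => \sum_(l < p.+2) ((-1) ^+ l * (-1) ^+ p.+1) *: f (word (x \o lift l) y)).
    apply/funext => y; have := f0 (word x y).
    have -> : (p.+1 + m).+2 = (p.+2 + m.+1)%N by lia.
    rewrite big_split_ord /=.
    under eq_bigr => l _ do rewrite word_lift.
    under [X in _ + X]eq_bigr => j _ do rewrite word_bump exprD -scalerA.
    rewrite -scaler_sumr => /eqP; rewrite addrC addr_eq0 => /eqP e.
    have {e} := congr1 (fun v => (-1) ^+ p.+2 *: v) e.
    rewrite scalerA -exprD addnn -mul2n exprM sqrrN !expr1n scale1r => ->.
    rewrite scalerN -scaleNr exprS mulN1r opprK scaler_sumr.
    by apply: eq_bigr => l _; rewrite scalerA mulrC.
  have [-> _] := sc_sum sc (fun l : 'I_p.+2 => (-1) ^+ l * (-1) ^+ p.+1)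
     (g := fun l y => f (word (x \o lift l) y)) (fun l => wdep _).
  by apply: eq_bigr => l _; rewrite scalerA.
- have scS : seq_comparison (J := fun n => J n.+1) (fun n => d n.+1) m.+1 (fun q => FF q.+1).
    split=> [q a g h|q u g|q g]; rewrite addSnnS.
    + exact: sc_linear sc q.+1 a g h.
    + exact: sc_act sc q.+1 u g.
    + exact: sc_dif sc q.+1 g.
  have := IH _ (fun n => d n.+1) m.+1 _ f N (fun n => ld n.+1) scS _ _ fe _.
  rewrite NE addSnnS => /(_ erefl); rewrite -addSnnS => /(_ fd f0).
  congr zig; apply/funext => x.
  have fdx : fin_dep (m + 0) (fun y => f (word x y)) by rewrite addn0.
  have := sc_dif sc fdx; rewrite addn0 => ->.
  by rewrite (linZ (ld 0)) scalerA -exprD addnn -mul2n exprM sqrrN !expr1n scale1r.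
Qed.

End NatSequences.

Section Comparison.
Variables (k : comPzRingType) (G : topGroupType) (U : ocsubgroup G).
Variables (Y : rep k G) (I : injres Y).

Definition resU n (f : ('I_n.+1 -> G) -> Y) : ('I_n.+1 -> U) -> res_rep Y U :=
  fun x => f (fun i => \val (x i)).

Lemma injres_acyclic : acyclic_seq U (J := I) (@ir_dif _ _ _ I).
Proof.
move=> n; split.
- exact: ir_smooth.
- exact: ir_dif_hom.
- have h := @ir_injective _ _ _ I n.
  by have := @injective_mean k G U _ (@ir_smooth _ _ _ I n) h; apply.
- exact: ir_exact.
Qed.

Lemma ir_dif_linear n : linear (@ir_dif _ _ _ I n).
Proof. exact: (ir_dif_hom I n).1. Qed.

Lemma locc_ptws_inord n (g' : ('I_n.+1 -> U) -> Y) :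
  (fun y : 'I_n.+1 -> U => g' (fun i => y (inord i))) = g'.
Proof. by apply/funext => y; congr g'; apply/funext => i; rewrite inord_val. Qed.

(** This holds for every comparison morphism at once, so the choice of one in
   [ext_match] has no effect on classes. *)
Lemma comparison_zig F n (f : ('I_n.+1 -> G) -> Y) :
  comparison (U := U) (I := I) F -> ucoch U f -> bar_dif f = 0 ->
  zig U (J := I) (@ir_dif _ _ _ I) (fun x => ir_aug I (f x)) (F n (resU f)).
Proof.
move=> [Fl Fa Fd F0] [lf ef] df.
pose FF q (g : (nat -> U) -> Y) : I q := F q (fun y : 'I_q.+1 -> U => g (fun l => y (inord l))).
have lcE q (g' : ('I_q.+1 -> U) -> Y) :
    (fun y : 'I_q.+1 -> U => g' (fun i : 'I_q.+1 => y (inord i))) = g'.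
  exact: locc_ptws_inord.
have sc : seq_comparison (U := U) (Y := Y) (J := I) (@ir_dif _ _ _ I) 0 FF.
  split=> [q a g h [g' lg ->] [h' lh ->]|q u g [g' lg ->]|q g [g' lg ->]].
  - rewrite /FF; have := Fl q a _ _ lg lh.
    by rewrite -[in X in X -> _](lcE q g') -[in X in X -> _](lcE q h').
  - rewrite /FF; have := Fa q u _ lg; rewrite -{2}(lcE q g') => <-; congr (F q).
    by apply/funext => y; congr (act _ (g' _)); apply/funext => i; rewrite inord_val.
  - rewrite /FF -{2}(lcE q g') in lg *; have := Fd q _ lg; rewrite lcE => <-.
    congr (F q.+1); apply/funext => y; apply: eq_bigr => j _; congr (_ *: g' _).
    apply/funext => i; rewrite /=; congr y; apply: val_inj; rewrite /= inordK //.
    by rewrite inord_val.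
    by rewrite inord_val; exact: (ltn_ord (lift j i)).
pose f' (z : nat -> G) := f (fun i : 'I_n.+1 => z i).
have fd : fin_dep n f' by exists f.
have fe u z : sg_set U u -> f' (fun l => u * z l)%g = act u (f' z) by move=> Uu; exact: ef.
have f0 (z : nat -> G) : \sum_(l < n.+2) (-1) ^+ l *: f' (z \o bump l) = 0.
  by have := congr1 (fun g => g (fun i : 'I_n.+2 => z i)) df.
have := comparison_zig_nat ir_dif_linear sc (esym (addn0 n)) fd fe f0.
have -> : FF n (fun y => f' (fun l => \val (y l))) = F n (resU f).
  congr (F n); apply/funext => y; congr f; apply/funext => i.
  by rewrite inord_val.
congr zig; apply/funext => x; rewrite -F0; congr (F 0); apply/funext => y.
rewrite big_ord1 expr0 scale1r; congr f; apply/funext => i.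
by rewrite /word ltn_ord inord_val.
Qed.

(** The homotopies of the columns, alternating with the differential of [J],
   compose to a comparison morphism. *)
Fixpoint splice p : forall (J : nat -> rep k G) (d : forall n, J n -> J n.+1)
    (rho : forall n, (G -> J n) -> J n), (('I_p.+1 -> G) -> J 0) -> J p :=
  match p with
  | 0 => fun J d rho z => hmean0 (rho 0) z
  | q.+1 => fun J d rho z => (-1) ^+ q.+1 *:
      splice (J := fun n => J n.+1) (fun n => d n.+1) (fun n => rho n.+1)
        (fun x => d 0 (hmean (rho 0) z x))
  end.

End Comparison.

Section Splice.
Variables (k : comPzRingType) (G : topGroupType) (U : ocsubgroup G).

Lemma locc_const_act (M : rep k G) n (f : ('I_n.+1 -> G) -> M) u :
  loc_const f -> loc_const (fun x => act u (f (fun i => u^-1 * x i)%g)).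
Proof.
move=> lf; apply: (@locc_post {ptws 'I_n.+1 -> G} _ _ (fun x => f (fun i => u^-1 * x i)%g) (act u)).
apply: (@locc_comp _ _ _ (fun x : {ptws 'I_n.+1 -> G} =>
  (fun i => u^-1 * x i)%g : {ptws 'I_n.+1 -> G}) f _ lf).
apply: (@ptws_continuous G) => i.
exact: (continuousM (@continuous_cst _ _ _) (@ptws_coord G _ i)).
Qed.

Lemma hmean_act (M : rep k G) (rho : (G -> M) -> M) p (f : ('I_p.+2 -> G) -> M) u :
  mean U rho -> loc_const f -> sg_set U u ->
  hmean rho (fun x => act u (f (fun i => u^-1 * x i)%g)) =
  fun x => act u (hmean rho f (fun i => u^-1 * x i)%g).
Proof.
move=> [_ _ re _] lf Uu; apply/funext => x; rewrite /hmean -re //; last exact: locc_hcons.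
congr rho; apply/funext => v; congr (act u (f _)).
by rewrite -(hcons_map (fun g => (u^-1 * g)%g)).
Qed.

Lemma splice_linear p (J : nat -> rep k G) (d : forall n, J n -> J n.+1)
    (rho : forall n, (G -> J n) -> J n) a f g :
  (forall n, mean U (rho n)) -> (forall n, linear (d n)) -> loc_const f -> loc_const g ->
  splice (p := p) d rho (a *: f + g) = a *: splice d rho f + splice d rho g.
Proof.
elim: p J d rho f g => [|p IH] J d rho f g mr ld lf lg.
  have [rl _ _ _] := mr 0; rewrite /= /hmean0 -rl //; exact: locc_diag.
rewrite /= -[LHS]/((-1) ^+ p.+1 *: _) scalerA mulrC -scalerA -scalerDr; congr (_ *: _).
have [rl _ _ _] := mr 0.
rewrite -IH //.
- congr splice; apply/funext => x.
  have -> : hmean (rho 0) (a *: f + g) x = a *: hmean (rho 0) f x + hmean (rho 0) g x.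
    rewrite /hmean -rl //; exact: locc_hcons.
  exact: (ld 0).
- exact: (locc_post (d 0) (hmean_locc (mr 0) lf)).
- exact: (locc_post (d 0) (hmean_locc (mr 0) lg)).
Qed.

Lemma splice_act p (J : nat -> rep k G) (d : forall n, J n -> J n.+1)
    (rho : forall n, (G -> J n) -> J n) f u :
  (forall n, mean U (rho n)) -> (forall n, is_hom (d n)) -> loc_const f -> sg_set U u ->
  splice (p := p) d rho (fun x => act u (f (fun i => u^-1 * x i)%g)) =
  act u (splice d rho f).
Proof.
elim: p J d rho f => [|p IH] J d rho f mr hd lf Uu.
  have [_ _ re _] := mr 0; rewrite /= /hmean0 -re //; exact: locc_diag.
rewrite /= (linZ (act_linear u)); congr (_ *: _).
rewrite -IH //; last exact: (locc_post (d 0) (hmean_locc (mr 0) lf)).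
by rewrite (hmean_act (mr 0)) //; congr splice; apply/funext => x; rewrite (hd 0).2.
Qed.

(** Moving the differential of cochains leftwards through the composite with
   [hmeanK] cancels everything but the last term; the signs in [splice] absorb
   those that appear on the way. *)
Lemma splice_dif p (J : nat -> rep k G) (d : forall n, J n -> J n.+1)
    (rho : forall n, (G -> J n) -> J n) f :
  (forall n, mean U (rho n)) -> (forall n, is_hom (d n)) ->
  (forall n w, d n.+1 (d n w) = 0) -> loc_const f -> (forall x, d 0 (f x) = 0) ->
  splice (p := p.+1) d rho (bar_dif f) = d p (splice d rho f).
Proof.
elim: p J d rho f => [|p IH] J d rho f mr hd dd lf df.
  have [_ rc _ _] := mr 1; have [rl _ _ _] := mr 0.
  rewrite /= expr1 scaleN1r (hmean0K (mr 0)) // /hmean0 -[in LHS]scaleN1r.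
  have -> : (fun u : G => d 0 ((f - (fun=> rho 0 (fun u => f (fun=> u)))) (fun=> u))) =
     fun=> - d 0 (rho 0 (fun u => f (fun=> u))).
    apply/funext => u; change (d 0 (f (fun=> u) - rho 0 (fun u => f (fun=> u))) =
      - d 0 (rho 0 (fun u => f (fun=> u)))).
    by rewrite -scaleN1r addrC (hd 0).1 df addr0 scaleN1r.
  by rewrite rc scaleN1r opprK.
have lh : loc_const (hmean (rho 0) f) by exact: (hmean_locc (mr 0)).
have lg : loc_const (fun x => d 0 (hmean (rho 0) f x)) by exact: (locc_post (d 0) lh).
change ((-1) ^+ p.+2 *: splice (p := p.+1) (fun n => d n.+1) (fun n => rho n.+1)
   (fun x => d 0 (hmean (rho 0) (bar_dif f) x)) =
  d p.+1 ((-1) ^+ p.+1 *: splice (p := p) (fun n => d n.+1) (fun n => rho n.+1)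
   (fun x => d 0 (hmean (rho 0) f x)))).
rewrite (linZ (hd p.+1).1) -(IH _ (fun n => d n.+1)) //.
rewrite exprS mulN1r scaleNr -scalerN; congr (_ *: _).
have sl := @splice_linear p.+1 _ (fun n => d n.+1) (fun n => rho n.+1) (-1)
  (bar_dif (fun x => d 0 (hmean (rho 0) f x))) 0 (fun n => mr n.+1) (fun n => (hd n.+1).1)
  (loc_const_dif lg) (@loc_const0 _ _ _ _).
have s0 : splice (p := p.+1) (fun n => d n.+1) (fun n => rho n.+1) 0 = 0.
  have := @splice_linear p.+1 _ (fun n => d n.+1) (fun n => rho n.+1) (-1)
    0 0 (fun n => mr n.+1) (fun n => (hd n.+1).1) (@loc_const0 _ _ _ _) (@loc_const0 _ _ _ _).
  by rewrite !scaleN1r oppr0 addr0 addNr.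
move: sl; rewrite s0 !addr0 !scaleN1r => sl.
rewrite -[RHS]opprK -sl; congr (- _); congr splice; apply/funext => x.
rewrite (hmeanK (mr 0) lf).
change (d 0 (f x - bar_dif (hmean (rho 0) f) x) =
  - bar_dif (fun x => d 0 (hmean (rho 0) f x)) x).
by rewrite -scaleN1r addrC (hd 0).1 df addr0 scaleN1r (bar_dif_lin _ _ (hd 0).1).
Qed.

(** A function on a power of [U] becomes a function on a power of [G] by
   composition with a retraction, and can then be spliced. *)
Lemma comparison_exists (Y : rep k G) (I : injres Y) :
  exists F, comparison (U := U) (I := I) F.
Proof.
have aI := injres_acyclic U I.
have mrE n : exists rho : (G -> I n) -> I n, mean U rho by have [] := aI n.
pose rho n := projT1 (cid (mrE n)).
have mr n : mean U (rho n) by rewrite /rho; case: cid.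
have hd n : is_hom (@ir_dif _ _ _ I n) by exact: ir_dif_hom.
have dd n w : @ir_dif _ _ _ I n.+1 (ir_dif w) = 0 by apply/ir_exact; exists w.
have [la ea] := ir_aug_hom I.
have [r [cr rM rK]] := retraction (@oc_open G U).
pose ext n (f : ('I_n.+1 -> U) -> Y) : ('I_n.+1 -> G) -> I 0 :=
  fun x => ir_aug I (f (fun i => r (x i))).
have lext n (f : ('I_n.+1 -> U) -> res_rep Y U) : loc_const f -> loc_const (ext n f).
  move=> lf; apply: (@locc_post {ptws 'I_n.+1 -> G} _ _ (fun x => f (fun i => r (x i))) (ir_aug I)).
  apply: (@locc_comp _ _ _ (fun x : {ptws 'I_n.+1 -> G} =>
    (fun i => r (x i)) : {ptws 'I_n.+1 -> U}) f _ lf).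
  apply: (@ptws_continuous U) => i x.
  apply: (@continuous_comp _ _ _ (fun x : {ptws 'I_n.+1 -> G} => x i) r).
    exact: ptws_coord.
  exact: cr.
exists (fun n f => splice (J := I) (@ir_dif _ _ _ I) rho (ext n f)); split.
- move=> n a f g lf lg; rewrite -(splice_linear _ mr (fun n => (hd n).1)); try exact: lext.
  congr splice; apply/funext => x; exact: la.
- move=> n u f lf; rewrite -(splice_act mr hd) //; [|exact: lext|exact: sg_mem].
  congr splice; apply/funext => x; rewrite /ext /= ea.
  congr (act _ (ir_aug I (f _))); apply/funext => i.
  by rewrite -(rM u^-1%g).
- move=> n f lf; rewrite -(splice_dif mr hd dd); last first.
  + by move=> x; apply/ir_exact0; exists (f (fun i => r (x i))).
  + exact: lext.
  congr (splice (p := n.+1)); apply/funext => x.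
  by rewrite [RHS](bar_dif_lin _ _ la).
- move=> y; have [_ rc _ _] := mr 0; exact: rc.
Qed.

End Splice.

(** * Ext groups through zigzags *)

Section ExtZigzag.
Variables (k : comPzRingType) (G : topGroupType) (U : ocsubgroup G).
Variables (Y : rep k G) (I : injres Y).
Hypothesis sY : smooth Y.

Local Notation dI := (@ir_dif _ _ _ I).

(** By Frobenius reciprocity the complex Hom (X_U, I) is the complex of
   vectors of [I] fixed by [U]. *)
Lemma cls_char n (phi psi : Xind k U -> I n) :
  cocycle (C := hom_complex (Xind k U) I) (n := n) phi ->
  cocycle (C := hom_complex (Xind k U) I) (n := n) psi ->
  cls (C := hom_complex (Xind k U) I) (n := n) phi =
    cls (C := hom_complex (Xind k U) I) (n := n) psi <->
  bdry U (J := I) dI (phi (charX k U) - psi (charX k U)).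
Proof.
move=> cphi cpsi; rewrite (clsP cphi cpsi).
have [hphi _] := cphi; have [hpsi _] := cpsi.
case: n phi psi cphi cpsi hphi hpsi => [|n] phi psi cphi cpsi hphi hpsi /=.
  split=> [e|e]; first exact: (congr1 (fun f => f (charX k U)) e).
  apply/eqP; rewrite subr_eq0; apply/eqP.
  rewrite (hom_charX hphi) (hom_charX hpsi); congr frob.
  by apply/eqP; rewrite -subr_eq0 e.
split=> [[xi hxi e]|[w fw e]].
  exists (xi (charX k U)); first exact: (hom_char_fixed hxi).
  exact: (congr1 (fun f => f (charX k U)) e).
exists (frob w); first exact: frob_hom.
have hd : is_hom (phi - psi).
  by rewrite -scaleN1r; apply: is_homD => //; exact: is_homZ.
have hx : is_hom (hom_dif (I := I) (frob w : Xind k U -> I n)).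
  exact/hom_dif_homs/frob_hom.
change (hom_dif (I := I) (frob w : Xind k U -> I n) = phi - psi).
rewrite (hom_charX hx) (hom_charX hd); congr frob.
by rewrite /hom_dif frob_char.
Qed.

(** [e] and [f] represent the same class under Ext^n(X_U, Y) = H^n(U, Y). *)
Definition EZ n (e : Ext (Xind k U) I n) (f : ('I_n.+1 -> G) -> Y) : Prop :=
  zig U (J := I) dI (fun x => ir_aug I (f x)) (crepr e (charX k U)).

Definition zcocycle n (f : ('I_n.+1 -> G) -> Y) : Prop :=
  ucoch U f /\ bar_dif f = 0.

Lemma zig_bdryD n z v v' : zig U (J := I) dI z v ->
  bdry U (J := I) (p := n) dI (v - v') -> zig U (J := I) dI z v'.
Proof.
move=> zv /(bdry_zig (ir_dif_linear (I := I))) z0.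
have := zig_sub (ir_dif_linear (I := I)) zv z0.
by rewrite subr0 opprB addrC subrK.
Qed.

Lemma bdry_opp n v : bdry U (J := I) (p := n) dI v -> bdry U (J := I) dI (- v).
Proof.
case: n v => [|n] v /=; first by move=> ->; rewrite oppr0.
move=> [w fw <-]; exists (- w).
  by move=> u Uu; rewrite -scaleN1r (linZ (act_linear u)) fw.
by rewrite -!scaleN1r (linZ (ir_dif_linear (I := I) (n := n))).
Qed.

Lemma EZ_cls n (phi : Xind k U -> I n) f :
  cocycle (C := hom_complex (Xind k U) I) (n := n) phi ->
  EZ (cls (C := hom_complex (Xind k U) I) (n := n) phi) f <->
  zig U (J := I) dI (fun x => ir_aug I (f x)) (phi (charX k U)).
Proof.
move=> cphi; have := creprK (cls (C := hom_complex (Xind k U) I) (n := n) phi).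
move/(cls_char (crepr_cocycle _) cphi) => b; split=> zf.
  exact: zig_bdryD zf b.
by apply: zig_bdryD zf _; have := bdry_opp b; rewrite opprB.
Qed.

Lemma zig_val_unique n z v v' :
  zig U (J := I) dI z v -> zig U (J := I) dI z v' -> bdry U (J := I) (p := n) dI (v - v').
Proof.
move=> zv zv'; apply: (zig_bdry (injres_acyclic U I)).
by have := zig_sub (ir_dif_linear (I := I)) zv zv'; rewrite subrr.
Qed.

Lemma EZ_inj n (e e' : Ext (Xind k U) I n) f : EZ e f -> EZ e' f -> e = e'.
Proof.
move=> ef ef'; rewrite -[e]creprK -[e']creprK.
apply/(cls_char (crepr_cocycle e) (crepr_cocycle e')).
exact: zig_val_unique ef ef'.
Qed.

Lemma resU_cochain n (f : ('I_n.+1 -> G) -> Y) : ucoch U f ->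
  bar_cochain (resU (U := U) f).
Proof.
move=> [lf ef]; split.
  apply: (@locc_comp _ _ _ (fun x : {ptws 'I_n.+1 -> U} =>
    (fun i => \val (x i)) : {ptws 'I_n.+1 -> G}) f _ lf).
  apply: (@ptws_continuous G) => i x.
  apply: (@continuous_comp _ _ _ (fun x : {ptws 'I_n.+1 -> U} => x i) \val).
    exact: (@ptws_coord U).
  exact: sg_val_continuous.
by move=> h x; exact: (ef (\val h) (fun i => \val (x i)) (sg_mem h)).
Qed.

Lemma resU_cocycle n (f : ('I_n.+1 -> G) -> Y) : zcocycle f ->
  cocycle (C := bar (res_rep Y U)) (n := n) (resU f).
Proof.
move=> [cf df]; split; first exact: resU_cochain.
apply/funext => x; exact: (congr1 (fun g => g (fun i => \val (x i))) df).
Qed.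

(** A zigzag to 0 makes the difference a coboundary in degree 0 of the
   resolution, and the primitive takes its values in the image of [Y]. *)
Lemma zig_fun_unique n f f' v : zcocycle f -> zcocycle f' ->
  zig U (J := I) dI (fun x => ir_aug I (f x)) v ->
  zig U (J := I) dI (fun x => ir_aug I (f' x)) v ->
  cls (C := bar (res_rep Y U)) (n := n) (resU f) = cls (C := bar (res_rep Y U)) (n := n) (resU f').
Proof.
move=> zf zf' zv zv'; have [la ea] := ir_aug_hom I.
apply/(clsP (resU_cocycle zf) (resU_cocycle zf')).
have := zig_sub (ir_dif_linear (I := I)) zv zv'; rewrite subrr.
case: n f f' v zf zf' zv zv' => [|n] f f' v zf zf' _ _.
  move=> e; apply/funext => x; apply/eqP; rewrite subr_eq0; apply/eqP.
  apply: (@ir_aug_inj _ _ _ I); apply/eqP; rewrite -subr_eq0; apply/eqP.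
  exact: (congr1 (fun g => g (fun i => \val (x i))) e).
move=> /(zig_cobd (injres_acyclic U I))[w [cw dw we]].
have [|b cb ab] := ucoch_lift sY (@ir_smooth _ _ _ I 0) (ir_aug_hom I) cw.
  by move=> x; apply/ir_exact0/dw.
exists (resU b); first exact: resU_cochain.
apply/funext => x; apply: (@ir_aug_inj _ _ _ I).
change (ir_aug I (bar_dif b (fun i => \val (x i))) =
  ir_aug I (f (fun i => \val (x i)) - f' (fun i => \val (x i)))).
rewrite -(bar_dif_lin _ _ la) (_ : (fun x => ir_aug I (b x)) = w); last exact/funext.
rewrite we; set a := f _; set b' := f' _.
change (ir_aug I a - ir_aug I b' = ir_aug I (a - b')).
by rewrite -[X in _ = ir_aug I (_ + X)]scaleN1r [X in _ = ir_aug I X]addrC la scaleN1r addrC.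
Qed.

(** Composition with a retraction of [G] to [U]; the last clause is what
   bounds the supports of the values later. *)
Lemma cocycle_extend n (c : ('I_n.+1 -> U) -> res_rep Y U) :
  cocycle (C := bar (res_rep Y U)) (n := n) c ->
  exists f : ('I_n.+1 -> G) -> Y, [/\ zcocycle f, resU f = c & forall x, exists y, f x = c y].
Proof.
move=> [[lc hc] dc]; have [r [cr rM rK]] := retraction (@oc_open G U).
exists (fun x => c (fun i => r (x i))); split; [split; first split|..].
- apply: (@locc_comp _ _ _ (fun x : {ptws 'I_n.+1 -> G} =>
    (fun i => r (x i)) : {ptws 'I_n.+1 -> U}) c _ lc).
  apply: (@ptws_continuous U) => i x.
  apply: (@continuous_comp _ _ _ (fun x : {ptws 'I_n.+1 -> G} => x i) r).
    exact: ptws_coord.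
  exact: cr.
- move=> u x Uu; pose u' : U := exist _ u (mem_set Uu).
  apply: etrans (hc u' (fun i => r (x i))).
  by congr c; apply/funext => i; exact: (rM u').
- apply/funext => x; exact: (congr1 (fun g => g (fun i => r (x i))) dc).
- by apply/funext => x; congr c; apply/funext => i; rewrite rK.
- by move=> x; exists (fun i => r (x i)).
Qed.

Lemma comparison_cls F n f : zcocycle f -> comparison (U := U) (I := I) F ->
  zig U (J := I) dI (fun x => ir_aug I (f x))
    (F n (crepr (cls (C := bar (res_rep Y U)) (n := n) (resU f)))).
Proof.
move=> zf cF; apply: zig_bdryD (comparison_zig cF zf.1 zf.2) _.
have cr := crepr_cocycle (cls (C := bar (res_rep Y U)) (n := n) (resU f)).
have := creprK (cls (C := bar (res_rep Y U)) (n := n) (resU f)).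
move/(clsP cr (resU_cocycle zf)); move: cr; set c := crepr _ => cr.
have [Fl Fa Fd F0] := cF.
have FL (g h : ('I_n.+1 -> U) -> res_rep Y U) : loc_const g -> loc_const h ->
    F n (g - h) = F n g - F n h.
  by move=> lg lh; rewrite -[in LHS]scaleN1r addrC Fl // scaleN1r addrC.
move=> cb; have lf := (resU_cocycle zf).1.1; have lc := cr.1.1.
rewrite -FL //.
case: n f zf c cr F cF Fl Fa Fd F0 FL cb lf lc => [|n] f zf c cr F cF Fl Fa Fd F0 FL cb lf lc /=.
  have -> : resU f - c = 0 by apply/eqP; rewrite -oppr_eq0 opprB; exact/eqP.
  have := FL 0 0 (@loc_const0 _ _ _ _) (@loc_const0 _ _ _ _).
  by rewrite !subrr.
move: cb => [b [lb hb] e]; exists (- F n b).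
  move=> u Uu; pose u' : U := exist _ u (mem_set Uu).
  rewrite -scaleN1r (linZ (act_linear u)); congr (_ *: _).
  rewrite -[u]/(\val u') -Fa //; congr (F n); apply/funext => x.
  rewrite -hb; congr b; apply/funext => i; exact: mulVKg.
rewrite -scaleN1r (linZ (ir_dif_linear (I := I) (n := n))) -Fd //.
have -> : bar_dif b = c - resU f by exact: e.
by rewrite FL // scaleN1r opprB FL.
Qed.

Lemma zcocycle_fixed F n f : zcocycle f -> comparison (U := U) (I := I) F ->
  let v := F n (crepr (cls (C := bar (res_rep Y U)) (n := n) (resU f))) in
  fixed_by U v /\ ir_dif v = 0.
Proof.
move=> zf [Fl Fa Fd F0] v; rewrite /v.
pose c : ('I_n.+1 -> U) -> res_rep Y U :=
  crepr (cls (C := bar (res_rep Y U)) (n := n) (resU f)).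
have [[lc hc] dc] : cocycle (C := bar (res_rep Y U)) (n := n) c by exact: crepr_cocycle.
rewrite -/c; split.
  move=> u Uu; pose u' : U := exist _ u (mem_set Uu).
  rewrite -[u]/(\val u') -Fa //; congr (F n); apply/funext => x.
  rewrite -hc; congr c; apply/funext => i; exact: mulVKg.
rewrite -Fd // [bar_dif _]dc.
have l0 := @loc_const0 k U (res_rep Y U) n.+1.
have := Fl n.+1 (-1) 0 0 l0 l0.
by rewrite !scaleN1r oppr0 addr0 addNr.
Qed.

Lemma frob_cocycle n (v : I n) : fixed_by U v -> ir_dif v = 0 ->
  cocycle (C := hom_complex (Xind k U) I) (n := n) (frob v).
Proof.
move=> fv dv; split; first exact: frob_hom.
have hd := hom_dif_homs (I := I) (frob_hom fv).
change (hom_dif (I := I) (frob v : Xind k U -> I n) = 0).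
rewrite (hom_charX hd) (hom_charX (is_hom0 (Xind k U) (I n.+1))); congr frob.
by rewrite /hom_dif frob_char.
Qed.

Lemma ext_match_EZ n (e : Ext (Xind k U) I n) f : zcocycle f ->
  ext_match e (cls (C := bar (res_rep Y U)) (n := n) (resU f)) -> EZ e f.
Proof.
move=> zf [F cF [phi [hphi phic ->]]].
have [fv dv] := zcocycle_fixed zf cF.
have phiE : phi = frob (phi (charX k U)) by exact: hom_charX.
apply/EZ_cls; first by rewrite phiE phic; exact: frob_cocycle.
by rewrite phic; exact: comparison_cls.
Qed.

Lemma ext_match_exists n f : zcocycle f ->
  exists e : Ext (Xind k U) I n, ext_match e (cls (C := bar (res_rep Y U)) (n := n) (resU f)).
Proof.
move=> zf; have [F cF] := comparison_exists U I.
have [fv dv] := zcocycle_fixed zf cF.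
eexists; exists F => //; eexists; split; [exact: (frob_hom fv)|exact: frob_char|reflexivity].
Qed.

Lemma hc_to_ext_EZ n f : zcocycle f ->
  EZ (hc_to_ext I (cls (C := bar (res_rep Y U)) (n := n) (resU f))) f.
Proof.
move=> zf; have [e me] := ext_match_exists zf.
by rewrite /hc_to_ext; case: xgetP => [y _ my|/(_ e)//]; exact: ext_match_EZ.
Qed.

Lemma EZ_exists n (e : Ext (Xind k U) I n) : exists2 f, zcocycle f & EZ e f.
Proof.
have [he de] := crepr_cocycle e.
have dv : ir_dif (crepr e (charX k U)) = 0.
  exact: (congr1 (fun g => g (charX k U)) de).
have [z [cz dz hz zv]] := zig_total (injres_acyclic U I) (hom_char_fixed he) dv.
have [|f cf az] := ucoch_lift sY (@ir_smooth _ _ _ I 0) (ir_aug_hom I) cz.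
  by move=> x; apply/ir_exact0/hz.
exists f; last by rewrite /EZ (_ : (fun x => ir_aug I (f x)) = z) //; exact/funext.
split => //; apply/funext => x; apply: (@ir_aug_inj _ _ _ I).
rewrite -(bar_dif_lin _ _ (ir_aug_hom I).1) (_ : (fun x => ir_aug I (f x)) = z); last exact/funext.
by rewrite dz (lin0 (ir_aug_hom I).1).
Qed.

(** Every class that matches [e] is represented by some cocycle on [G], and
   all of these are joined to the same vector by zigzags. *)
Lemma ext_to_hc_EZ n (e : Ext (Xind k U) I n) f : zcocycle f -> EZ e f ->
  ext_to_hc e = cls (C := bar (res_rep Y U)) (n := n) (resU f).
Proof.
move=> zf ef.
have me c : ext_match e c -> c = cls (C := bar (res_rep Y U)) (n := n) (resU f).
  rewrite -[c]creprK.
  have [f' [zf' <- _]] := cocycle_extend (crepr_cocycle c).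
  move=> /(ext_match_EZ zf') ef'.
  exact: zig_fun_unique zf' zf ef' ef.
rewrite /ext_to_hc; case: xgetP => [y _ /me //|].
move=> /(_ (cls (C := bar (res_rep Y U)) (n := n) (resU f))) [].
have [e' me'] := ext_match_exists zf.
by rewrite (EZ_inj ef (ext_match_EZ zf me')).
Qed.

(** Unlike the cocycle of [EZ_exists], this one takes no values other than
   those of a locally constant function on a power of the compact group [U].
   *)
Lemma EZ_exists_extended n (e : Ext (Xind k U) I n) :
  exists f, [/\ zcocycle f, EZ e f &
    exists2 c : ('I_n.+1 -> U) -> res_rep Y U, loc_const c & forall x, exists y, f x = c y].
Proof.
have [g zg eg] := EZ_exists e.
have cc := crepr_cocycle (ext_to_hc e).
have [f [zf fc fv]] := cocycle_extend cc.
exists f; split => //; last by exists (crepr (ext_to_hc e)) => //; exact: cc.1.1.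
have := ext_match_exists zf => -[e' me'].
have ee : cls (C := bar (res_rep Y U)) (n := n) (resU f) = ext_to_hc e.
  by rewrite fc creprK.
have := hc_to_ext_EZ zf; rewrite ee.
rewrite (ext_to_hc_EZ zg eg) => eh.
suff -> : e = hc_to_ext I (cls (C := bar (res_rep Y U)) (n := n) (resU g)) by [].
exact: EZ_inj eg (hc_to_ext_EZ zg).
Qed.

End ExtZigzag.

(** * Lifting homomorphisms to injective resolutions *)

Section ChainLift.
Variables (k : comPzRingType) (G : topGroupType).

Section Extend.
Variables (M N J : rep k G) (e : M -> N) (g : M -> J).
Hypotheses (sN : smooth N) (iJ : injective_rep J) (he : is_hom e) (hg : is_hom g).
Hypothesis ker : forall w, e w = 0 -> g w = 0.

Definition im_set : set N := [set e w | w in setT].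

Fact im0 : im_set 0.
Proof. by exists 0 => //; rewrite (lin0 he.1). Qed.

Fact imD x y : im_set x -> im_set y -> im_set (x + y).
Proof. by move=> [a _ <-] [b _ <-]; exists (a + b) => //; rewrite (linD he.1). Qed.

Fact imZ c x : im_set x -> im_set (c *: x).
Proof. by move=> [a _ <-]; exists (c *: a) => //; rewrite (linZ he.1). Qed.

Definition im_sub : submod N := Submod im0 imD imZ.

Fact im_act h v : sm_set im_sub v -> sm_set im_sub (act h v).
Proof. by move=> [a _ <-]; exists (act h a) => //; rewrite he.2. Qed.

Definition im_rep : rep k G := sub_rep im_act.

(** Injectivity in its usual form, along a monomorphism, is applied to the
   inclusion of the image of [e]. *)
Lemma injective_extend : exists2 h : N -> J, is_hom h & forall w, h (e w) = g w.
Proof.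
have sI : smooth im_rep.
  move=> v; have -> : [set h | act h v = v] = [set h | act h (\val v) = \val v].
    by apply/predeqP => h; split=> [/(congr1 val)//|E]; exact: val_inj.
  exact: sN.
have gE w w' : e w = e w' -> g w = g w'.
  move=> ew; apply/eqP; rewrite -subr_eq0; apply/eqP.
  rewrite -scaleN1r addrC -hg.1; apply: ker.
  by rewrite he.1 ew scaleN1r addNr.
pose s (v : im_rep) : M := xget 0 [set w | e w = \val v].
have sP v : e (s v) = \val v.
  have [w _ ew] := set_mem (valP v).
  by rewrite /s; case: xgetP => [y _ //|/(_ w)].
have hgs : is_hom (fun v : im_rep => g (s v)).
  split=> [a x y|a v].
    by rewrite -hg.1; apply: gE; rewrite he.1 !sP.
  by rewrite -hg.2; apply: gE; rewrite he.2 !sP.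
have hv : is_hom (fun v : im_rep => \val v) by [].
have iv : injective (fun v : im_rep => \val v) by exact: val_inj.
have [h hh hE] := @iJ im_rep N _ _ sI sN hv iv hgs.
exists h => // w.
have imw : sm_set im_sub (e w) by exists w.
pose v : im_rep := exist (fun x : N => sm_pred im_sub x) _ (mem_set imw).
rewrite -[e w]/(\val v) -[h _]/((h \o (fun v : im_rep => \val v)) v) hE.
by apply: gE; rewrite sP.
Qed.

End Extend.

Variables (Y Y' : rep k G) (I : injres Y) (I' : injres Y') (b : Y -> Y').
Hypothesis hb : is_hom b.

Lemma chain_lift_exists : exists F : forall n, I n -> I' n, chain_lift b F.
Proof.
pose st n := {F : I n -> I' n | is_hom F /\ forall w, ir_dif w = 0 -> ir_dif (F w) = 0}.
have [la ea] := ir_aug_hom I; have [la' ea'] := ir_aug_hom I'.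
have [|w|F0 hF0 F0E] := @injective_extend _ _ _ (ir_aug I) (fun y => ir_aug I' (b y))
   (@ir_smooth _ _ _ I 0) (@ir_injective _ _ _ I' 0) (ir_aug_hom I).
- by split=> [a x y|h v]; rewrite ?hb.1 ?hb.2 ?la' ?ea'.
- rewrite -(lin0 la) => /(@ir_aug_inj _ _ _ I) ->.
  by rewrite (lin0 hb.1) (lin0 la').
have F0P : is_hom F0 /\ forall w, ir_dif w = 0 -> ir_dif (F0 w) = 0.
  split => // w /ir_exact0[y <-]; rewrite F0E.
  by apply/ir_exact0; exists (b y).
have step n (F : st n) : exists F' : st n.+1,
    forall w, projT1 F' (ir_dif w) = ir_dif (projT1 F w).
  case: F => F [hF FP] /=.
  have [ld ed] := ir_dif_hom I' n.
  have [||F' hF' FE] := @injective_extend _ _ _ (@ir_dif _ _ _ I n) (fun w => ir_dif (F w))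
   (@ir_smooth _ _ _ I n.+1) (@ir_injective _ _ _ I' n.+1) (ir_dif_hom I n).
  - by split=> [a x y|h v]; rewrite ?hF.1 ?hF.2 ?ld ?ed.
  - exact: FP.
  have P' : is_hom F' /\ forall w, ir_dif w = 0 -> ir_dif (F' w) = 0.
    split => // w /ir_exact[y <-]; rewrite FE.
    by apply/ir_exact; exists (F y).
  by exists (exist _ F' P').
(* each step only needs that the previous map preserves cycles *)
pose lift := fix lift n : st n :=
  match n with
  | 0 => exist _ F0 F0P
  | m.+1 => projT1 (cid (step m (lift m)))
  end.
exists (fun n => projT1 (lift n)); split.
- by move=> n; case: (lift n) => F [].
- by move=> n v; rewrite /=; case: cid.
- exact: F0E.
Qed.

Lemma ext_post_spec (X : rep k G) n (y : Ext X I n) :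
  exists2 F : forall n, I n -> I' n, chain_lift b F &
    ext_post I' b y = cls (C := hom_complex X I') (n := n) (F n \o crepr y).
Proof.
have [F cF] := chain_lift_exists.
rewrite /ext_post; case: xgetP => [z _ [F' cF' ->]|]; first by exists F'.
move=> /(_ (cls (C := hom_complex X I') (n := n) (F n \o crepr y))) [].
by exists F.
Qed.

Lemma chain_lift_cocycle (X : rep k G) F n (phi : X -> I n) : chain_lift b F ->
  cocycle (C := hom_complex X I) (n := n) phi ->
  cocycle (C := hom_complex X I') (n := n) (F n \o phi).
Proof.
move=> [hF Fd F0] [[lp ep] dp]; have [lF eF] := hF n; split.
  by split=> [a x y|h v] /=; rewrite ?lp ?ep ?lF ?eF.
apply/funext => x; change (ir_dif (F n (phi x)) = 0).
rewrite -Fd (_ : ir_dif (phi x) = 0) ?(lin0 (hF n.+1).1) //.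
exact: (congr1 (fun g => g x) dp).
Qed.

End ChainLift.

Lemma pre_cocycle (k : comPzRingType) (G : topGroupType) (X X' Y : rep k G)
    (I : injres Y) (a : X' -> X) n (phi : X -> I n) : is_hom a ->
  cocycle (C := hom_complex X I) (n := n) phi ->
  cocycle (C := hom_complex X' I) (n := n) (phi \o a).
Proof.
move=> [la ea] [[lp ep] dp]; split.
  by split=> [c x y|h v] /=; rewrite ?la ?ea ?lp ?ep.
apply/funext => x; exact: (congr1 (fun g => g (a x)) dp).
Qed.

(** * Restriction and corestriction through zigzags *)

Section Trace.
Variables (k : comPzRingType) (G : topGroupType) (U V : ocsubgroup G).
Hypothesis sUV : sg_set U `<=` sg_set V.

(** The corestriction of cochains: the sum over V / U of the translates. *)
Definition ctrace (M : rep k G) n (f : ('I_n.+1 -> G) -> M) : ('I_n.+1 -> G) -> M :=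
  fun x => \sum_(s <- coset_reps U V) act s (f (fun i => s^-1 * x i)%g).

Lemma ctrace_ucoch (M : rep k G) n (f : ('I_n.+1 -> G) -> M) :
  ucoch U f -> ucoch V (ctrace f).
Proof.
move=> [lf ef]; split.
  apply: (@locc_sum {ptws 'I_n.+1 -> G} _ _ _ (fun s x => act s (f (fun i => s^-1 * x i)%g))).
  by move=> s; exact: locc_const_act.
move=> g x Vg; rewrite /ctrace (big_morph (act g) (linD (act_linear g)) (lin0 (act_linear g))).
have := coset_reps_mul sUV Vg (th := fun s => act s (f (fun i => s^-1 * (g * x i))%g)).
move=> <-; last first.
  move=> y u _ Uu; rewrite actM; congr (act y _); rewrite -ef //; congr f.
  by apply/funext => i; rewrite invgM !mulgA mulgV mul1g.
apply: eq_bigr => s _; rewrite actM; congr (act g (act s (f _))).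
by apply/funext => i; rewrite invgM -mulgA mulKg.
Qed.

Lemma ctrace_dif (M : rep k G) n (f : ('I_n.+1 -> G) -> M) :
  bar_dif (ctrace f) = ctrace (bar_dif f).
Proof.
apply/funext => x; rewrite /ctrace /bar_dif.
under [RHS]eq_bigr => s _ do
  rewrite (big_morph (act s) (linD (act_linear s)) (lin0 (act_linear s))).
rewrite exchange_big; apply: eq_bigr => j _; rewrite scaler_sumr.
by apply: eq_bigr => s _; rewrite (linZ (act_linear s)).
Qed.

Lemma ctrace_hom (M N : rep k G) (L : M -> N) n (f : ('I_n.+1 -> G) -> M) x : is_hom L ->
  L (ctrace f x) = ctrace (fun x => L (f x)) x.
Proof.
move=> [lL eL]; rewrite /ctrace (big_morph L (linD lL) (lin0 lL)).
by apply: eq_bigr => s _; rewrite eL.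
Qed.

Lemma zig_trace p (J : nat -> rep k G) (d : forall n, J n -> J n.+1) z v :
  (forall n, is_hom (d n)) -> zig U (p := p) d z v ->
  zig V d (ctrace z) (\sum_(s <- coset_reps U V) act s v).
Proof.
elim: p J d z v => [|p IH] J d z v hd; first by move=> /= ->.
move=> [w [cw dw zw]]; exists (ctrace w); split.
- exact: ctrace_ucoch.
- by rewrite ctrace_dif dw.
- have := IH _ _ _ _ (fun n => hd n.+1) zw; congr zig; apply/funext => x.
  rewrite ctrace_hom // /ctrace scaler_sumr; apply: eq_bigr => s _.
  by rewrite (linZ (act_linear s)).
Qed.

Lemma zig_restrict p (J : nat -> rep k G) (d : forall n, J n -> J n.+1) z v :
  zig V (p := p) d z v -> zig U d z v.
Proof.
elim: p J d z v => [|p IH] J d z v //=.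
move=> [w [[lw ew] dw zw]]; exists w; split => //.
  by split => // u x /sUV; exact: ew.
exact: IH.
Qed.

Variables (IU : injres (Xind k U)) (IV : injres (Xind k V)).

Lemma zcocycle_res n (f : ('I_n.+1 -> G) -> Xind k V) : zcocycle V f ->
  zcocycle U (fun x => iotaX sUV (f x)).
Proof.
move=> [[lf ef] df]; split.
  apply: (ucoch_hom (iotaX_hom k sUV)); split => // u x /sUV; exact: ef.
by apply/funext => x; rewrite (bar_dif_lin _ _ (iotaX_hom k sUV).1) df (lin0 (iotaX_hom k sUV).1).
Qed.

Lemma zcocycle_cores n (f : ('I_n.+1 -> G) -> Xind k U) : zcocycle U f ->
  zcocycle V (fun x => piX V (ctrace f x)).
Proof.
move=> [cf df]; have [hp _] := piX_spec k sUV; split.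
  by apply: (ucoch_hom hp); exact: ctrace_ucoch.
apply/funext => x; rewrite (bar_dif_lin _ _ hp.1) ctrace_dif df.
rewrite /ctrace big1 ?(lin0 hp.1) // => s _; exact: (lin0 (act_linear s)).
Qed.

(** A zigzag for [V] is a zigzag for [U]; composing it with a chain map that
   lifts the inclusion gives one for the restricted class. *)
Lemma EZ_res n (B : EU IV n) f : EZ (U := V) B f ->
  EZ (U := U) (E_res sUV IU B) (fun x => iotaX sUV (f x)).
Proof.
move=> zf; have [hp pc] := piX_spec k sUV.
have cb := pre_cocycle hp (crepr_cocycle B).
rewrite /E_res; set y := ext_pre _ B.
have [F cF ->] := ext_post_spec IU (iotaX_hom k sUV) y.
have [hF Fd F0] := cF.
apply/EZ_cls; first exact: (chain_lift_cocycle cF (crepr_cocycle y)).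
have zy : EZ (U := U) y f.
  by apply/(EZ_cls _ cb); rewrite /= pc; exact: zig_restrict.
have := zig_map hF Fd zy; congr zig; apply/funext => x; exact: F0.
Qed.

(** The vector attached to A o iota is the trace over V / U of the vector
   attached to A, and zigzags are compatible with traces; a chain map that
   lifts the projection then carries the zigzag to the other resolution. *)
Lemma EZ_cores n (A : EU IU n) f : EZ (U := U) A f ->
  EZ (U := V) (E_cores sUV IV A) (fun x => piX V (ctrace f x)).
Proof.
move=> zf; have [hp pc] := piX_spec k sUV.
have ca := pre_cocycle (iotaX_hom k sUV) (crepr_cocycle A).
rewrite /E_cores; set y := ext_pre _ A.
have [F cF ->] := ext_post_spec IV hp y.
have [hF Fd F0] := cF.
apply/EZ_cls; first exact: (chain_lift_cocycle cF (crepr_cocycle y)).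
have zy : EZ (U := V) y (ctrace f).
  apply/(EZ_cls _ ca); rewrite /= hom_iota_char; last exact: (crepr_cocycle A).1.
  have := zig_trace (fun n => ir_dif_hom IU n) zf; congr zig; apply/funext => x.
  by rewrite (ctrace_hom _ _ (ir_aug_hom IU)).
have := zig_map hF Fd zy; congr zig; apply/funext => x; exact: F0.
Qed.

End Trace.

(** * Cup products of classes *)

Lemma coboundary_add (k : comPzRingType) (C : complex k) n (x y : cpx_amb C n) :
  coboundary x -> coboundary y -> coboundary (x + y).
Proof.
case: n x y => [x y /= -> ->|m x y /= [a Ca <-] [b Cb <-]]; first exact: addr0.
by exists (a + b); [exact: smD|rewrite (linD (@dif_linear _ _ _))].
Qed.

Section Cup.
Variables (k : comPzRingType) (H : topGroupType) (M : rep k H) (mul : M -> M -> M).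
Hypotheses (lr : forall v, linear (mul v)) (ll : forall w, linear (mul^~ w)).
Hypothesis mulE : forall h v w, mul (act h v) (act h w) = act h (mul v w).

(** The degree [n] of the product is left free, so that i + j.+1 and (i +
   j).+1 need no cast. *)
Definition cupc i j n (a : ('I_i.+1 -> H) -> M) (b : ('I_j.+1 -> H) -> M) :
    ('I_n.+1 -> H) -> M :=
  fun z => mul (a (fun r : 'I_i.+1 => z (inord r)))
               (b (fun r : 'I_j.+1 => z (inord (i + r)))).

Lemma leibniz i j (a : ('I_i.+1 -> H) -> M) (b : ('I_j.+1 -> H) -> M) :
  bar_dif (cupc (n := i + j) a b) =
  cupc (n := (i + j).+1) (bar_dif a) b + (-1) ^+ i *: cupc (n := (i + j).+1) a (bar_dif b).
Proof.
apply/funext => z.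
pose y (r : nat) := z (inord r).
pose a' (l : nat) := a (fun r : 'I_i.+1 => y (bump l r)).
pose b' (l : nat) := b (fun r : 'I_j.+1 => y (i + bump l r)%N).
change (\sum_(l < (i + j).+2) (-1) ^+ l *:
  mul (a (fun r : 'I_i.+1 => z (lift l (inord r))))
      (b (fun r : 'I_j.+1 => z (lift l (inord (i + r))))) =
  mul (\sum_(l < i.+2) (-1) ^+ l *: a' l) (b (fun r : 'I_j.+1 => y (i.+1 + r)%N)) +
  (-1) ^+ i *: mul (a (fun r : 'I_i.+1 => y r)) (\sum_(l < j.+2) (-1) ^+ l *: b' l)).
have b'0 : b (fun r : 'I_j.+1 => y (i.+1 + r)%N) = b' 0%N.
  by congr b; apply/funext => r; rewrite /bump /= addSnnS.
have a'i : a (fun r : 'I_i.+1 => y r) = a' i.+1.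
  by congr a; apply/funext => r; congr y; rewrite /bump; have := ltn_ord r; lia.
have e1 (l : 'I_(i + j).+2) (r : nat) : (r < (i + j).+1)%N ->
    z (lift l (inord r)) = y (bump l r).
  move=> rij; congr z; apply: val_inj; rewrite /= inordK // inordK //.
  exact: (ltn_ord (lift l (Ordinal rij))).
under eq_bigr => l _.
  have -> : (fun r : 'I_i.+1 => z (lift l (inord r))) = fun r => y (bump l r).
    by apply/funext => r; apply: e1; have := ltn_ord r; lia.
  have -> : (fun r : 'I_j.+1 => z (lift l (inord (i + r)))) =
      fun r => y (bump l (i + r)).
    by apply/funext => r; apply: e1; have := ltn_ord r; lia.
  over.
rewrite b'0 a'i.
rewrite -(big_mkord xpredT (fun l => (-1) ^+ l *: mul
  (a (fun r : 'I_i.+1 => y (bump l r)))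
  (b (fun r : 'I_j.+1 => y (bump l (i + r)))))).
rewrite (big_cat_nat (n := i.+1)) //=; last by lia.
have -> : \sum_(0 <= l < i.+1) (-1) ^+ l *: mul
    (a (fun r : 'I_i.+1 => y (bump l r)))
    (b (fun r : 'I_j.+1 => y (bump l (i + r)))) =
  mul (\sum_(l < i.+1) (-1) ^+ l *: a' l) (b' 0%N).
  rewrite [RHS](big_morph (mul^~ _) (linD (ll _)) (lin0 (ll _))) big_mkord.
  apply: eq_bigr => l _; rewrite (linZ (ll _)); congr (_ *: mul _ (b _)).
  by apply/funext => r; congr y; rewrite /bump; have := ltn_ord l; lia.
have -> : \sum_(i.+1 <= l < (i + j).+2) (-1) ^+ l *: mul
    (a (fun r : 'I_i.+1 => y (bump l r)))
    (b (fun r : 'I_j.+1 => y (bump l (i + r)))) =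
  (-1) ^+ i.+1 *: mul (a' i.+1) (\sum_(s < j.+1) (-1) ^+ s *: b' s.+1).
  rewrite [X in _ *: X](big_morph (mul _) (linD (lr _)) (lin0 (lr _))) scaler_sumr.
  rewrite -{1}[i.+1]add0n big_addn.
  have -> : ((i + j).+2 - i.+1)%N = j.+1 by lia.
  rewrite big_mkord; apply: eq_bigr => s _.
  rewrite (linZ (lr _)) scalerA -exprD.
  congr (_ ^+ _ *: mul (a _) (b _)); first by rewrite addnC.
  - by apply/funext => r; congr y; rewrite /bump; have := ltn_ord r; lia.
  - by apply/funext => r; congr y; rewrite /bump; lia.
rewrite [in RHS]big_ord_recr /= (linD (ll _)) (linZ (ll _)).
rewrite [X in _ = _ + _ *: mul _ X]big_ord_recl /= expr0 scale1r (linD (lr _)) scalerDr.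
rewrite -!addrA; congr (_ + _).
rewrite addrA exprS mulN1r !scaleNr addNr add0r -scalerN; congr (_ *: _).
rewrite -[LHS]scaleN1r -(linZ (lr _)); congr mul.
rewrite scaleN1r -sumrN; apply: eq_bigr => s _.
by rewrite /bump /= add1n exprS mulN1r scaleNr.
Qed.

Lemma cupc_cochain i j n (a : ('I_i.+1 -> H) -> M) (b : ('I_j.+1 -> H) -> M) :
  bar_cochain a -> bar_cochain b -> bar_cochain (cupc (n := n) a b).
Proof.
move=> [la ha] [lb hb]; split; last by move=> h x; rewrite /cupc -mulE -ha -hb.
apply: (@locc_op2 {ptws 'I_n.+1 -> H} _ _ _ mul).
  apply: (@locc_comp _ _ _ (fun x : {ptws 'I_n.+1 -> H} =>
    (fun r => x (inord r)) : {ptws 'I_i.+1 -> H}) a _ la).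
  by apply: (@ptws_continuous H) => r; exact: (@ptws_coord H).
apply: (@locc_comp _ _ _ (fun x : {ptws 'I_n.+1 -> H} =>
  (fun r => x (inord (i + r))) : {ptws 'I_j.+1 -> H}) b _ lb).
by apply: (@ptws_continuous H) => r; exact: (@ptws_coord H).
Qed.

Lemma cupc_lin_l i j n c (a a' : ('I_i.+1 -> H) -> M) (b : ('I_j.+1 -> H) -> M) :
  cupc (n := n) (c *: a + a') b = c *: cupc a b + cupc a' b.
Proof. by apply/funext => z; exact: (ll _). Qed.

Lemma cupc_lin_r i j n c (a : ('I_i.+1 -> H) -> M) (b b' : ('I_j.+1 -> H) -> M) :
  cupc (n := n) a (c *: b + b') = c *: cupc a b + cupc a b'.
Proof. by apply/funext => z; exact: (lr _). Qed.

Lemma cupc_0r i j n (a : ('I_i.+1 -> H) -> M) : cupc (j := j) (n := n) a 0 = 0.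
Proof. by apply/funext => z; exact: (lin0 (lr _)). Qed.

Lemma cupc_0l i j n (b : ('I_j.+1 -> H) -> M) : cupc (i := i) (n := n) 0 b = 0.
Proof. by apply/funext => z; exact: (lin0 (ll _)). Qed.

Let cob n (x : ('I_n.+1 -> H) -> M) := coboundary (C := bar M) (n := n) x.

Lemma cob_cup_l i j (a : ('I_i.+1 -> H) -> M) (b : ('I_j.+1 -> H) -> M) :
  cob a -> cocycle (C := bar M) (n := j) b -> cob (cupc (n := i + j) a b).
Proof.
case: i a => [|i] a; first by rewrite /cob /= => -> _; rewrite cupc_0l; exact: (@coboundary0 _ (bar M) _).
move=> [e ce <-] [cb db]; exists (cupc (n := i + j) e b).
  exact: cupc_cochain.
change (bar_dif (cupc (n := i + j) e b) = cupc (n := (i + j).+1) (bar_dif e) b).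
by rewrite leibniz (_ : bar_dif b = 0) // cupc_0r scaler0 addr0.
Qed.

Lemma cob_cup_r i j (a : ('I_i.+1 -> H) -> M) (b : ('I_j.+1 -> H) -> M) :
  cocycle (C := bar M) (n := i) a -> cob b -> cob (cupc (n := i + j) a b).
Proof.
case: j b => [|j] b; first by rewrite /cob /= => _ ->; rewrite cupc_0r; exact: (@coboundary0 _ (bar M) _).
move=> [ca da] [e ce <-].
suff h n : n = (i + j).+1 -> cob (cupc (n := n) a (bar_dif e)) by apply: h; rewrite addnS.
move=> ->; exists ((-1) ^+ i *: cupc (n := i + j) a e).
  exact/bar_cochainZ/cupc_cochain.
change (bar_dif ((-1) ^+ i *: cupc (n := i + j) a e) = cupc (n := (i + j).+1) a (bar_dif e)).
rewrite (linZ (@bar_dif_linear _ _ _ _)) leibniz (_ : bar_dif a = 0) // cupc_0l add0r.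
by rewrite scalerA -exprD addnn -mul2n exprM sqrrN !expr1n scale1r.
Qed.

Lemma cup_cls i j (a : ('I_i.+1 -> H) -> M) (b : ('I_j.+1 -> H) -> M) :
  cocycle (C := bar M) (n := i) a -> cocycle (C := bar M) (n := j) b ->
  cup mul (cls (C := bar M) (n := i) a) (cls (C := bar M) (n := j) b) =
  cls (C := bar M) (n := i + j) (cupc (n := i + j) a b).
Proof.
move=> ca cb; have ca' := crepr_cocycle (cls (C := bar M) (n := i) a).
have cb' := crepr_cocycle (cls (C := bar M) (n := j) b).
have /(clsP ca' ca) da := creprK (cls (C := bar M) (n := i) a).
have /(clsP cb' cb) db := creprK (cls (C := bar M) (n := j) b).
apply/clsP; [exact: (cup_cocycle lr ll mulE ca' cb')|exact: (cup_cocycle lr ll mulE ca cb)|].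
move: da db ca' cb'; rewrite /cup.
pose a' : ('I_i.+1 -> H) -> M := crepr (cls (C := bar M) (n := i) a).
pose b' : ('I_j.+1 -> H) -> M := crepr (cls (C := bar M) (n := j) b).
rewrite -/a' -/b' => da db ca' cb'.
have -> : (fun z => mul (a' (fun r : 'I_i.+1 => z (inord r)))
    (b' (fun r : 'I_j.+1 => z (inord (i + r))))) - cupc (n := i + j) a b =
  cupc (n := i + j) (a' - a) b' + cupc (n := i + j) a (b' - b).
  rewrite -[a' - a]addrC -[b' - b]addrC -!scaleN1r cupc_lin_l cupc_lin_r.
  rewrite !scaleN1r [X in _ = X + _]addrC [X in _ = _ + X]addrC addrA subrK.
  by [].
exact: coboundary_add (cob_cup_l da cb') (cob_cup_r ca db).
Qed.

End Cup.

(** * The prism homotopy *)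

Section Prism.
Variables (k : comPzRingType) (T S : topGroupType) (N : rep k T) (M : rep k S).
Variables (m : M -> N) (alpha beta : T -> S).
Hypothesis lm : linear m.

(** The vertices alpha y_0, ..., alpha y_i, beta y_i, beta y_{i+1}, ... of the
   [i]-th simplex of the prism. *)
Definition pword (y : nat -> T) (i l : nat) : S :=
  if (l <= i)%N then alpha (y l) else beta (y l.-1).

Definition prism n (f : ('I_n.+2 -> S) -> M) : ('I_n.+1 -> T) -> N :=
  fun t => m (\sum_(i < n.+1) (-1) ^+ i *: f (fun l => pword (fun r => t (inord r)) i l)).

Lemma pword_low y i j : (j <= i)%N -> pword (y \o bump j) i = pword y i.+1 \o bump j.
Proof.
move=> ji; apply/funext => l; rewrite /pword /bump /=.
case: (leqP j l) => jl.
  rewrite add1n ltnS; case: (leqP l i) => li //; congr (beta (y _)).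
  by rewrite (_ : (j <= l.-1)%N = true); lia.
rewrite add0n; have -> : (l <= i)%N by lia.
by have -> : (l <= i.+1)%N by lia.
Qed.

Lemma pword_high y i j : (i < j)%N -> pword (y \o bump j) i = pword y i \o bump j.+1.
Proof.
move=> ij; apply/funext => l; rewrite /pword /bump /=.
case: (ltnP j l) => jl.
  have -> : (l <= i)%N = false by lia.
  have -> : (1 + l <= i)%N = false by lia.
  have -> : (j <= l.-1)%N by lia.
  by congr (beta (y _)); lia.
rewrite add0n; case: (leqP l i) => li.
  by rewrite (_ : (j <= l)%N = false) //; lia.
by rewrite (_ : (j <= l.-1)%N = false) //; lia.
Qed.

(** The common face of two consecutive simplices of the prism. *)
Definition qword (y : nat -> T) (i l : nat) : S :=
  if (l < i)%N then alpha (y l) else beta (y l).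

Lemma pword_diag y i : pword y i \o bump i = qword y i.
Proof.
apply/funext => l; rewrite /pword /qword /bump /=; case: (leqP i l) => il.
  by rewrite add1n (_ : (l.+1 <= i)%N = false) //; lia.
by rewrite add0n (_ : (l <= i)%N = true) //; lia.
Qed.

Lemma pword_diagS y i : pword y i \o bump i.+1 = qword y i.+1.
Proof.
apply/funext => l; rewrite /pword /qword /bump /= ltnS; case: (ltnP i l) => il.
  by rewrite add1n (_ : (l.+1 <= i)%N = false) //; lia.
by rewrite add0n il.
Qed.

(** Sum the cocycle equations of all simplices of the prism: the faces shared
   by consecutive simplices telescope to the two ends, and the remaining ones
   form the differential of [prism f]. *)
Lemma prism_dif n (f : ('I_n.+2 -> S) -> M) t : bar_dif f = 0 ->
  bar_dif (prism f) t = m (f (fun l => beta (t l)) - f (fun l => alpha (t l))).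
Proof.
move=> df; pose y (r : nat) := t (inord r).
pose F (z : nat -> S) := f (fun l : 'I_n.+2 => z l).
have F0 z : \sum_(0 <= l < n.+3) (-1) ^+ l *: F (z \o bump l) = 0.
  rewrite big_mkord.
  by have := congr1 (fun g => g (fun i : 'I_n.+3 => z i)) df.
(* the terms of the differential of [prism f] *)
pose B (j i : nat) : M := (-1) ^+ (j + i) *: F (pword (y \o bump j) i).
have -> : bar_dif (prism f) t = m (\sum_(0 <= i < n.+1) \sum_(0 <= j < n.+2) B j i).
  rewrite exchange_big_nat /= big_mkord (big_morph m (linD lm) (lin0 lm)).
  apply: eq_bigr => j _; rewrite -(linZ lm) big_mkord; congr m.
  rewrite scaler_sumr; apply: eq_bigr => i _; rewrite scalerA -exprD; congr (_ *: f _).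
  apply/funext => l; rewrite /pword /= /y.
  have e (r : nat) : (r < n.+1)%N -> t (lift j (inord r)) = t (inord (bump j r)).
    move=> rn; congr t; apply: val_inj; rewrite /= !inordK //.
    exact: (ltn_ord (lift j (Ordinal rn))).
  have := ltn_ord l; have := ltn_ord i => hi hl.
  by case: (leqP l i) => li; rewrite e //; lia.
congr m.
(* the cocycle equation on the [i]-th simplex *)
have row i : (i < n.+2)%N ->
    F (qword y i.+1) - F (qword y i) =
    - \sum_(0 <= l < i) B l i.-1 - \sum_(i.+1 <= j < n.+2) B j i.
  move=> lin; have := F0 (pword y i) => r0.
  have {r0} : (-1) ^+ i *: \sum_(0 <= l < n.+3) (-1) ^+ l *: F (pword y i \o bump l) = 0.
    by rewrite r0 scaler0.
  rewrite scaler_sumr (big_cat_nat (n := i)) //=; last by lia.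
  rewrite [X in _ + X = _]big_ltn; last by lia.
  rewrite [X in _ + (_ + X) = _]big_ltn; last by lia.
  rewrite pword_diag pword_diagS !scalerA -!exprD addnn -mul2n exprM sqrrN !expr1n scale1r.
  rewrite addnS exprS addnn -mul2n exprM sqrrN !expr1n mulr1 scaleN1r.
  have -> : \sum_(0 <= l < i) (-1) ^+ i *: ((-1) ^+ l *: F (pword y i \o bump l)) =
      - \sum_(0 <= l < i) B l i.-1.
    rewrite -sumrN; apply: eq_big_nat => l /andP[_ li]; rewrite scalerA -exprD /B.
    rewrite pword_low; last by lia.
    have -> : i.-1.+1 = i by lia.
    have -> : (i + l = (l + i.-1).+1)%N by lia.
    by rewrite exprS mulN1r scaleNr.
  have -> : \sum_(i.+2 <= l < n.+3) (-1) ^+ i *: ((-1) ^+ l *: F (pword y i \o bump l)) =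
      - \sum_(i.+1 <= j < n.+2) B j i.
    rewrite big_add1 /= -sumrN; apply: eq_big_nat => l /andP[li _]; rewrite scalerA -exprD /B.
    rewrite pword_high; last by lia.
    have -> : (i + l.+1 = (l + i).+1)%N by lia.
    by rewrite exprS mulN1r scaleNr.
  set a := - \sum_(_ <= _ < i) _; set b := - \sum_(_ <= _ < _) _.
  set p := F _; set q := F _ => e.
  apply/eqP; rewrite eq_sym -subr_eq0; apply/eqP; rewrite -[RHS]e opprB.
  by rewrite -!addrA; congr (a + _); rewrite addrC -addrA.
have tele : F (qword y n.+2) - F (qword y 0) =
    \sum_(0 <= i < n.+2) (F (qword y i.+1) - F (qword y i)).
  by rewrite (telescope_sumr (fun i => F (qword y i))).
have qn : F (qword y n.+2) = f (fun l => alpha (t l)).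
  by congr f; apply/funext => l; rewrite /qword ltn_ord /y inord_val.
have q0 : F (qword y 0) = f (fun l => beta (t l)).
  by congr f; apply/funext => l; rewrite /qword ltn0 /y inord_val.
rewrite -q0 -qn -opprB tele.
rewrite [X in _ = - X](eq_big_nat _ _ (F2 := fun i => - (\sum_(0 <= l < i) B l i.-1 + \sum_(i.+1 <= j < n.+2) B j i))); last first.
  by move=> i /andP[_ li]; rewrite row // opprD.
rewrite sumrN opprK big_split /=.
rewrite [X in _ = X + _]big_ltn // [X in _ = X + _ + _]big_geq // add0r big_add1 /=.
rewrite [X in _ = _ + X]big_nat_recr //= [X in _ = _ + (_ + X)]big_geq // addr0.
rewrite -big_split /=; apply: eq_big_nat => i /andP[_ li].
by rewrite (big_cat_nat (n := i.+1)) //=; lia.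
Qed.

End Prism.

(** * Functoriality on representing cocycles *)

Section Pull.
Variables (k : comPzRingType) (H H' : topGroupType) (M : rep k H) (M' : rep k H').
Variables (phi : H' -> H) (m : M -> M').
Hypotheses (cphi : continuous phi) (phiM : forall x y, phi (x * y)%g = (phi x * phi y)%g).
Hypotheses (lm : linear m) (mE : forall h v, m (act (phi h) v) = act h (m v)).

Lemma pull_cochain n (c : ('I_n.+1 -> H) -> M) : bar_cochain c ->
  bar_cochain (M := M') (fun z => m (c (phi \o z))).
Proof.
move=> [lc hc]; split.
  apply: (@locc_post {ptws 'I_n.+1 -> H'} _ _ (fun z => c (phi \o z)) m).
  apply: (@locc_comp _ _ _ (fun x : {ptws 'I_n.+1 -> H'} =>
    phi \o x : {ptws 'I_n.+1 -> H}) c _ lc).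
  apply: (@ptws_continuous H) => i x.
  apply: (@continuous_comp _ _ _ (fun x : {ptws 'I_n.+1 -> H'} => x i) phi).
    exact: (@ptws_coord H').
  exact: cphi.
move=> h x; rewrite -mE -hc; congr (m (c _)).
by apply/funext => i; exact: phiM.
Qed.

Lemma pull_dif n (c : ('I_n.+1 -> H) -> M) z :
  bar_dif (M := M') (fun z => m (c (phi \o z))) z = m (bar_dif c (phi \o z)).
Proof.
rewrite /bar_dif (big_morph m (linD lm) (lin0 lm)).
by apply: eq_bigr => j _; rewrite (linZ lm).
Qed.

Lemma pull_coboundary n (c : ('I_n.+1 -> H) -> M) :
  coboundary (C := bar M) (n := n) c ->
  coboundary (C := bar M') (n := n) (fun z => m (c (phi \o z))).
Proof.
case: n c => [|n] c /=.
  by move=> ->; apply/funext => z; exact: (lin0 lm).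
move=> [b cb <-]; exists (fun z => m (b (phi \o z))); first exact: pull_cochain.
by apply/funext => z; exact: pull_dif.
Qed.

Lemma pull_cls n (c : ('I_n.+1 -> H) -> M) : cocycle (C := bar M) (n := n) c ->
  pull (M' := M') phi m (cls (C := bar M) (n := n) c) =
  cls (C := bar M') (n := n) (fun z => m (c (phi \o z))).
Proof.
move=> cc; have cc' := crepr_cocycle (cls (C := bar M) (n := n) c).
have /(clsP cc' cc) /pull_coboundary cob := creprK (cls (C := bar M) (n := n) c).
apply/clsP; [exact: (pull_cocycle cphi phiM lm mE cc')|exact: (pull_cocycle cphi phiM lm mE cc)|].
move: cob; congr coboundary; apply/funext => z.
rewrite -[LHS]/(m ((crepr (cls (C := bar M) (n := n) c) : ('I_n.+1 -> H) -> M) (phi \o z) - c (phi \o z))).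
by rewrite -scaleN1r addrC lm scaleN1r addrC.
Qed.

End Pull.

(** * Shapiro's lemma *)

Section Shapiro.
Variables (k : comPzRingType) (G : topGroupType) (U : ocsubgroup G).

Lemma conjI_open g : open (sg_set (conjI U g)).
Proof.
apply: openI; first exact: oc_open.
have -> : [set (g * u * g^-1)%g | u in sg_set U] = [set x | sg_set U (g^-1 * x * g)%g].
  apply/predeqP => x; split=> [[u Uu <-]|Ux] /=.
    by rewrite !mulgA mulVg mul1g mulgVK.
  by exists (g^-1 * x * g)%g => //; rewrite !mulgA mulgV mul1g mulgK.
have c : continuous (fun x : G => g^-1 * x * g)%g.
  exact: (continuousM (@mul_continuous G g^-1%g) (@continuous_cst _ _ g)).
by move/continuousP: c => /(_ _ (@oc_open G U)).
Qed.

Lemma conjI_incl_continuous g : continuous (@conjI_incl G U g).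
Proof. apply: sg_continuous; exact: (@sg_val_continuous G (conjI U g)). Qed.

Lemma conjI_inclM g x y : @conjI_incl G U g (x * y)%g = (conjI_incl x * conjI_incl y)%g.
Proof. exact: val_inj. Qed.

Lemma conjI_conj_continuous g : continuous (@conjI_conj G U g).
Proof.
apply: sg_continuous => /=.
apply: continuousM; last exact: continuous_cst.
apply: continuousM; [exact: continuous_cst|exact: (@sg_val_continuous G (conjI U g^-1%g))].
Qed.

Lemma conjI_conjM g x y : @conjI_conj G U g (x * y)%g = (conjI_conj x * conjI_conj y)%g.
Proof. by apply: val_inj; rewrite /= !mulgA mulgVK. Qed.

Lemma xval_conjI g (phi : Xind k U) h : sg_set (conjI U g) h ->
  xval phi (h * g)%g = xval phi g.
Proof.
move=> [_ [u Uu <-]]; rewrite mulgVK.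
by rewrite (xvalP phi).1.
Qed.

Lemma ev_act g (h : conjI U g) (v : Xdc k U g) :
  xval (xg_incl (act (conjI_incl h) v)) g = xval (xg_incl v) g.
Proof.
change (xval (xg_incl v) ((\val h)^-1 * g)%g = xval (xg_incl v) g).
by rewrite xval_conjI //; apply: (sgV (sg_mem h)).
Qed.

Lemma shapiro_cls g n (c : ('I_n.+1 -> U) -> Xdc k U g) :
  cocycle (C := bar (Xdc k U g)) (n := n) c ->
  shapiro (cls (C := bar (Xdc k U g)) (n := n) c) =
  cls (C := bar (triv_rep k (conjI U g))) (n := n)
    (fun z => xval (xg_incl (c (@conjI_incl G U g \o z))) g).
Proof.
move=> cc.
have lm : linear ((fun v : Xdc k U g => xval (xg_incl v) g) : Xdc k U g -> triv_rep k (conjI U g)).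
  move=> a v w; exact: (xval_linear g a (xg_incl v) (xg_incl w)).
exact: (pull_cls (@conjI_incl_continuous g) (@conjI_inclM g) lm (@ev_act g) cc).
Qed.

Lemma dcoset_id g : dcoset U g g.
Proof. by exists 1%g; [exact: sg1|exists 1%g; [exact: sg1|rewrite mul1g mulg1]]. Qed.

(** Some u in [U] with t in u g U. *)
Definition dc_left (g t : G) : G :=
  xget 1%g [set u | sg_set U u /\ exists2 v, sg_set U v & (u * g * v)%g = t].

Lemma dc_leftP g t : dcoset U g t -> sg_set U (dc_left g t) /\
  exists2 v, sg_set U v & (dc_left g t * g * v)%g = t.
Proof.
move=> [u Uu [v Uv e]]; rewrite /dc_left; case: xgetP => [y _ //|/(_ u)] [].
by split => //; exists v.
Qed.

Lemma dcoset_mem g t u v : sg_set U u -> sg_set U v ->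
  dcoset U g (u * t * v)%g <-> dcoset U g t.
Proof.
move=> Uu Uv; split=> -[a Ua [b Ub e]].
  exists (u^-1 * a)%g; first exact: sgM (sgV Uu) Ua.
  exists (b * v^-1)%g; first exact: sgM Ub (sgV Uv).
  by rewrite !mulgA -(mulgA _ a g) -(mulgA _ (a * g)%g b) e !mulgA mulVg mul1g mulgK.
exists (u * a)%g; first exact: sgM.
exists (b * v)%g; first exact: sgM.
by rewrite -e !mulgA.
Qed.

Lemma compact_dcoset g : compact (dcoset U g).
Proof.
have -> : dcoset U g = (fun uv : G * G => uv.1 * g * uv.2)%g @` (sg_set U `*` sg_set U).
  apply/predeqP => x; split=> [[u Uu [v Uv <-]]|[[u v] [/= Uu Uv] <-]].
    by exists (u, v).
  by exists u => //; exists v.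
apply: continuous_compact; last by apply: compact_setX; exact: oc_compact.
apply: continuous_subspaceT; apply: continuousM; last by move=> x; exact: cvg_snd.
by apply: continuousM => x; [exact: cvg_fst|exact: cvg_cst].
Qed.

Section Spread.
Variables (g : G) (n : nat) (e : ('I_n.+1 -> U) -> k).
Hypothesis le : @locc {ptws 'I_n.+1 -> U} k e.
Hypothesis ie : forall (u : U) x, sg_set (conjI U g) (\val u) ->
  e (fun i => u * x i)%g = e x.

Let toU (u : G) : U := insubd 1%g u.

Let toUK u : sg_set U u -> \val (toU u) = u.
Proof. by move=> Uu; rewrite insubdK //; exact: mem_set. Qed.

(** Inverse of the Shapiro isomorphism on cochains: e is moved from g to the
   other points of U g U by equivariance. *)
Definition spread_fun (x : 'I_n.+1 -> U) (t : G) : k :=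
  if t \in dcoset U g then e (fun i => (toU (dc_left g t))^-1 * x i)%g else 0.

(** The element u is only determined up to U_g on the right, under which [e]
   is invariant. *)
Lemma spread_funE x (u : U) v : sg_set U v ->
  spread_fun x (\val u * g * v)%g = e (fun i => u^-1 * x i)%g.
Proof.
move=> Uv; have dt : dcoset U g (\val u * g * v)%g.
  by apply/dcoset_mem => //; [exact: sg_mem|exact: dcoset_id].
rewrite /spread_fun mem_set //; have [Uw [w' Uw' ew]] := dc_leftP dt.
set w := dc_left _ _ in Uw ew *.
rewrite -[RHS](ie (u := ((toU w)^-1 * u)%g)).
  by congr e; apply/funext => i; rewrite mulgA mulgK.
split; first exact: sg_mem.
exists (w' * v^-1)%g; first exact: sgM Uw' (sgV Uv).
rewrite /= toUK //.
have -> : w' = ((w * g)^-1 * (\val u * g * v))%g by rewrite -ew mulKg.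
by rewrite invgM !mulgA mulgK mulgV mul1g mulgK.
Qed.

Lemma spread_comp_ind x : comp_ind U (spread_fun x : G -> k^o).
Proof.
split=> [t v Uv|]; last first.
  by exists (dcoset U g); [exact: compact_dcoset|move=> t nt; rewrite /spread_fun memNset].
have mt : ((t * v)%g \in dcoset U g) = (t \in dcoset U g).
  apply/idP/idP => /set_mem h; apply/mem_set; move: h.
    by rewrite -[(t * v)%g]mul1g mulgA => /(dcoset_mem _ _ (sg1 U) Uv).
  by move=> h; rewrite -[(t * v)%g]mul1g mulgA; apply/dcoset_mem => //; exact: sg1.
have [dt|dt] := pselect (dcoset U g t); last first.
  by rewrite /spread_fun mt memNset.
have [u Uu [w Uw <-]] := dt.
rewrite -(toUK Uu) -mulgA spread_funE ?spread_funE //; exact: sgM.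
Qed.

Definition spreadX (x : 'I_n.+1 -> U) : Xind k U := mkX (spread_comp_ind x).

Lemma spread_supp x : supp_in g (spreadX x).
Proof. by move=> t nt; rewrite /xval /= /spread_fun memNset. Qed.

Definition spread (x : 'I_n.+1 -> U) : Xdc k U g :=
  exist _ (spreadX x) (mem_set (spread_supp x)).

(** At a point t = u g v the value depends on u in the compact group [U], so
   that local constancy is uniform in t. *)
Lemma spread_cochain : bar_cochain spread.
Proof.
have [r [cr rM rK]] := retraction (@oc_open G U).
split.
  move=> x.
  pose w (sx : G * {ptws 'I_n.+1 -> U}) : {ptws 'I_n.+1 -> U} :=
    fun i => ((r sx.1)^-1 * sx.2 i)%g.
  have cw : continuous w.
    apply: (@ptws_continuous U) => i; apply: (@continuousM U).
      apply: (@continuousV U) => sx.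
      by apply: (@continuous_comp _ _ _ fst r); [exact: cvg_fst|exact: cr].
    move=> sx; apply: (@continuous_comp _ _ _ snd (fun x : {ptws 'I_n.+1 -> U} => x i)).
      exact: cvg_snd.
    exact: (@ptws_coord U).
  have n1 := locc_tube (x := x : {ptws 'I_n.+1 -> U}) (@oc_compact G U)
    (fun s _ => locc_comp cw le (s, _)).
  apply: (nbhs_sub n1) => x' /= ex'; apply: val_inj; apply: val_inj; apply/funext => t.
  change (spread_fun x' t = spread_fun x t).
  have [dt|dt] := pselect (dcoset U g t); last by rewrite /spread_fun memNset.
  have [u Uu [v Uv <-]] := dt.
  have := ex' u Uu; rewrite /w /= -{1 2 3 4}(toUK Uu) rK => E.
  by rewrite !spread_funE.
move=> h x; apply: val_inj; apply: val_inj; apply/funext => t.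
change (spread_fun (fun i => h * x i)%g t = spread_fun x ((\val h)^-1 * t)%g).
have Uh := sg_mem h.
have [dt|dt] := pselect (dcoset U g t); last first.
  rewrite /spread_fun !memNset // => dt'; apply: dt; move: dt'.
  by rewrite -[((\val h)^-1 * t)%g]mulg1 => /(dcoset_mem _ _ (sgV Uh) (sg1 U)).
have [u Uu [v Uv <-]] := dt.
rewrite -(toUK Uu) spread_funE // !mulgA -[((\val h)^-1 * _)%g]/(\val (h^-1 * toU u)%g).
rewrite spread_funE //; congr e; apply/funext => i.
by rewrite invgM invgK mulgA.
Qed.

End Spread.
End Shapiro.

Section ShapiroInjective.
Variables (k : comPzRingType) (G : topGroupType) (U : ocsubgroup G) (g : G).

Definition evXdc (v : Xdc k U g) : k := xval (xg_incl v) g.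

Lemma evXdc_linear (H : topGroupType) :
  linear (evXdc : Xdc k U g -> triv_rep k H).
Proof. by move=> a v w; exact: (xval_linear g a (xg_incl v) (xg_incl w)). Qed.

Lemma evXdcB v w : evXdc (v - w) = evXdc v - evXdc w.
Proof. by rewrite -[v - w]addrC -scaleN1r (evXdc_linear U) scaleN1r addrC. Qed.

(** [U] acts transitively on the left cosets of [U] in U g U, so an
   equivariant function is determined by its values at g. *)
Lemma Xdc_ext n (d d' : ('I_n.+1 -> U) -> Xdc k U g) :
  homogeneous d -> homogeneous d' -> (forall x, evXdc (d x) = evXdc (d' x)) -> d = d'.
Proof.
move=> hd hd' e; apply/funext => x; apply: val_inj; apply: val_inj; apply/funext => t.
change (xval (xg_incl (d x)) t = xval (xg_incl (d' x)) t).
have [[u Uu [v Uv <-]]|dt] := pselect (dcoset U g t); last first.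
  by rewrite (set_mem (valP (d x)) _ dt) (set_mem (valP (d' x)) _ dt).
rewrite ((xvalP (xg_incl (d x))).1 (u * g)%g v Uv) ((xvalP (xg_incl (d' x))).1 (u * g)%g v Uv).
pose u' : U := exist _ u (mem_set Uu).
have tr (c : ('I_n.+1 -> U) -> Xdc k U g) : homogeneous c ->
    xval (xg_incl (c x)) (u * g)%g = evXdc (c (fun i => u'^-1 * x i)%g).
  move=> hc; rewrite hc /evXdc.
  change (xval (xg_incl (c x)) (u * g)%g = xval (xg_incl (c x)) ((\val (u'^-1)%g)^-1 * g)%g).
  by rewrite /= invgK.
by rewrite !tr.
Qed.

(** The given primitive lives on powers of U_g only. Composed with a
   retraction of [U] to U_g, it is a primitive of the composed cocycle, which
   a prism connects to the given one; the resulting invariant primitive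
   spreads over U g U. *)
Lemma shapiro_coboundary n (d : ('I_n.+1 -> U) -> Xdc k U g) :
  cocycle (C := bar (Xdc k U g)) (n := n) d ->
  coboundary (C := bar (triv_rep k (conjI U g))) (n := n)
    (fun z => evXdc (d (@conjI_incl G U g \o z))) ->
  coboundary (C := bar (Xdc k U g)) (n := n) d.
Proof.
case: n d => [|n] d [[ld hd] dd].
  move=> /= e0.
  change (d = 0); apply: Xdc_ext => // [h x|x].
    by rewrite (lin0 (act_linear _)).
  have := congr1 (fun f => f (hcons 1%g x)) dd.
  change (bar_dif d (hcons 1%g x) = 0 -> evXdc (d x) = evXdc 0).
  rewrite /bar_dif big_ord_recl big_ord1 hcons_lift0 hcons1_lift expr0 scale1r.
  rewrite /= scaleN1r => /eqP; rewrite subr_eq0 => /eqP ->.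
  have := congr1 (fun f => f (fun=> 1%g)) e0; rewrite /=.
  change (evXdc (d (@conjI_incl G U g \o (fun=> 1%g))) = 0 -> evXdc (d (fun=> 1%g)) = 0).
  by move=> <-; congr (evXdc (d _)); apply/funext => i; apply: val_inj.
move=> [b [lb hb] eb].
have [r [cr rM rK]] := retraction (@conjI_open G U g).
pose rU (u : U) : U := conjI_incl (r (\val u)).
have crv : continuous (fun u : U => r (\val u)).
  move=> u; exact: (@continuous_comp U G (conjI U g) \val r u (@sg_val_continuous _ _ u) (cr _)).
have crU : continuous rU.
  move=> u; apply: (@continuous_comp _ _ _ (fun u : U => r (\val u)) (@conjI_incl G U g)).
    exact: crv.
  exact: conjI_incl_continuous.
(* the prism from the retraction to the identity, corrected by the primitive [b] of
   the retracted cocycle *)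
pose e (x : 'I_n.+1 -> U) : k :=
  prism (N := triv_rep k U) (evXdc : Xdc k U g -> triv_rep k U) rU id d x +
  b (fun i => r (\val (x i))).
have le : @locc {ptws 'I_n.+1 -> U} k e.
  apply: (@locc_op2 {ptws 'I_n.+1 -> U} _ _ _ +%R); last first.
    apply: (@locc_comp _ _ _ (fun x : {ptws 'I_n.+1 -> U} =>
      (fun i => r (\val (x i))) : {ptws 'I_n.+1 -> conjI U g}) b _ lb).
    apply: (@ptws_continuous (conjI U g)) => i x.
    apply: (@continuous_comp _ _ _ (fun x : {ptws 'I_n.+1 -> U} => x i) (fun u : U => r (\val u))).
      exact: (@ptws_coord U).
    exact: crv.
  apply: (@locc_post {ptws 'I_n.+1 -> U} _ _ _ evXdc).
  apply: (@locc_sum {ptws 'I_n.+1 -> U} _ _ _ (fun (i : 'I_n.+1) t =>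
     (-1) ^+ i *: d (fun l => pword rU id (fun r => t (inord r)) i l))) => i.
  apply: (@locc_post {ptws 'I_n.+1 -> U} _ _ _ (fun v => (-1) ^+ i *: v)).
  apply: (@locc_comp _ _ _ (fun t : {ptws 'I_n.+1 -> U} =>
    (fun l : 'I_n.+2 => pword rU id (fun r => t (inord r)) i l) : {ptws 'I_n.+2 -> U}) d _ ld).
  apply: (@ptws_continuous U) => l; rewrite /pword; case: (l <= i)%N.
    move=> x; apply: (@continuous_comp _ _ _ (fun x : {ptws 'I_n.+1 -> U} => x (inord l)) rU).
      exact: (@ptws_coord U).
    exact: crU.
  exact: (@ptws_coord U).
have ie (u : U) x : sg_set (conjI U g) (\val u) -> e (fun i => u * x i)%g = e x.
  move=> Uu; pose u' : conjI U g := exist _ (\val u) (mem_set Uu).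
  have rUM y : rU (u * y)%g = (u * rU y)%g.
    by apply: val_inj; rewrite /rU /= -[(\val u * _)%g]/(\val u' * \val y)%g rM.
  congr (_ + _); last first.
    rewrite -[RHS](hb u' (fun i => r (\val (x i)))); congr b.
    by apply/funext => i; rewrite -rM.
  rewrite /prism !(big_morph _ (linD (evXdc_linear U)) (lin0 (evXdc_linear U))).
  apply: eq_bigr => i _; rewrite !(linZ (evXdc_linear U)); apply: (congr1 (fun w : triv_rep k U => (-1) ^+ i *: w)).
  have -> : (fun l : 'I_n.+2 => pword rU id (fun r => u * x (inord r))%g i l) =
     fun l => (u * pword rU id (fun r => x (inord r)) i l)%g.
    by apply/funext => l; rewrite /pword; case: ifP.
  rewrite hd; have -> : u = conjI_incl u' by apply: val_inj.
  exact: ev_act.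
exists (spread ie); first exact: (spread_cochain le ie).
change (bar_dif (spread ie) = d).
apply: Xdc_ext => //.
  by apply: homogeneous_dif; exact: (spread_cochain le ie).2.
move=> x.
have -> : evXdc (bar_dif (spread ie) x) = bar_dif (M := triv_rep k U) e x.
  rewrite -[LHS](@bar_dif_lin k U _ (triv_rep k U)); last exact: evXdc_linear.
  apply: (congr1 (fun h : ('I_n.+1 -> U) -> triv_rep k U => bar_dif h x)); apply/funext => z.
  change (spread_fun g e z g = e z).
  have := spread_funE ie z 1%g (sg1 U); rewrite mul1g mulg1 => ->.
  by congr e; apply/funext => i; rewrite invg1 mul1g.
have -> : bar_dif (M := triv_rep k U) e x =
  bar_dif (prism (N := triv_rep k U) (evXdc : Xdc k U g -> triv_rep k U) rU id d) x +
  bar_dif (M := triv_rep k U) (fun x => b (fun i => r (\val (x i))) : triv_rep k U) x.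
  rewrite /bar_dif -big_split /=; apply: eq_bigr => j _; exact: scalerDr.
rewrite (prism_dif _ _ (evXdc_linear U) x dd).
have -> : bar_dif (M := triv_rep k U) (fun x => b (fun i => r (\val (x i))) : triv_rep k U) x =
   evXdc (d (fun l => rU (x l))).
  exact: (congr1 (fun f => f (fun i => r (\val (x i)))) eb).
have := linD (evXdc_linear U) (d x - d (fun l => rU (x l))) (d (fun l => rU (x l))).
by rewrite subrK => ->.
Qed.

Lemma shapiro_cocycle n (c : ('I_n.+1 -> U) -> Xdc k U g) :
  cocycle (C := bar (Xdc k U g)) (n := n) c ->
  cocycle (C := bar (triv_rep k (conjI U g))) (n := n)
     (fun z => evXdc (c (@conjI_incl G U g \o z))).
Proof.
move=> cc.
exact: (pull_cocycle (@conjI_incl_continuous G U g) (@conjI_inclM G U g)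
    (evXdc_linear (conjI U g)) (@ev_act k G U g) cc).
Qed.

Lemma shapiro_inj n : injective (@shapiro k G U g n).
Proof.
have rep (x : Hc (Xdc k U g) n) : exists2 c : ('I_n.+1 -> U) -> Xdc k U g,
    cocycle (C := bar (Xdc k U g)) (n := n) c & x = cls (C := bar (Xdc k U g)) (n := n) c.
  by exists (crepr x); [exact: crepr_cocycle|rewrite creprK].
move=> x y; have [c cc ->] := rep x; have [c' cc' ->] := rep y.
rewrite !shapiro_cls //.
move/(clsP (shapiro_cocycle cc) (shapiro_cocycle cc')) => e; apply/(clsP cc cc'); apply: shapiro_coboundary.
  by rewrite -scaleN1r; apply: cocycleD => //; exact: cocycleZ.
have E : (fun z => evXdc (c (@conjI_incl G U g \o z))) - (fun z => evXdc (c' (@conjI_incl G U g \o z))) =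
    (fun z => evXdc (c (@conjI_incl G U g \o z) - c' (@conjI_incl G U g \o z)))
    :> (('I_n.+1 -> conjI U g) -> triv_rep k (conjI U g)).
  by apply/funext => z; rewrite evXdcB.
exact: (eq_ind _ (fun h => coboundary (C := bar (triv_rep k (conjI U g))) (n := n) h) e _ E).
Qed.

End ShapiroInjective.

(** * The involution exchanges the two variables *)

Section Swap.
Variables (k : comPzRingType) (G : topGroupType) (U : ocsubgroup G).

Definition bounded n (f : ('I_n.+1 -> G) -> Xind k U) : Prop :=
  exists2 K, compact K & forall x t, ~ K t -> xval (f x) t = 0.

Definition swap_fun n (f : ('I_n.+1 -> G) -> Xind k U) (x : 'I_n.+1 -> G) (t : G) : k :=
  xval (f (fun i => t^-1 * x i)%g) t^-1%g.

(** The involution on cocycles. With f (x; s, t) for f (s^-1 x) (s^-1 t), a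
   G-invariant function of its three arguments, it exchanges s and t. *)
Definition swap n (f : ('I_n.+1 -> G) -> Xind k U) (x : 'I_n.+1 -> G) : Xind k U :=
  insubd (0 : sm_type (@comp_inds k G U)) (swap_fun f x : G -> k^o).

Lemma compact_inv (K : set G) : compact K -> compact [set t^-1%g | t in K].
Proof.
move=> cK; apply: continuous_compact => //.
by apply: continuous_subspaceT => x; exact: invg_continuous.
Qed.

Section Model.
Variables (n : nat) (f : ('I_n.+1 -> G) -> Xind k U).
Hypotheses (zf : zcocycle U f) (bf : bounded f).

Lemma swap_comp_ind x : comp_ind U (swap_fun f x : G -> k^o).
Proof.
have [[lf ef] _] := zf; have [K cK fK] := bf; split.
  move=> t u Uu; rewrite /swap_fun invgM.
  have -> : (fun i => u^-1 * t^-1 * x i)%g = (fun i => u^-1 * (t^-1 * x i))%g.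
    by apply/funext => i; rewrite mulgA.
  rewrite ef; last exact: sgV.
  change (xval (f (fun i => t^-1 * x i)%g) (u^-1^-1 * (u^-1 * t^-1))%g =
    xval (f (fun i => t^-1 * x i)%g) t^-1%g).
  by rewrite mulKg.
exists [set t^-1%g | t in K]; first exact: compact_inv.
move=> t nt; apply: fK => Kt; apply: nt.
by exists t^-1%g; rewrite ?invgK.
Qed.

Lemma swapE x t : xval (swap f x) t = xval (f (fun i => t^-1 * x i)%g) t^-1%g.
Proof.
rewrite /xval /swap.
by rewrite (insubdK (0 : sm_type (@comp_inds k G U)) (mem_set (swap_comp_ind x))).
Qed.

Lemma swap_bounded : bounded (swap f).
Proof.
have [K cK fK] := bf; exists [set t^-1%g | t in K]; first exact: compact_inv.
move=> x t nt; rewrite swapE; apply: fK => Kt; apply: nt.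
by exists t^-1%g; rewrite ?invgK.
Qed.

Lemma swap_zcocycle : zcocycle U (swap f).
Proof.
have [[lf ef] df] := zf; have [K cK fK] := swap_bounded.
split; first split.
- move=> x.
  pose w (tx : G * {ptws 'I_n.+1 -> G}) : {ptws 'I_n.+1 -> G} :=
    fun i => (tx.1^-1 * tx.2 i)%g.
  have cw : continuous w.
    apply: (@ptws_continuous G) => i; apply: continuousM.
      by apply: continuousV => tx; exact: cvg_fst.
    move=> tx; apply: (@continuous_comp _ _ _ snd (fun x : {ptws 'I_n.+1 -> G} => x i)).
      exact: cvg_snd.
    exact: (@ptws_coord G).
  have n1 := locc_tube (x := x : {ptws 'I_n.+1 -> G}) cK (fun s _ => locc_comp cw lf (s, _)).
  apply: (nbhs_sub n1) => x' /= ex'; apply: val_inj; apply/funext => t.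
  change (xval (swap f x') t = xval (swap f x) t).
  have [Kt|Kt] := pselect (K t); last by rewrite !fK.
  have := ex' t Kt; rewrite /w /= => E.
  by rewrite !swapE E.
- move=> u x Uu; apply: val_inj; apply/funext => t.
  change (xval (swap f (fun i => u * x i)%g) t = xval (swap f x) (u^-1 * t)%g).
  rewrite !swapE invgM invgK (xvalP _).1 //.
  by congr (xval (f _) _); apply/funext => i; rewrite mulgA.
- apply/funext => x; apply: val_inj; apply/funext => t.
  have -> : \val (bar_dif (swap f) x) t = xval (bar_dif (swap f) x) t by [].
  rewrite /bar_dif (big_morph (fun v : Xind k U => xval v t : k^o) (linD (xval_linear t)) (lin0 (xval_linear t))).
  have := congr1 (fun h => xval (h (fun i => t^-1 * x i)%g) t^-1%g) df.
  rewrite /bar_dif (big_morph (fun v : Xind k U => xval v t^-1%g : k^o) (linD (xval_linear t^-1%g)) (lin0 (xval_linear t^-1%g))).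
  move=> E; rewrite -[RHS]E; apply: eq_bigr => j _.
  change ((-1) ^+ j * xval (swap f (x \o lift j)) t =
    (-1) ^+ j * xval (f ((fun i => t^-1 * x i)%g \o lift j)) t^-1%g).
  by rewrite swapE.
Qed.

End Model.

Lemma dcoset_act g (u : U) t : ((\val u)^-1 * t)%g \in dcoset U g = (t \in dcoset U g).
Proof.
have Uu := sg_mem u; rewrite -[((\val u)^-1 * t)%g]mulg1.
by apply/idP/idP => /set_mem h; apply/mem_set; move: h;
  move/(dcoset_mem _ _ (sgV Uu) (sg1 U)).
Qed.

Lemma xg_proj_linear g : linear (@xg_proj k G U g).
Proof.
move=> a v w; apply: val_inj; apply: val_inj; apply/funext => t.
change ((if t \in dcoset U g then a * xval v t + xval w t else 0) =
  a * (if t \in dcoset U g then xval v t else 0) + (if t \in dcoset U g then xval w t else 0)).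
by case: ifP => _ //; rewrite mulr0 addr0.
Qed.

Lemma xg_proj_act g (u : U) (v : res_rep (Xind k U) U) :
  xg_proj g (act (id u) v) = act u (xg_proj g v).
Proof.
apply: val_inj; apply: val_inj; apply/funext => t.
change ((if t \in dcoset U g then xval v ((\val u)^-1 * t)%g else 0) =
  (if ((\val u)^-1 * t)%g \in dcoset U g then xval v ((\val u)^-1 * t)%g else 0)).
by rewrite dcoset_act.
Qed.

Lemma xg_incl_linear g : linear (@xg_incl k G U g).
Proof. by []. Qed.

Lemma xg_incl_act g (u : U) (v : Xdc k U g) : xg_incl (act (id u) v) = act u (xg_incl v).
Proof. by []. Qed.

Let XU := res_rep (Xind k U) U.

Lemma hc_proj_cls g n (c : ('I_n.+1 -> U) -> XU) :
  cocycle (C := bar XU) (n := n) c ->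
  cocycle (C := bar (Xdc k U g)) (n := n) (fun z => xg_proj g (c z)) /\
  hc_proj g (cls (C := bar XU) (n := n) c) =
    cls (C := bar (Xdc k U g)) (n := n) (fun z => xg_proj g (c z)).
Proof.
move=> cc; split.
  exact: (pull_cocycle (@continuous_id U) (fun _ _ => erefl) (xg_proj_linear g) (@xg_proj_act g) cc).
exact: (pull_cls (@continuous_id U) (fun _ _ => erefl) (xg_proj_linear g) (@xg_proj_act g) cc).
Qed.

Lemma hc_incl_cls g n (c : ('I_n.+1 -> U) -> Xdc k U g) :
  cocycle (C := bar (Xdc k U g)) (n := n) c ->
  cocycle (C := bar XU) (n := n) (fun z => xg_incl (c z)) /\
  hc_incl (cls (C := bar (Xdc k U g)) (n := n) c) =
    cls (C := bar XU) (n := n) (fun z => xg_incl (c z)).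
Proof.
move=> cc; split.
  exact: (pull_cocycle (@continuous_id U) (fun _ _ => erefl) (@xg_incl_linear g) (@xg_incl_act g) cc).
exact: (pull_cls (@continuous_id U) (fun _ _ => erefl) (@xg_incl_linear g) (@xg_incl_act g) cc).
Qed.

Lemma conj_star_cls g n (c : ('I_n.+1 -> conjI U g) -> triv_rep k (conjI U g)) :
  cocycle (C := bar (triv_rep k (conjI U g))) (n := n) c ->
  cocycle (C := bar (triv_rep k (conjI U g^-1%g))) (n := n)
    (fun z => c (@conjI_conj G U g \o z)) /\
  conj_star (cls (C := bar (triv_rep k (conjI U g))) (n := n) c) =
    cls (C := bar (triv_rep k (conjI U g^-1%g))) (n := n) (fun z => c (@conjI_conj G U g \o z)).
Proof.
have lid : linear (id : triv_rep k (conjI U g) -> triv_rep k (conjI U g^-1%g)) by [].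
move=> cc; split.
  exact: (pull_cocycle (@conjI_conj_continuous G U g) (@conjI_conjM G U g) lid (fun _ _ => erefl) cc).
exact: (pull_cls (@conjI_conj_continuous G U g) (@conjI_conjM G U g) lid (fun _ _ => erefl) cc).
Qed.

Lemma evX_linear g (H : topGroupType) : linear (fun v : Xind k U => xval v g : triv_rep k H).
Proof. exact: xval_linear. Qed.

(** Right translation of the arguments by g^-1 is homotopic to the identity by
   a prism, which is still invariant under the conjugate of U_g because it
   only involves translations on the other side. *)
Lemma translate_coboundary g n (f : ('I_n.+1 -> G) -> Xind k U) : zcocycle U f ->
  let T := conjI U g^-1%g in
  coboundary (C := bar (triv_rep k T)) (n := n)
    ((fun z => xval (f (fun i => g * \val (z i : T) * g^-1)%g) g) -
     (fun z => xval (f (fun i => g * \val (z i : T))%g) g)).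
Proof.
move=> zf T.
pose al (x : T) : G := (g * \val x)%g.
pose be (x : T) : G := (g * \val x * g^-1)%g.
have [[lf ef] df] := zf.
have inv (h : T) : (fun y : G => (g * \val h * y)%g) = fun y => (g * \val h * g^-1 * (g * y))%g.
  by apply/funext => y; rewrite mulgA mulgVK.
have Uh (h : T) : sg_set U (g * \val h * g^-1)%g by case: (sg_mem (conjI_conj h)).
case: n f zf lf ef df => [|n] f zf lf ef df.
  apply/funext => z.
  change (xval (f (fun i => be (z i))) g - xval (f (fun i => al (z i))) g = 0).
  have := congr1 (fun h => h (hcons (be (z ord0)) (fun i => al (z i)))) df.
  change (bar_dif f (hcons (be (z ord0)) (fun i => al (z i))) = 0 -> 
    xval (f (fun i => be (z i))) g - xval (f (fun i => al (z i))) g = 0).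
  rewrite /bar_dif big_ord_recl big_ord1 hcons_lift0 hcons1_lift expr0 scale1r.
  rewrite /= scaleN1r => /eqP; rewrite subr_eq0 => /eqP ->.
  have -> : (fun i => be (z i)) = fun=> be (z ord0) by apply/funext => i; rewrite (ord1 i).
  by rewrite subrr.
exists (prism (N := triv_rep k T) (fun v : Xind k U => xval v g : triv_rep k T) al be f).
  split.
    apply: (@locc_post {ptws 'I_n.+1 -> T} _ _ _ (fun v : Xind k U => xval v g)).
    apply: (@locc_sum {ptws 'I_n.+1 -> T} _ _ _ (fun (i : 'I_n.+1) t =>
       (-1) ^+ i *: f (fun l => pword al be (fun r => t (inord r)) i l))) => i.
    apply: (@locc_post {ptws 'I_n.+1 -> T} _ _ _ (fun v => (-1) ^+ i *: v)).
    apply: (@locc_comp _ _ _ (fun t : {ptws 'I_n.+1 -> T} =>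
      (fun l : 'I_n.+2 => pword al be (fun r => t (inord r)) i l) : {ptws 'I_n.+2 -> G}) f _ lf).
    have cv l : continuous (fun t : {ptws 'I_n.+1 -> T} => \val (t l) : G).
      move=> x; exact: (@continuous_comp {ptws 'I_n.+1 -> T} T G (fun t => t l) \val x
        (@ptws_coord T _ l x) (@sg_val_continuous _ _ _)).
    apply: (@ptws_continuous G) => l; rewrite /pword; case: (l <= i)%N.
      exact: (continuousM (@continuous_cst _ _ g) (cv _)).
    exact: (continuousM (continuousM (@continuous_cst _ _ g) (cv _)) (@continuous_cst _ _ _)).
  move=> h x; rewrite /prism !(big_morph _ (linD (evX_linear g T)) (lin0 (evX_linear g T))).
  apply: eq_bigr => i _; rewrite !(linZ (evX_linear g T)).
  apply: (congr1 (fun w : triv_rep k T => (-1) ^+ i *: w)).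
  have -> : (fun l : 'I_n.+2 => pword al be (fun r => h * x (inord r))%g i l) =
     fun l => (g * \val h * g^-1 * pword al be (fun r => x (inord r)) i l)%g.
    apply/funext => l; rewrite /pword; case: ifP => _; rewrite /al /be /=.
      by rewrite !mulgA mulgVK.
    by rewrite !mulgA mulgVK.
  rewrite ef //.
  set v := f _.
  change (xval v ((g * \val h * g^-1)^-1 * g)%g = xval v g).
  rewrite !invgM invgK -!mulgA mulVg mulg1 (xvalP v).1 //.
  by apply: sgV; case: (sg_mem h).
apply/funext => z.
apply: etrans (prism_dif al be (evX_linear g T) z df) _.
set v := f _; set w := f _.
have e : xval (-1 *: w + v) g = -1 * xval w g + xval v g by exact: (evX_linear g T (-1) w v).
rewrite scaleN1r mulN1r addrC [RHS]addrC in e.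
exact: e.
Qed.

(** Both sides are pulled back from [f]: the left one along x |-> g x g^-1 and
   the right one, where the arguments s and t are exchanged, along x |-> g x.
   *)
Lemma invol_term g n (f : ('I_n.+1 -> G) -> Xind k U) : zcocycle U f -> bounded f ->
  conj_star (shapiro (hc_proj g (cls (C := bar XU) (n := n) (resU f)))) =
  shapiro (hc_proj g^-1%g (cls (C := bar XU) (n := n) (resU (swap f)))).
Proof.
move=> zf bf; have zs := swap_zcocycle zf bf.
have [c1 ->] := hc_proj_cls g (resU_cocycle zf).
have [c2 ->] := hc_proj_cls g^-1%g (resU_cocycle zs).
rewrite !shapiro_cls //.
have [c3 ->] := conj_star_cls (shapiro_cocycle c1).
have c4 := shapiro_cocycle c2.
apply/(clsP c3 c4).
pose T := conjI U g^-1%g.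
pose al (x : T) : G := (g * \val x)%g.
pose be (x : T) : G := (g * \val x * g^-1)%g.
pose A (z : 'I_n.+1 -> T) : triv_rep k T := xval (f (fun i => be (z i))) g.
pose B (z : 'I_n.+1 -> T) : triv_rep k T := xval (f (fun i => al (z i))) g.
have AE : (fun z => evXdc (xg_proj g (resU f (@conjI_incl G U g \o (@conjI_conj G U g \o z))))) = A.
  apply/funext => z; rewrite /A.
  change ((if g \in dcoset U g then xval (f (fun i => be (z i))) g else 0) = xval (f (fun i => be (z i))) g).
  by rewrite mem_set //; exact: dcoset_id.
have BE : (fun z => evXdc (xg_proj g^-1%g (resU (swap f) (@conjI_incl G U g^-1%g \o z)))) = B.
  apply/funext => z; rewrite /B.
  change ((if g^-1%g \in dcoset U g^-1%g then xval (swap f (fun i => \val (z i))) g^-1%g else 0) =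
     xval (f (fun i => al (z i))) g).
  rewrite mem_set; last exact: dcoset_id.
  by rewrite (swapE zf bf) invgK.
have tc : coboundary (C := bar (triv_rep k T)) (n := n) (A - B) := translate_coboundary g zf.
by rewrite -AE -BE in tc.
Qed.

End Swap.

Section Involution.
Variables (k : comPzRingType) (G : topGroupType) (U : ocsubgroup G).

Let XU := res_rep (Xind k U) U.

Lemma cls_sum n (I : Type) (s : seq I) (F : I -> ('I_n.+1 -> U) -> XU) :
  (forall i, cocycle (C := bar XU) (n := n) (F i)) ->
  \sum_(i <- s) cls (C := bar XU) (n := n) (F i) =
  cls (C := bar XU) (n := n) (\sum_(i <- s) F i).
Proof.
move=> cF; have clsD x y : cocycle (C := bar XU) (n := n) x -> cocycle (C := bar XU) (n := n) y ->
    cls (C := bar XU) (n := n) (x + y) = cls x + cls y.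
  move=> cx cy; rewrite /cls -qpiD; congr qpi; apply: val_inj.
  have iK z : cocycle (C := bar XU) (n := n) z ->
      \val (insubd (0 : cocycles (bar XU) n) z) = z.
    by move=> cz; rewrite insubdK //; exact: mem_set.
  change (\val (insubd (0 : cocycles (bar XU) n) (x + y)) =
    \val (insubd (0 : cocycles (bar XU) n) x) + \val (insubd (0 : cocycles (bar XU) n) y)).
  by rewrite !iK //; exact: cocycleD.
elim: s => [|i s IH].
  rewrite !big_nil; apply: (addIr (cls (C := bar XU) (n := n) 0)).
  by rewrite -clsD ?add0r //; exact: cocycle0.
have cs : cocycle (C := bar XU) (n := n) (\sum_(i <- s) F i).
  elim: (s) => [|j t IHt]; first by rewrite big_nil; exact: cocycle0.
  by rewrite big_cons; exact: cocycleD.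
by rewrite !big_cons IH clsD.
Qed.

Lemma dcoset_eq g t : dcoset U g t -> dcoset U t = dcoset U g.
Proof.
move=> [u Uu [v Uv <-]]; apply/predeqP => x; split=> -[a Ua [b Ub <-]].
  exists (a * u)%g; first exact: sgM.
  by exists (v * b)%g; [exact: sgM|rewrite !mulgA].
exists (a * u^-1)%g; first exact: sgM Ua (sgV Uu).
exists (v^-1 * b)%g; first exact: sgM (sgV Uv) Ub.
by rewrite !mulgA mulgVK mulgK.
Qed.

Lemma dcoset_inv g t : dcoset U g^-1%g t -> dcoset U g t^-1%g.
Proof.
move=> [u Uu [v Uv <-]]; exists v^-1%g; first exact: sgV.
by exists u^-1%g; [exact: sgV|rewrite !invgM invgK mulgA].
Qed.

Definition dc_repr (D : set G) : G := xget 1%g D.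

Lemma dc_reprP D : range (dcoset U) D -> dcoset U (dc_repr D) = D.
Proof.
move=> [g _ <-]; apply: dcoset_eq; rewrite /dc_repr.
by case: xgetP => [y _ //|/(_ g)] []; exact: dcoset_id.
Qed.

(** By [invol_term] and the injectivity of the Shapiro map, the term of the
   double coset of g is the part of [swap f] on the double coset of g^-1. Only
   finitely many double cosets meet the common support of the values, and the
   parts add up to [swap f]. *)
Lemma hc_invol_cls n (f : ('I_n.+1 -> G) -> Xind k U) : zcocycle U f -> bounded f ->
  hc_invol (cls (C := bar XU) (n := n) (resU f)) =
  cls (C := bar XU) (n := n) (resU (swap f)).
Proof.
move=> zf bf; have zs := swap_zcocycle zf bf; have cs := resU_cocycle zs.
have [K cK fK] := swap_bounded zf bf.
pose T (D : set G) (z : 'I_n.+1 -> U) : XU := xcut (dc_repr D)^-1%g (resU (swap f) z).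
have cT D : cocycle (C := bar XU) (n := n) (T D).
  have [c1 _] := hc_proj_cls (dc_repr D)^-1%g cs.
  by have [] := hc_incl_cls c1.
have -> : hc_invol (cls (C := bar XU) (n := n) (resU f)) =
    \sum_(D \in range (dcoset U)) cls (C := bar XU) (n := n) (T D).
  apply: eq_fsbigr => D _; rewrite -/(dc_repr D) /= invol_term //.
  set g := (dc_repr D)^-1%g.
  have -> y : shapiro_inv (shapiro y) = y :> Hc (Xdc k U g) n.
    rewrite /shapiro_inv; case: xgetP => [x _ /shapiro_inj//|/(_ y)].
    by move=> /(_ erefl).
  have [c1 ->] := hc_proj_cls g cs.
  by have [_ ->] := hc_incl_cls c1.
have Dloc : locc (fun t : G => dcoset U t^-1%g).
  apply: (@locc_right G U) => t u Uu; apply: dcoset_eq; rewrite invgM.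
  by exists u^-1%g; [exact: sgV|exists 1%g; [exact: sg1|rewrite mulg1]].
(* finitely many double cosets contain the inverse of an element of [K] *)
have [s sK] := locc_finite cK Dloc.
pose r := undup [seq dcoset U t^-1%g | t <- s].
have TE D z t : range (dcoset U) D -> xval (T D z) t =
    if D == dcoset U t^-1%g then xval (swap f (fun i => \val (z i))) t else 0.
  move=> rD.
  change ((if t \in dcoset U (dc_repr D)^-1%g then xval (swap f (fun i => \val (z i))) t else 0) =
    if D == dcoset U t^-1%g then xval (swap f (fun i => \val (z i))) t else 0).
  congr (if _ then _ else _); apply/idP/eqP => [/set_mem dt|DE]; last first.
    apply/mem_set; rewrite -[t]invgK; apply: dcoset_inv; rewrite invgK.
    by rewrite (dc_reprP rD) DE; exact: dcoset_id.
  by rewrite (dcoset_eq (dcoset_inv dt)) dc_reprP.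
have rr t : K t -> dcoset U t^-1%g \in r.
  by move=> /sK[y ys ->]; rewrite mem_undup; exact: map_f.
rewrite (fsbigE r); first last.
- move=> D rD /negP Dr.
  have -> : T D = 0.
    apply/funext => z; apply: val_inj; apply/funext => t.
    change (xval (T D z) t = 0); rewrite TE //; case: eqP => // DE.
    have [Kt|Kt] := pselect (K t); last exact: fK.
    by exfalso; apply: Dr; rewrite DE; exact: rr.
  have := @cls_sum n bool [::] (fun=> 0) (fun=> cocycle0 (bar XU) n).
  by rewrite !big_nil.
- by move=> D; rewrite /= mem_undup => /mapP[t _ ->]; exists t^-1%g.
- exact: undup_uniq.
rewrite -big_filter cls_sum //; congr cls; apply/funext => z.
apply: val_inj; apply/funext => t.
pose q := [seq D <- r | D \in range (dcoset U)].
change (xval ((\sum_(D <- q) T D) z) t = xval (resU (swap f) z) t).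
have -> : (\sum_(D <- q) T D) z = \sum_(D <- q) T D z by rewrite fct_sumE.
rewrite (big_morph (fun v : Xind k U => xval v t : k^o) (linD (xval_linear t)) (lin0 (xval_linear t))).
rewrite (eq_big_seq (fun D => if D == dcoset U t^-1%g then xval (swap f (fun i => \val (z i))) t else 0)); last first.
  by move=> D; rewrite mem_filter => /andP[/set_mem rD _]; exact: TE.
rewrite -big_mkcond /=.
have [Kt|Kt] := pselect (K t); last first.
  by rewrite [RHS]fK // big1 // => D _; exact: fK.
have Dq : dcoset U t^-1%g \in q.
  by rewrite mem_filter rr // andbT; apply/mem_set; exists t^-1%g.
rewrite -big_filter (_ : [seq D <- q | D == dcoset U t^-1%g] = [:: dcoset U t^-1%g]) ?big_seq1 //.
have uq : uniq q by rewrite filter_uniq // undup_uniq.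
exact: (filter_pred1_uniq uq Dq).
Qed.

End Involution.

(** * The three identities *)

Section Main.
Variables (k : comPzRingType) (G : topGroupType) (U V : ocsubgroup G).
Hypothesis sUV : sg_set U `<=` sg_set V.
Variables (IU : injres (Xind k U)) (IV : injres (Xind k V)).

(** A locally constant function on a power of the compact group [W] takes
   finitely many values. *)
Lemma locc_bounded (W : ocsubgroup G) n (f : ('I_n.+1 -> G) -> Xind k W)
    (c : ('I_n.+1 -> W) -> res_rep (Xind k W) W) :
  loc_const c -> (forall x, exists y, f x = c y) -> bounded f.
Proof.
move=> lc fc.
have [s sc] := locc_finite (@sg_compact_power G W n) (lc : @locc {ptws 'I_n.+1 -> W} _ c).
have [K cK sK] : exists2 K, compact K & forall y, y \in s -> forall t, ~ K t -> xval (c y) t = 0.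
  elim: (s) => [|y t [K cK tK]]; first by exists set0 => //; exact: compact0.
  have [_ [L cL yL]] := xvalP (c y); exists (K `|` L); first exact: compactU.
  move=> z; rewrite inE => /orP[/eqP -> x /not_orP[_ Lx]|zt x /not_orP[Kx _]]; first exact: yL.
  exact: tK.
exists K => // x t Kt; have [y ->] := fc x.
by have [//|y' y's ->] := sc y; exact: sK.
Qed.

Lemma EZ_bounded (W : ocsubgroup G) (I : injres (Xind k W)) n (e : EU I n) :
  exists f, [/\ zcocycle W f, EZ (U := W) e f & bounded f].
Proof.
have [f [zf ef [c lc fc]]] := EZ_exists_extended (@smooth_X k G W) e.
by exists f; split => //; exact: locc_bounded lc fc.
Qed.

Lemma xmulE (W : ocsubgroup G) (v w : Xind k W) t : xval (xmul v w) t = xval v t * xval w t.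
Proof. by []. Qed.

Lemma Xind_ext (W : ocsubgroup G) (v w : Xind k W) : (forall t, xval v t = xval w t) -> v = w.
Proof. by move=> e; apply: val_inj; apply/funext. Qed.

Lemma xmul_linear_r (W : ocsubgroup G) (v : Xind k W) : linear (xmul v).
Proof.
move=> a x y; apply: Xind_ext => t.
change (xval v t * (a * xval x t + xval y t) = a * (xval v t * xval x t) + xval v t * xval y t).
by rewrite mulrDr mulrCA.
Qed.

Lemma xmul_linear_l (W : ocsubgroup G) (w : Xind k W) : linear ((@xmul k G W)^~ w).
Proof.
move=> a x y; apply: Xind_ext => t.
change ((a * xval x t + xval y t) * xval w t = a * (xval x t * xval w t) + xval y t * xval w t).
by rewrite mulrDl mulrA.
Qed.

Lemma xmul_act (W : ocsubgroup G) (h : G) (v w : Xind k W) :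
  xmul (act h v) (act h w) = act h (xmul v w).
Proof. exact: Xind_ext. Qed.

Definition gcup (W : ocsubgroup G) i j (a : ('I_i.+1 -> G) -> Xind k W)
    (b : ('I_j.+1 -> G) -> Xind k W) : ('I_(i + j).+1 -> G) -> Xind k W :=
  cupc (M := Xind k W) (@xmul k G W) a b.

Lemma gcup_zcocycle (W : ocsubgroup G) i j (a : ('I_i.+1 -> G) -> Xind k W)
    (b : ('I_j.+1 -> G) -> Xind k W) :
  zcocycle W a -> zcocycle W b -> zcocycle W (gcup a b).
Proof.
move=> [[la ea] da] [[lb eb] db].
split; last first.
  rewrite /gcup leibniz; [|exact: xmul_linear_r|exact: xmul_linear_l].
  rewrite da db cupc_0l; last exact: xmul_linear_l.
  by rewrite cupc_0r ?scaler0 ?addr0 //; exact: xmul_linear_r.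
split; last by move=> u x Wu; rewrite /gcup /cupc -xmul_act -ea // -eb.
apply: (@locc_op2 {ptws 'I_(i + j).+1 -> G} _ _ _ (@xmul k G W)).
  apply: (@locc_comp _ _ _ (fun x : {ptws 'I_(i + j).+1 -> G} =>
    (fun r => x (inord r)) : {ptws 'I_i.+1 -> G}) a _ la).
  by apply: (@ptws_continuous G) => r; exact: (@ptws_coord G).
apply: (@locc_comp _ _ _ (fun x : {ptws 'I_(i + j).+1 -> G} =>
  (fun r => x (inord (i + r))) : {ptws 'I_j.+1 -> G}) b _ lb).
by apply: (@ptws_continuous G) => r; exact: (@ptws_coord G).
Qed.

Lemma EZ_cup (W : ocsubgroup G) (I : injres (Xind k W)) i j (A : EU I i) (B : EU I j) a b :
  zcocycle W a -> zcocycle W b -> EZ (U := W) A a -> EZ (U := W) B b ->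
  EZ (U := W) (E_cup A B) (gcup a b).
Proof.
move=> za zb eA eB; have sX := @smooth_X k G W.
rewrite /E_cup (ext_to_hc_EZ sX za eA) (ext_to_hc_EZ sX zb eB).
have xact (h : W) (v w : res_rep (Xind k W) W) :
  @xmul k G W (act h v) (act h w) = act h (xmul v w : res_rep (Xind k W) W).
  exact: (@xmul_act W (\val h)).
rewrite (@cup_cls k W (res_rep (Xind k W) W) (@xmul k G W) (@xmul_linear_r W)
  (@xmul_linear_l W) xact i j _ _ (resU_cocycle za) (resU_cocycle zb)).
exact: (hc_to_ext_EZ I (gcup_zcocycle za zb)).
Qed.

Lemma EZ_invol (W : ocsubgroup G) (I : injres (Xind k W)) n (A : EU I n) a :
  zcocycle W a -> bounded a -> EZ (U := W) A a -> EZ (U := W) (E_invol A) (swap a).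
Proof.
move=> za ba eA; rewrite /E_invol (ext_to_hc_EZ (@smooth_X k G W) za eA) hc_invol_cls //.
exact: (hc_to_ext_EZ I (swap_zcocycle za ba)).
Qed.

Definition gcores n (f : ('I_n.+1 -> G) -> Xind k U) : ('I_n.+1 -> G) -> Xind k V :=
  fun x => piX V (ctrace U V f x).

Lemma gcores_val n (f : ('I_n.+1 -> G) -> Xind k U) x t :
  xval (gcores f x) t = \sum_(w <- coset_reps U V) \sum_(v <- coset_reps U V)
    xval (f (fun i => v^-1 * x i)%g) (v^-1 * (t * w))%g.
Proof.
rewrite /gcores (piX_val sUV); apply: eq_bigr => w _; rewrite /ctrace.
by rewrite (big_morph (fun v : Xind k U => xval v (t * w)%g : k^o)
  (linD (xval_linear _)) (lin0 (xval_linear _))).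
Qed.

Lemma gcores_bounded n (f : ('I_n.+1 -> G) -> Xind k U) : bounded f -> bounded (gcores f).
Proof.
move=> [K cK fK]; pose h (p : G * (G * G)) : G := (p.1 * p.2.1 * p.2.2^-1)%g.
exists (h @` (sg_set V `*` (K `*` sg_set V))).
  apply: continuous_compact; last first.
    by apply: compact_setX; [exact: oc_compact|apply: compact_setX => //; exact: oc_compact].
  have c1 : continuous (fun p : G * (G * G) => p.1) by move=> p; exact: cvg_fst.
  have c2 : continuous (fun p : G * (G * G) => p.2.1).
    by move=> p; apply: (@continuous_comp _ _ _ snd fst); [exact: cvg_snd|exact: cvg_fst].
  have c3 : continuous (fun p : G * (G * G) => p.2.2).
    by move=> p; apply: (@continuous_comp _ _ _ snd snd); exact: cvg_snd.
  apply: continuous_subspaceT.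
  exact: (continuousM (continuousM c1 c2) (continuousV c3)).
move=> x t nt; rewrite gcores_val big_seq big1 // => w Rw; rewrite big_seq big1 // => v Rv.
apply: fK => Kt; apply: nt; exists (v, (v^-1 * (t * w), w))%g => /=.
  by split; [|split]; rewrite //=; exact: (coset_reps_sub sUV).
by rewrite /h /= mulVKg mulgK.
Qed.

(** In the three-variable form, corestriction sums over the translates of s
   and of t by V / U, and this double sum is symmetric. *)
Lemma swap_gcores n (f : ('I_n.+1 -> G) -> Xind k U) : zcocycle U f -> bounded f ->
  swap (gcores f) = gcores (swap f).
Proof.
move=> zf bf; apply/funext => x; apply: Xind_ext => t.
rewrite (swapE (zcocycle_cores sUV zf) (gcores_bounded bf)) !gcores_val exchange_big /=.
apply: eq_bigr => w _; apply: eq_bigr => v _.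
rewrite (swapE zf bf) !invgM invgK.
congr (xval (f _) _); last by rewrite mulgA.
by apply/funext => i; rewrite !mulgA mulgK.
Qed.

Lemma swap_iota n (f : ('I_n.+1 -> G) -> Xind k V) : zcocycle V f -> bounded f ->
  swap (fun x => iotaX sUV (f x)) = fun x => iotaX sUV (swap f x).
Proof.
move=> zf bf; apply/funext => x; apply: Xind_ext => t.
rewrite (swapE (zcocycle_res sUV zf)); last by have [K cK fK] := bf; exists K.
change (xval (f (fun i => t^-1 * x i)%g) t^-1%g = xval (swap f x) t).
by rewrite (swapE zf bf).
Qed.

(** By V-equivariance and right V-invariance the factor [b] is the same in all
   terms of the double sum. *)
Lemma gcores_gcup i j (a : ('I_i.+1 -> G) -> Xind k U) (b : ('I_j.+1 -> G) -> Xind k V) :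
  zcocycle V b ->
  gcores (gcup a (fun x => iotaX sUV (b x))) = gcup (gcores a) b.
Proof.
move=> [[lb eb] _]; apply/funext => x; apply: Xind_ext => t.
rewrite /gcup /cupc [RHS]xmulE !gcores_val mulr_suml big_seq [RHS]big_seq.
apply: eq_bigr => w Rw; rewrite mulr_suml big_seq [RHS]big_seq.
apply: eq_bigr => v Rv; rewrite xmulE; congr (_ * _).
have Vw := coset_reps_sub sUV Rw; have Vv := coset_reps_sub sUV Rv.
set y := (fun r : 'I_j.+1 => x (inord (i + r))).
change (xval (b (fun r => v^-1 * y r)%g) (v^-1 * (t * w))%g = xval (b y) t).
rewrite eb; last exact: sgV.
change (xval (b y) (v^-1^-1 * (v^-1 * (t * w)))%g = xval (b y) t).
by rewrite mulKg (xvalP (b y)).1.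
Qed.

End Main.

Theorem proposition2p18 (k : comPzRingType) (G : topGroupType)
    (hG : locally_profinite G) (U V : ocsubgroup G)
    (sUV : sg_set U `<=` sg_set V)
    (IU : injres (Xind k U)) (IV : injres (Xind k V)) :
  (forall (i j : nat) (A : EU IU i) (B : EU IV j),
     E_cores sUV IV (E_cup A (E_res sUV IU B)) = E_cup (E_cores sUV IV A) B) /\
  (forall (n : nat) (B : EU IV n),
     E_invol (E_res sUV IU B) = E_res sUV IU (E_invol B)) /\
  (forall (n : nat) (A : EU IU n),
     E_invol (E_cores sUV IV A) = E_cores sUV IV (E_invol A)).
Proof.
split; [|split].
- move=> i j A B; have [a [za eA ba]] := EZ_bounded A; have [b [zb eB bb]] := EZ_bounded B.
  have zb' := zcocycle_res sUV zb; have eB' := EZ_res sUV IU eB.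
  have l := EZ_cores sUV IV (EZ_cup za zb' eA eB').
  have r := EZ_cup (zcocycle_cores sUV za) zb (EZ_cores sUV IV eA) eB.
  apply: (EZ_inj l); move: r; rewrite -/(gcores V a) -gcores_gcup //; exact.
- move=> n B; have [b [zb eB bb]] := EZ_bounded B.
  have l := EZ_res sUV IU (EZ_invol zb bb eB).
  have bb' : bounded (fun x => iotaX sUV (b x)) by have [K cK fK] := bb; exists K.
  have r := EZ_invol (zcocycle_res sUV zb) bb' (EZ_res sUV IU eB).
  by rewrite (swap_iota sUV zb bb) in r; exact: EZ_inj r l.
- move=> n A; have [a [za eA ba]] := EZ_bounded A.
  have l := EZ_cores sUV IV (EZ_invol za ba eA).
  have r := EZ_invol (zcocycle_cores sUV za) (gcores_bounded sUV ba) (EZ_cores sUV IV eA).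
  have e := swap_gcores sUV za ba; rewrite /gcores in e; rewrite e in r.
  exact: EZ_inj r l.
Qed.
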